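(* Let $\mathfrak s$ be a symmetry jet on a manifold $M$, let $\nabla=\nabla^{\mathfrak s}$ with torsion $T^\nabla$ and curvature $R^\nabla$. Let $\xi\in\mathcal B^{(1)}$ be a $1$-jet that preserves the torsion of $\nabla$, let $x=\alpha(\xi)$, let $X_x,Y_x,Z_x\in T_xM$ extend to vector fields $X,Y,Z$, and let $\mathfrak X=Z_{**_{Y_x}}Y_{*_x}X_x\in T^3M$. Then $$\Pi\bigl(\mathbb S(\xi)\cdot\mathfrak X,\;\kappa(\mathbb S(\xi))\cdot\mathfrak X\bigr)=\xi\bigl(R^\nabla(X_x,Y_x)Z_x\bigr)-R^\nabla(\xi X_x,\xi Y_x)\,\xi Z_x .$$ In particular, if $\xi$ preserves the torsion tensor $T^\nabla$ and the curvature tensor $R^\nabla$, the affine extension $\mathbb S(\xi)$ is $\kappa$-invariant, i.e. $\kappa(\mathbb S(\xi))=\mathbb S(\xi)$.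
   Context: All objects are smooth. $\mathcal B^{(1)}$ is the Lie groupoid over $M$ of linear isomorphisms $\xi:T_xM\to T_yM$, source $\alpha(\xi)=x$, target $\beta(\xi)=y$; $-I_x=-\mathrm{id}_{T_xM}$. A local bisection of a Lie groupoid $G\rightrightarrows M$ is a section $b:U\to G$ of $\alpha$ over an open $U$ with $b^0:=\beta\circ b$ a diffeomorphism onto an open set; the $1$-jets $j^1_xb$ of local bisections of $G$ form a Lie groupoid over $M$. $\mathcal B^{(1,1)}_{nh}$ (resp. $\mathcal B^{(1,1,1)}_{nh}$) is the groupoid of $1$-jets of local bisections of $\mathcal B^{(1)}$ (resp. of $\mathcal B^{(1,1)}_{nh}$). On $\mathcal B^{(1,1)}_{nh}$: $p(j^1_xb)=b(x)$, $p_*(j^1_xb)=(b^0)_{*_x}$; $\mathcal B^{(1,1)}_{sh}=\{p=p_*\}$. On $\mathcal B^{(1,1,1)}_{nh}$: $p(j^1_xb)=b(x)$, $p_*(j^1_xb)=j^1_x(p\circ b)$, $p_{**}(j^1_xb)=j^1_x(p_*\circ b)$; $\mathcal B^{(1,1,1)}=\{p=p_*=p_{**}\in\mathcal B^{(1,1)}_{sh}\}$. A symmetry jet is a smooth section $\mathfrak s:M\to\mathcal B^{(1,1)}_{sh}$, $\mathfrak s(x)$ being a jet at $x$ with $p(\mathfrak s(x))=-I_x$. With $(bY)_{b^0(x')}=b(x')Y_{x'}$, $(\nabla^{\mathfrak s}_XY)_x=\frac12[X,Y+s_xY]_x$ where $\mathfrak s(x)=j^1_xs_x$. Each $\xi\in\mathcal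 B^{(1)}$ with $\alpha(\xi)=x$ has a unique extension $S(\xi)=j^1_xa\in\mathcal B^{(1,1)}_{sh}$ with $p(S(\xi))=\xi$ that is affine: $\xi(\nabla_{X_x}Y)=\nabla_{\xi X_x}(aY)$ for all $X_x,Y$. $\mathbb S(\xi)=j^1_x(S\circ a)\in\mathcal B^{(1,1,1)}$, for any such $a$. Iterated tangent bundles: $T^kM=T(T^{k-1}M)$; $Y_*:TM\to T^2M$ is the differential of $Y:M\to TM$, and $Z_{**}:T^2M\to T^3M$ the second differential of $Z:M\to TM$. $j^1_xb\in\mathcal B^{(1,1)}_{nh}$ acts on $T^2M$ over $x$ by $j^1_xb\cdot\frac{dX_t}{dt}|_0=\frac{d}{dt}(b(x_t)X_t)|_0$ ($X_t\in T_{x_t}M$), and $j^1_xb\in\mathcal B^{(1,1,1)}_{nh}$ acts on $T^3M$ over $x$ by $j^1_xb\cdot\frac{d\mathcal Z_t}{dt}|_0=\frac{d}{dt}(b(x_t)\cdot\mathcal Z_t)|_0$ ($\mathcal Z_t\in T^2M$ over $x_t$). The canonical involution of $T^2N$ is $(u,Q,R,W)\mapsto(u,R,Q,W)$ in coordinates induced by a chart of $N$ (vector with components $(R,W)$ at $(u,Q)\in TN$); $\kappa:T^3M\to T^3M$ is that of $T^2N$ with $N=TM$. $\kappa(\eta)$, for $\eta\in\mathcal B^{(1,1,1)}$, is determined by $\kappa(\eta)\cdot\mathfrak X=\kappa(\eta\cdot\kappa(\mathfrak X))$. $T^3M$ has three projections to $T^2M$: $p$ (canonical), $p_*$ (differential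 of the canonical projection $T^2M\to TM$), $p_{**}$ (second differential of $TM\to M$). If two elements of $T^3M$ over a point $y$ have the same images under $p,p_*,p_{**}$, then in the coordinates induced by a chart of $M$ they differ only in the last $n=\dim M$ coordinates; $\Pi(\mathfrak X_1,\mathfrak X_2)\in T_yM$ is the (chart-independent) vector whose components are the difference (first minus second) of these. $T^\nabla(X,Y)=\nabla_XY-\nabla_YX-[X,Y]$, $R^\nabla(X,Y)Z=\nabla_X\nabla_YZ-\nabla_Y\nabla_XZ-\nabla_{[X,Y]}Z$. $\xi$ preserves a $TM$-valued covariant tensor $Q$ if $Q(\xi X_1,\dots,\xi X_k)=\xi Q(X_1,\dots,X_k)$ for all $X_i\in T_xM$. *)

(* Defs.v *)
From HB Require Import structures.
From mathcomp Require Import all_boot all_order all_algebra.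
From mathcomp Require Import all_classical all_reals all_analysis.
Set Implicit Arguments.
Unset Strict Implicit.
Unset Printing Implicit Defensive.
Import Order.TTheory GRing.Theory Num.Theory.
Import numFieldNormedType.Exports.
Local Open Scope classical_set_scope.
Local Open Scope ring_scope.

(* Conventions.
   - Tangent vectors are row vectors; a linear map with matrix A is u |-> u *m A.
   - Every point x of a manifold carries one chart of the atlas around x, and
     T_xM is R^n through that chart. TB and Hom carry the charts induced
     by those of the base, so the fibre components of an element of TB (TB N) are
     its coordinates in the chart induced by the chart of N at its base point.
   - As usual for maps into submanifolds, maps into a groupoid of jets, and
     their 1-jets, are taken in the ambient bundle Hom.
   - An object determined uniquely, or up to choices that do not matter, is
     selected with [xget] (whose first argument is a dummy default). *)

(** * Smooth maps *)

Fixpoint Ck (R : realType) (V W : normedModType R) (k : nat) (U : set V)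
    (f : V -> W) : Prop :=
  match k with
  | 0 => forall z, U z -> {for z, continuous f}
  | k'.+1 => (forall z, U z -> differentiable f z) /\
             forall v, Ck k' U (fun z => 'D_v f z)
  end.

Definition smooth_on (R : realType) (V W : normedModType R) (U : set V)
    (f : V -> W) := forall k, Ck k U f.

Definition smooth_near (R : realType) (V W : normedModType R)
    (f : V -> W) (z : V) := exists U, [/\ open U, U z & smooth_on U f].

(** * Charted spaces and manifolds *)

(* Raw data: a chart [coord x], with domain [cdom x] and inverse [cinv x], at
   every point x. The laws are in [manifold]; the bundles over a manifold are
   only used through their charts. *)
Record charted (R : realType) := Charted {
  cpt :> choiceType;
  cdim : nat;
  cdom : cpt -> set cpt;
  coord : cpt -> cpt -> 'rV[R]_cdim;
  cinv : cpt -> 'rV[R]_cdim -> cpt }.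

Record manifold (R : realType) (n : nat) := Manifold {
  mtop : topologicalType;
  mdom : mtop -> set mtop;
  mcoord : mtop -> mtop -> 'rV[R]_n;
  mcinv : mtop -> 'rV[R]_n -> mtop;
  m_hausdorff : hausdorff_space mtop;
  m_second_countable : @second_countable mtop;
  m_center : forall x, mdom x x;
  m_open_dom : forall x, open (mdom x);
  m_open_range : forall x, open (mcoord x @` mdom x);
  m_coordK : forall x y, mdom x y -> mcinv x (mcoord x y) = y;
  m_coord_cont : forall x y, mdom x y -> {for y, continuous (mcoord x)};
  m_cinv_cont : forall x z, (mcoord x @` mdom x) z ->
    {for z, continuous (mcinv x)};
  m_compat : forall x y,
    smooth_on (mcoord x @` (mdom x `&` mdom y)) (mcoord y \o mcinv x) }.

Definition manifold_charted (R : realType) (n : nat) (M : manifold R n) :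
    charted R :=
  @Charted R (mtop M) n (@mdom R n M) (@mcoord R n M) (@mcinv R n M).
Coercion manifold_charted : manifold >-> charted.

Definition smooth_at (R : realType) (N P : charted R) (f : N -> P) (x : N) :=
  (\forall z \near coord x x, cdom (f x) (f (cinv x z))) /\
  smooth_near (coord (f x) \o f \o cinv x) (coord x x).

(* Matrix of f_{*x} : T_xN -> T_{f x}P. *)
Definition dmat (R : realType) (N P : charted R) (f : N -> P) (x : N) :
    'M[R]_(cdim N, cdim P) :=
  jacobian (coord (f x) \o f \o cinv x) (coord x x).

(* For y in the domain of the chart at x: change of components in T_yN from
   the chart at y to the chart at x, and from the chart at x to the one at y. *)
Definition tc (R : realType) (N : charted R) (x y : N) : 'M[R]_(cdim N) :=
  jacobian (coord x \o cinv y) (coord y y).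
Definition tc_inv (R : realType) (N : charted R) (x y : N) : 'M[R]_(cdim N) :=
  jacobian (coord y \o cinv x) (coord x y).

(** * Tangent bundles and bundles of linear maps *)

Definition TB (R : realType) (N : charted R) : charted R :=
  @Charted R (N * 'rV[R]_(cdim N))%type (cdim N + cdim N)
    (fun a => [set v | cdom a.1 v.1])
    (fun a v => row_mx (coord a.1 v.1) (v.2 *m tc a.1 v.1))
    (fun a z => let y := cinv a.1 (lsubmx z) in
                (y, rsubmx z *m tc_inv a.1 y)).

Definition tproj (R : realType) (N : charted R) (v : TB N) : N := v.1.

Definition tmap (R : realType) (N P : charted R) (f : N -> P)
    (v : TB N) : TB P :=
  (f v.1, v.2 *m dmat f v.1).

(* Linear maps T_xM -> T_yN, written (x, y, A); equivalently, 1-jets at x of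
   maps M -> N with value y. *)
Definition Hom (R : realType) (M N : charted R) : charted R :=
  @Charted R (M * N * 'M[R]_(cdim M, cdim N))%type
    (cdim M + cdim N + cdim M * cdim N)
    (fun a => [set j | cdom a.1.1 j.1.1 /\ cdom a.1.2 j.1.2])
    (fun a j => row_mx (row_mx (coord a.1.1 j.1.1) (coord a.1.2 j.1.2))
      (mxvec (tc_inv a.1.1 j.1.1 *m j.2 *m tc a.1.2 j.1.2)))
    (fun a z => let x := cinv a.1.1 (lsubmx (lsubmx z)) in
                let y := cinv a.1.2 (rsubmx (lsubmx z)) in
                (x, y, tc a.1.1 x *m vec_mx (rsubmx z) *m tc_inv a.1.2 y)).

Definition jet1 (R : realType) (M N : charted R) (f : M -> N) (x : M) :
    Hom M N :=
  (x, f x, dmat f x).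

(** * Curves *)

Definition velocity (R : realType) (N : charted R) (c : R -> N) : TB N :=
  (c 0, derive1 (coord (c 0) \o c) 0).

Definition smooth_curve (R : realType) (N : charted R) (c : R -> N) :=
  (\forall t \near (0 : R), cdom (c 0) (c t)) /\
  smooth_near (coord (c 0) \o c : R -> 'rV[R]_(cdim N)) 0.

Definition curve_of (R : realType) (N : charted R) (v : TB N) : R -> N :=
  xget (fun=> v.1) [set c | smooth_curve c /\ velocity c = v].

(** * Groupoids of jets of bisections *)

(* A groupoid over M whose arrows form a subset [gset] (in the cases below an
   embedded submanifold) of a charted space. Only source and target matter for
   bisections and their jets. *)
Record groupoid (R : realType) (n : nat) (M : manifold R n) := Groupoid {
  gspace : charted R;
  gset : set gspace;
  gsrc : gspace -> M;
  gtgt : gspace -> M }.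

Definition diffeo_onto_open (R : realType) (n : nat) (M : manifold R n)
    (U : set (mtop M)) (f : M -> M) :=
  open ((f : mtop M -> mtop M) @` U) /\
  exists g : M -> M, forall x, U x ->
    [/\ g (f x) = x, smooth_at f x & smooth_at g (f x)].

Definition bisection (R : realType) (n : nat) (M : manifold R n)
    (G : groupoid M) (U : set (mtop M)) (b : M -> gspace G) :=
  [/\ open U,
      forall x, U x -> [/\ gset (b x), gsrc (b x) = x & smooth_at b x]
    & diffeo_onto_open U (gtgt (g := G) \o b)].

(* The groupoid of 1-jets of local bisections of G. *)
Definition jets (R : realType) (n : nat) (M : manifold R n) (G : groupoid M) :
    groupoid M :=
  @Groupoid R n M (Hom M (gspace G))
    [set j | exists U b, [/\ @bisection R n M G U b, U j.1.1 & j = jet1 b j.1.1]]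
    (fun j => j.1.1) (fun j => gtgt (g := G) j.1.2).

(* A local bisection b on U with j = j^1_x b, x the source of j. *)
Definition rep (R : realType) (n : nat) (M : manifold R n) (G : groupoid M)
    (j : gspace (jets G)) : set (mtop M) * (M -> gspace G) :=
  xget (set0, fun=> j.1.2)
    [set Ub | [/\ bisection Ub.1 Ub.2, Ub.1 j.1.1 & j = jet1 Ub.2 j.1.1]].

(* j^1_x b |-> j^1_x (f o b). *)
Definition jlift (R : realType) (n : nat) (M : manifold R n) (G : groupoid M)
    (P : charted R) (f : gspace G -> P) (j : gspace (jets G)) : Hom M P :=
  jet1 (f \o (rep j).2) j.1.1.

Definition B1 (R : realType) (n : nat) (M : manifold R n) : groupoid M :=
  @Groupoid R n M (Hom M M) [set xi | xi.2 \in unitmx]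
    (fun xi => xi.1.1) (fun xi => xi.1.2).

Definition B11nh (R : realType) (n : nat) (M : manifold R n) := jets (B1 M).
Definition B111nh (R : realType) (n : nat) (M : manifold R n) := jets (B11nh M).

(* j^1_x b |-> b x *)
Definition pj (R : realType) (n : nat) (M : manifold R n) (G : groupoid M)
    (j : gspace (jets G)) : gspace G := j.1.2.

Definition pstar2 (R : realType) (n : nat) (M : manifold R n)
    (j : gspace (B11nh M)) : gspace (B1 M) :=
  jlift (G := B1 M) (P := M) (gtgt (g := B1 M)) j.

Definition B11sh (R : realType) (n : nat) (M : manifold R n) :
    set (gspace (B11nh M)) :=
  [set j | gset j /\ pj j = pstar2 j].

(** * Vector fields, symmetry jets, connections *)

Definition vfield (R : realType) (n : nat) (M : manifold R n) :=
  M -> 'rV[R]_n.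

Definition sec (R : realType) (n : nat) (M : manifold R n) (X : vfield M)
    (x : M) : TB M := (x, X x).

Definition smooth_vfield_at (R : realType) (n : nat) (M : manifold R n)
    (X : vfield M) (x : M) := smooth_at (sec X) x.
Definition smooth_vfield (R : realType) (n : nat) (M : manifold R n)
    (X : vfield M) := forall x, smooth_vfield_at X x.

(* Components of X in the chart at x, as a function of the coordinates. *)
Definition vlocal (R : realType) (n : nat) (M : manifold R n) (x : M)
    (X : vfield M) (z : 'rV[R]_n) : 'rV[R]_n :=
  let y : M := @cinv R M x z in X y *m (tc x y : 'M[R]_n).

Definition bracket (R : realType) (n : nat) (M : manifold R n)
    (X Y : vfield M) : vfield M := fun x =>
  let z : 'rV[R]_n := @coord R M x x in
  vlocal x X z *m jacobian (vlocal x Y) z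
  - vlocal x Y z *m jacobian (vlocal x X) z.

(* bY, for a local bisection b of B1 defined on U. *)
Definition push (R : realType) (n : nat) (M : manifold R n)
    (Ub : set (mtop M) * (M -> gspace (B1 M))) (Y : vfield M) : vfield M :=
  fun y => let x := xget y [set x | Ub.1 x /\ gtgt (Ub.2 x) = y] in
           Y x *m ((Ub.2 x).2 : 'M[R]_n).

Definition symmetry_jet (R : realType) (n : nat) (M : manifold R n)
    (s : M -> gspace (B11nh M)) :=
  forall x : M, [/\ smooth_at s x, B11sh (s x), gsrc (s x) = x
                  & pj (s x) = (x, x, - 1%:M)].

Definition nabla (R : realType) (n : nat) (M : manifold R n)
    (s : M -> gspace (B11nh M)) (X Y : vfield M) : vfield M := fun x =>
  2^-1 *: bracket X (fun z => Y z + push (rep (s x)) Y z) x.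

Definition torsion (R : realType) (n : nat) (M : manifold R n)
    (s : M -> gspace (B11nh M)) (X Y : vfield M) : vfield M := fun x =>
  nabla s X Y x - nabla s Y X x - bracket X Y x.

Definition curvature (R : realType) (n : nat) (M : manifold R n)
    (s : M -> gspace (B11nh M)) (X Y Z : vfield M) : vfield M := fun x =>
  nabla s X (nabla s Y Z) x - nabla s Y (nabla s X Z) x
  - nabla s (bracket X Y) Z x.

(* A vector field, smooth near x, with value u at x; used to evaluate tensorial
   expressions on tangent vectors. *)
Definition vext (R : realType) (n : nat) (M : manifold R n) (x : M)
    (u : 'rV[R]_n) : vfield M :=
  xget (fun=> u) [set X : vfield M | smooth_vfield_at X x /\ X x = u].

Definition nabla_at (R : realType) (n : nat) (M : manifold R n)
    (s : M -> gspace (B11nh M)) (x : M) (u : 'rV[R]_n) (Y : vfield M) :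
    'rV[R]_n :=
  nabla s (vext x u) Y x.

Definition torsion_at (R : realType) (n : nat) (M : manifold R n)
    (s : M -> gspace (B11nh M)) (x : M) (u v : 'rV[R]_n) : 'rV[R]_n :=
  torsion s (vext x u) (vext x v) x.

Definition curvature_at (R : realType) (n : nat) (M : manifold R n)
    (s : M -> gspace (B11nh M)) (x : M) (u v w : 'rV[R]_n) : 'rV[R]_n :=
  curvature s (vext x u) (vext x v) (vext x w) x.

Definition app (R : realType) (n : nat) (M : manifold R n)
    (xi : gspace (B1 M)) (u : 'rV[R]_n) : 'rV[R]_n :=
  u *m (xi.2 : 'M[R]_n).

Definition preserves_torsion (R : realType) (n : nat) (M : manifold R n)
    (s : M -> gspace (B11nh M)) (xi : gspace (B1 M)) :=
  forall u v, torsion_at s (gtgt xi) (app xi u) (app xi v)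
              = app xi (torsion_at s (gsrc xi) u v).

Definition preserves_curvature (R : realType) (n : nat) (M : manifold R n)
    (s : M -> gspace (B11nh M)) (xi : gspace (B1 M)) :=
  forall u v w,
    curvature_at s (gtgt xi) (app xi u) (app xi v) (app xi w)
    = app xi (curvature_at s (gsrc xi) u v w).

(** * Affine extensions *)

Definition affine (R : realType) (n : nat) (M : manifold R n)
    (s : M -> gspace (B11nh M)) (xi : gspace (B1 M)) (j : gspace (B11nh M)) :=
  forall (u : 'rV[R]_n) (Y : vfield M), smooth_vfield_at Y (gsrc xi) ->
    app xi (nabla_at s (gsrc xi) u Y)
    = nabla_at s (gtgt xi) (app xi u) (push (rep j) Y).

Definition affine_ext (R : realType) (n : nat) (M : manifold R n)
    (s : M -> gspace (B11nh M)) (xi : gspace (B1 M)) : gspace (B11nh M) :=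
  xget (gsrc xi, xi, 0)
    [set j | [/\ B11sh j, pj j = xi & affine s xi j]].

Definition affine_ext3 (R : realType) (n : nat) (M : manifold R n)
    (s : M -> gspace (B11nh M)) (xi : gspace (B1 M)) : gspace (B111nh M) :=
  jlift (G := B1 M) (affine_ext s) (affine_ext s xi).

(** * Actions on iterated tangent bundles, the involution kappa, Pi *)

Definition act1 (R : realType) (n : nat) (M : manifold R n)
    (xi : gspace (B1 M)) (v : TB M) : TB M := (gtgt xi, app xi v.2).

Definition act2 (R : realType) (n : nat) (M : manifold R n)
    (j : gspace (B11nh M)) (V : TB (TB M)) : TB (TB M) :=
  let b := (rep j).2 in let c := curve_of V in
  velocity (fun t => act1 (b (c t).1) (c t)).

Definition act3 (R : realType) (n : nat) (M : manifold R n)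
    (j : gspace (B111nh M)) (V : TB (TB (TB M))) : TB (TB (TB M)) :=
  let b := (rep j).2 in let c := curve_of V in
  velocity (fun t => act2 (b (c t).1.1) (c t)).

(* In the chart induced by that of N at u, V.1 = (u, Q) and V.2 = (R, W). *)
Definition kappa (R : realType) (N : charted R) (V : TB (TB N)) : TB (TB N) :=
  let q : 'rV[R]_(cdim N + cdim N) := V.2 in
  ((V.1.1, lsubmx q), row_mx V.1.2 (rsubmx q)).

Definition kappaJ (R : realType) (n : nat) (M : manifold R n)
    (j : gspace (B111nh M)) : gspace (B111nh M) :=
  xget j [set j' : gspace (B111nh M) | [/\ gset j', gsrc j' = gsrc j
    & forall V : TB (TB (TB M)), V.1.1.1 = gsrc j ->
        act3 j' V = kappa (N := TB M) (act3 j (kappa (N := TB M) V))]].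

Definition same_projections (R : realType) (n : nat) (M : manifold R n)
    (V W : TB (TB (TB M))) :=
  [/\ tproj V = tproj W,
      tmap (@tproj R (TB M)) V = tmap (@tproj R (TB M)) W
    & tmap (tmap (@tproj R M)) V = tmap (tmap (@tproj R M)) W].

(* The last n coordinates of V, W in the chart of TB (TB (TB M)) induced by the
   chart of M at the base point. Meaningful when [same_projections V W]. *)
Definition Pi (R : realType) (n : nat) (M : manifold R n)
    (V W : TB (TB (TB M))) : 'rV[R]_n :=
  let v : 'rV[R]_((n + n) + (n + n)) := V.2 in
  let w : 'rV[R]_((n + n) + (n + n)) := W.2 in
  rsubmx (rsubmx v) - rsubmx (rsubmx w).

(* Main.v *)
Require Import Defs.
From HB Require Import structures.
From mathcomp Require Import all_boot all_order all_algebra.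
From mathcomp Require Import all_classical all_reals all_analysis.
From mathcomp Require Import ring.
Set Implicit Arguments.
Unset Strict Implicit.
Unset Printing Implicit Defensive.
Import Order.TTheory GRing.Theory Num.Theory.
Import numFieldNormedType.Exports.
Local Open Scope classical_set_scope.
Local Open Scope ring_scope.

(* With tangent vectors as rows, a symmetry jet amounts in a chart to Christoffel
   matrices G_z(u), with nabla_u Y = D_u Y + Y G(u). The affine extension of
   xi = (x, y, A) is the 2-jet with first-order part A and second-order part
   B(u) = G_x(u) A - A G_y(u A), and xi preserves the torsion iff u B(h) = h B(u).
   Differentiating the affine extension along a bisection that represents S(xi)
   gives the third-order part C(h, u) of SS(xi). The involution exchanges the two
   directions: kappa(SS(xi)) is the jet with the same lower-order parts and
   third-order part C(u, h). It is realized by a bisection that is affine in a chart,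
   and it is unique because jets are determined by their action on T^3M. So Pi
   evaluates to v (C(h, u) - C(u, h)), where torsion invariance cancels every term
   outside the two curvature tensors. *)

(** * Smooth maps between normed spaces of matrices *)

(** The definitions read each point in the chart centred at that point, so charts move along every
    curve or bisection that is differentiated. The proof works with fixed pairs of charts instead,
    and returns to the centred ones because a chart of [TB] or [Hom] depends only on the base points
    of its index. Most objects of the statement are chosen, not constructed: representing
    bisections, curves, extensions of vectors, the affine extension, the involution. Each choice is
    eliminated by a formula in the coordinates of the jet. For the affine extension, selected point
    by point, this formula is also the source of smoothness. Torsion invariance has a second use.
    The flip turns the component u B(h) of SS(xi), which p_** sees, into h B(u); were these
    different, the two images would differ in more than the last n coordinates and Pi would lose its
    meaning. The action of a jet does not show its source components, so uniqueness of the
    involution takes them from the fact that bisections are sections of the source map. *)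

Section Calculus.
Context {R : realType}.
Implicit Types V W : normedModType R.

(** A germ that vanishes is its own remainder, so its differential is 0. Adding such a germ to [f]
    gives the locality of differentiability. *)
Lemma differentiable_near0 V W (h : V -> W) z :
  (\forall y \near z, h y = 0) -> differentiable h z.
Proof.
move=> h0; have hz : h z = 0 by exact: nbhs_singleton h0.
have E : h \o shift z = cst (h z) + (0 : V -> W) +o_ 0 id.
  apply: eqaddoE; rewrite hz.
  apply/eqaddoP => _/posnumP[e] /=.
  have := h0; rewrite (near_shift 0 z) /= => h0'.
  rewrite -nbhs_nearE; apply: filterS h0' => y /=; rewrite subr0 => hy.
  by rewrite !fctE hy /= !addr0 subr0 normr0 mulr_ge0.
have c0 : continuous (0 : V -> W) by move=> x; exact: cst_continuous.
have d0 : 'd h z = 0 :> (V -> W) by apply/diff_unique.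
by apply/diff_locallyP; rewrite d0.
Qed.

Lemma near_eq_differentiable V W (f g : V -> W) z :
  (\forall y \near z, f y = g y) -> differentiable f z -> differentiable g z.
Proof.
move=> fg df; have -> : g = f + (g - f) by rewrite addrC subrK.
apply: differentiableD => //; apply: differentiable_near0.
by apply: filterS fg => y /= E; rewrite !fctE E subrr.
Qed.

Lemma mx_sum_fun m n V (f : V -> 'M[R]_(m, n)) :
  f = \sum_i \sum_j (fun z => f z i j *: delta_mx i j).
Proof.
apply/funext => z; rewrite [LHS]matrix_sum_delta fct_sumE.
by apply: eq_bigr => i _; rewrite fct_sumE.
Qed.

Lemma differentiable_mxP m n V (f : V -> 'M[R]_(m, n)) z :
  differentiable f z <-> forall i j, differentiable (fun y => f y i j) z.
Proof.
split=> [df i j|df].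
  apply: (@differentiable_comp _ _ _ _ f (fun N : 'M[R]_(m, n) => N i j)) => //.
  exact: differentiable_coord.
rewrite (mx_sum_fun f); apply: differentiable_sum => i.
by apply: differentiable_sum => j; exact: differentiableZl.
Qed.

Lemma derive_entry m n V (f : V -> 'M[R]_(m, n)) z v i j :
  differentiable f z -> 'D_v (fun y => f y i j) z = ('D_v f z) i j.
Proof. by move=> /diff_derivable df; rewrite derive_mx ?mxE. Qed.

(** Finite dimension enters here: the map is a finite sum of entry functions with constant
    coefficients, hence differentiable. *)
Lemma linear_mx_continuous m n p q (L : {linear 'M[R]_(m, n) -> 'M[R]_(p, q)}) :
  continuous L.
Proof.
move=> x; apply: differentiable_continuous.
pose S : 'M[R]_(m, n) -> 'M[R]_(p, q) :=
  \sum_i \sum_j (fun z : 'M[R]_(m, n) => z i j *: L (delta_mx i j)).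
have E : S = L.
  apply/funext => z; rewrite [in RHS](matrix_sum_delta z) linear_sum /S fct_sumE.
  apply: eq_bigr => i _; rewrite linear_sum fct_sumE.
  by apply: eq_bigr => j _; rewrite linearZ.
suff: differentiable S x by rewrite E.
apply: differentiable_sum => i; apply: differentiable_sum => j.
exact/differentiableZl/differentiable_coord.
Qed.

Lemma differentiable_lin m n p q (L : {linear 'M[R]_(m, n) -> 'M[R]_(p, q)})
  V (f : V -> 'M[R]_(m, n)) z :
  differentiable f z -> differentiable (fun y => L (f y)) z.
Proof.
move=> df; apply: (@differentiable_comp _ _ _ _ f L) => //.
exact/linear_differentiable/linear_mx_continuous.
Qed.

Lemma derive_comp (U V W : normedModType R) (f : U -> V) (g : V -> W) z v :
  differentiable f z -> differentiable g (f z) ->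
  'D_v (fun y => g (f y)) z = 'D_('D_v f z) g (f z).
Proof.
move=> df dg; have dgf := differentiable_comp df dg.
by rewrite (deriveE _ dgf) diff_comp//= (deriveE _ dg) (deriveE _ df).
Qed.

Lemma derive_lin m n p q (L : {linear 'M[R]_(m, n) -> 'M[R]_(p, q)})
  V (f : V -> 'M[R]_(m, n)) z v :
  differentiable f z -> 'D_v (fun y => L (f y)) z = L ('D_v f z).
Proof.
move=> df; have cL := @linear_mx_continuous _ _ _ _ L.
have dL x : differentiable L x by exact: linear_differentiable.
by rewrite (derive_comp v df (dL _)) (deriveE _ (dL _)) diff_lin.
Qed.

Lemma differentiable_mulmx m n p V (f : V -> 'M[R]_(m, n))
  (g : V -> 'M[R]_(n, p)) z : differentiable f z -> differentiable g z ->
  differentiable (fun y => f y *m g y) z.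
Proof.
move=> /differentiable_mxP df /differentiable_mxP dg.
apply/differentiable_mxP => i j.
rewrite (_ : (fun _ => _) = \sum_k ((fun y => f y i k) * (fun y => g y k j))).
  by apply: differentiable_sum => k; exact: differentiableM.
by apply/funext => y; rewrite mxE fct_sumE.
Qed.

Lemma derive_mulmx m n p V (f : V -> 'M[R]_(m, n))
  (g : V -> 'M[R]_(n, p)) z v : differentiable f z -> differentiable g z ->
  'D_v (fun y => f y *m g y) z = 'D_v f z *m g z + f z *m 'D_v g z.
Proof.
move=> df dg; apply/matrixP => i j.
rewrite -derive_entry; last exact: differentiable_mulmx.
rewrite (_ : (fun _ => _) = \sum_k ((fun y => f y i k) * (fun y => g y k j)));
  last by apply/funext => y; rewrite mxE fct_sumE.
have dfe k : derivable (fun y => f y i k) z v.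
  by apply: diff_derivable; move/differentiable_mxP: df.
have dge k : derivable (fun y => g y k j) z v.
  by apply: diff_derivable; move/differentiable_mxP: dg.
rewrite derive_sum => [|k]; last exact: derivableM.
rewrite !mxE -big_split; apply: eq_bigr => k _.
rewrite deriveM// derive_entry// derive_entry//.
by rewrite addrC /GRing.scale/= mulrC.
Qed.

Lemma derive_add V W (f g : V -> W) z v :
  differentiable f z -> differentiable g z ->
  'D_v (fun y => f y + g y) z = 'D_v f z + 'D_v g z.
Proof. by move=> df dg; rewrite -deriveD; try exact: diff_derivable. Qed.

Lemma derive_sub V W (f g : V -> W) z v :
  differentiable f z -> differentiable g z ->
  'D_v (fun y => f y - g y) z = 'D_v f z - 'D_v g z.
Proof. by move=> df dg; rewrite -deriveB; try exact: diff_derivable. Qed.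

Lemma jacobianP n m (f : 'rV[R]_n -> 'rV[R]_m) z (A : 'M[R]_(n, m)) :
  differentiable f z -> (forall v, 'D_v f z = v *m A) -> jacobian f z = A.
Proof.
move=> df H; apply/row_matrixP => i.
by rewrite !rowE -deriveEjacobian// H.
Qed.

Lemma near_eq_jacobian n m (f g : 'rV[R]_n -> 'rV[R]_m) z :
  (\forall y \near z, f y = g y) -> differentiable f z ->
  jacobian f z = jacobian g z.
Proof.
move=> fg df; apply: jacobianP => // v.
by rewrite (near_eq_derive _ fg) deriveEjacobian//; exact: near_eq_differentiable df.
Qed.

(** * Maps of class C^k *)

Lemma Ck_diff V W k (U : set V) (f : V -> W) z :
  Ck k.+1 U f -> U z -> differentiable f z.
Proof. by case=> + _; exact. Qed.

Lemma Ck_ext V W k (U : set V) (f g : V -> W) :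
  open U -> (forall z, U z -> f z = g z) -> Ck k U f -> Ck k U g.
Proof.
move=> oU; elim: k => [|k IH] in f g * => fg /=.
  move=> cf z Uz; have : f @ z --> f z := cf z Uz; rewrite (fg z Uz).
  apply: cvg_trans; apply: near_eq_cvg.
  by near=> y; apply: fg; near: y; exact: open_nbhs_nbhs.
have nfg z : U z -> \forall y \near z, f y = g y.
  by move=> Uz; near=> y; apply: fg; near: y; exact: open_nbhs_nbhs.
case=> df Df; split=> [z Uz|v].
  by apply: near_eq_differentiable (df z Uz); exact: nfg.
by apply: IH (Df v) => z Uz; apply: near_eq_derive; exact: nfg.
Unshelve. all: by end_near. Qed.

Lemma CkW V W k (U : set V) (f : V -> W) : Ck k.+1 U f -> Ck k U f.
Proof.
elim: k f => [|k IH] f /= [df Df].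
  by move=> z Uz; exact/differentiable_continuous/df.
by split=> // v; apply: IH; exact: Df.
Qed.

Lemma Ck_subset V W k (U U' : set V) (f : V -> W) :
  U' `<=` U -> Ck k U f -> Ck k U' f.
Proof.
move=> sU; elim: k f => [|k IH] f /=; first by move=> cf z /sU /cf.
by case=> df Df; split=> [z /sU /df//|v]; exact: IH.
Qed.

Lemma Ck_cst V W k (U : set V) (c : W) : Ck k U (fun _ : V => c).
Proof.
elim: k c => [|k IH] c /=; first by move=> z _; exact: cst_continuous.
split=> [z _|v]; first exact: (differentiable_cst c).
have -> : 'D_v (fun _ : V => c) = (fun=> 0) by apply/funext => z; exact: derive_cst.
exact: IH.
Qed.

Lemma CkD V W k (U : set V) (f g : V -> W) : open U ->
  Ck k U f -> Ck k U g -> Ck k U (fun z => f z + g z).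
Proof.
move=> oU; elim: k f g => [|k IH] f g.
  by move=> cf cg z Uz; apply: (@continuousD _ _ _ f g); [exact: cf|exact: cg].
move=> [df Df] [dg Dg]; split=> [z Uz|v].
  by apply: differentiableD; [exact: df|exact: dg].
apply: (Ck_ext oU _ (IH _ _ (Df v) (Dg v))) => z Uz.
by rewrite derive_add; [|exact: df|exact: dg].
Qed.

Lemma Ck_sum V W k (U : set V) (I : Type) (r : seq I) (f : I -> V -> W) :
  open U -> (forall i, Ck k U (f i)) -> Ck k U (fun z => \sum_(i <- r) f i z).
Proof.
move=> oU cf; elim: r => [|i r IH].
  by under eq_fun do rewrite big_nil; exact: Ck_cst.
by under eq_fun do rewrite big_cons; exact: CkD.
Qed.

Lemma derive_mul V (f g : V -> R) z v : differentiable f z ->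
  differentiable g z -> 'D_v (fun y => f y * g y) z = f z * 'D_v g z + 'D_v f z * g z.
Proof.
move=> df dg; rewrite -[LHS]/('D_v (f * g) z) deriveM; try exact: diff_derivable.
by congr (_ + _); rewrite /GRing.scale/= mulrC.
Qed.

Lemma CkM V k (U : set V) (f g : V -> R) : open U ->
  Ck k U f -> Ck k U g -> Ck k U (fun z => f z * g z).
Proof.
move=> oU; elim: k f g => [|k IH] f g.
  by move=> cf cg z Uz; apply: (@continuousM _ _ f g); [exact: cf|exact: cg].
move=> cf cg; have [df Df] := cf; have [dg Dg] := cg; split=> [z Uz|v].
  by apply: differentiableM; [exact: df|exact: dg].
have H := CkD oU (IH _ _ (CkW cf) (Dg v)) (IH _ _ (Df v) (CkW cg)).
apply: (Ck_ext oU _ H) => z Uz.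
by rewrite derive_mul; [|exact: df|exact: dg].
Qed.

Lemma Ck_lin m n p q k (U : set 'M[R]_(m, n)) (L : {linear 'M[R]_(m, n) -> 'M[R]_(p, q)}) :
  Ck k U L.
Proof.
have cL := @linear_mx_continuous _ _ _ _ L.
have dL x : differentiable L x by exact: linear_differentiable.
case: k => [z _|k]; first exact: cL.
split=> // v; have -> : 'D_v L = (fun=> L v).
  by apply/funext => z; rewrite (deriveE _ (dL _)) diff_lin.
exact: Ck_cst.
Qed.

Lemma Ck_entry m n V k (U : set V) (f : V -> 'M[R]_(m, n)) i j : open U ->
  Ck k U f -> Ck k U (fun z => f z i j).
Proof.
move=> oU; elim: k f => [|k IH] f.
  move=> cf z Uz; apply: (@continuous_comp _ _ _ f (fun M : 'M[R]_(m, n) => M i j)).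
    exact: cf.
  exact: coord_continuous.
move=> [df Df]; split=> [z Uz|v]; first by move/differentiable_mxP: (df z Uz).
by apply: (Ck_ext oU _ (IH _ (Df v))) => z Uz; rewrite derive_entry//; exact: df.
Qed.

Lemma Ck_mx m n V k (U : set V) (f : V -> 'M[R]_(m, n)) : open U ->
  (forall i j, Ck k U (fun z => f z i j)) -> Ck k U f.
Proof.
move=> oU; elim: k f => [|k IH] f H.
  move=> z Uz; rewrite (mx_sum_fun f) (_ : \sum_i _ = fun z =>
      \sum_i \sum_j (f z i j *: delta_mx i j)); last first.
    by apply/funext => y; rewrite fct_sumE; apply: eq_bigr => i _; rewrite fct_sumE.
  have /= := @Ck_sum V 'M[R]_(m, n) 0 U _ (index_enum 'I_m)
    (fun i z => \sum_j (f z i j *: delta_mx i j)) oU; apply=> // i.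
  apply: (@Ck_sum V 'M[R]_(m, n) 0 U _ _ (fun j z => f z i j *: delta_mx i j)) => // j.
  by move=> y Uy; apply: continuousZl; exact: H.
have df z : U z -> differentiable f z.
  by move=> Uz; apply/differentiable_mxP => i j; exact: Ck_diff (H i j) Uz.
split=> // v; apply: IH => i j; have [_ /(_ v)] := H i j.
by apply: Ck_ext => // z Uz; rewrite derive_entry//; exact: df.
Qed.

(** The derivative of g o f at z is taken in the direction ['D_v f z], which moves with z, whereas
    [Ck] controls fixed directions. Expanding it in the basis [delta_mx i j] restores fixed
    directions; this is why the intermediate space is a space of matrices. *)
Lemma Ck_comp0 m n V k (U : set V) (U' : set 'M[R]_(m, n)) (f : V -> 'M[R]_(m, n))
  (g : 'M[R]_(m, n) -> R) : open U -> open U' -> (forall z, U z -> U' (f z)) ->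
  Ck k U f -> Ck k U' g -> Ck k U (fun z => g (f z)).
Proof.
move=> oU oU' fU; elim: k g => [|k IH] g cf cg.
  move=> z Uz; apply: (@continuous_comp _ _ _ f g); first exact: cf.
  exact/cg/fU.
have [df Df] := cf; have [dg Dg] := cg.
split=> [z Uz|v].
  by apply: (@differentiable_comp _ _ _ _ f g); [exact: df|exact/dg/fU].
have H : Ck k U (fun z => \sum_i \sum_j
    ('D_v f z i j * 'D_(delta_mx i j) g (f z))).
  apply: Ck_sum => // i; apply: Ck_sum => // j; apply: CkM => //.
    by apply: (@Ck_entry _ _ _ _ _ ('D_v f)); [|exact: Df].
  by apply: (IH ('D_(delta_mx i j) g)); [exact: CkW|exact: Dg].
apply: (Ck_ext oU _ H) => z Uz.
have dgz := dg _ (fU _ Uz).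
rewrite (derive_comp v (df z Uz) dgz) [in RHS](matrix_sum_delta ('D_v f z)).
rewrite (deriveE _ dgz) linear_sum; apply: eq_bigr => i _.
rewrite linear_sum; apply: eq_bigr => j _.
by rewrite linearZ (deriveE _ dgz).
Qed.

Lemma Ck_comp m n p q V k (U : set V) (U' : set 'M[R]_(m, n)) (f : V -> 'M[R]_(m, n))
  (g : 'M[R]_(m, n) -> 'M[R]_(p, q)) : open U -> open U' -> (forall z, U z -> U' (f z)) ->
  Ck k U f -> Ck k U' g -> Ck k U (fun z => g (f z)).
Proof.
move=> oU oU' fU cf cg; apply: Ck_mx => // i j.
by apply: (Ck_comp0 (g := fun z => g z i j) oU oU' fU cf); exact: Ck_entry.
Qed.

(** * Germs of smooth maps *)

Lemma smooth_near_ext V W (f g : V -> W) z :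
  (\forall y \near z, f y = g y) -> smooth_near f z -> smooth_near g z.
Proof.
move=> fg [U [oU Uz sf]]; exists (U `&` [set y | f y = g y]^°); split.
- by apply: openI => //; exact: open_interior.
- by split.
- move=> k; apply: (@Ck_ext _ _ k _ f); first by apply: openI => //; exact: open_interior.
    by move=> y [_ /interior_subset].
  by apply: Ck_subset (sf k) => y [].
Qed.

Lemma smooth_near_near V W (f : V -> W) z :
  smooth_near f z -> \forall y \near z, smooth_near f y.
Proof.
move=> [U [oU Uz sf]]; near=> y; exists U; split=> //; near: y.
exact: open_nbhs_nbhs.
Unshelve. all: by end_near. Qed.

Lemma smooth_near_diff V W (f : V -> W) z : smooth_near f z -> differentiable f z.
Proof. by move=> [U [oU Uz /(_ 1%N) sf]]; exact: (@Ck_diff _ _ 0 U). Qed.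

Lemma smooth_near_cont V W (f : V -> W) z : smooth_near f z -> {for z, continuous f}.
Proof. by move=> /smooth_near_diff/differentiable_continuous. Qed.

Lemma smooth_near_cst V W (c : W) (z : V) : smooth_near (fun=> c) z.
Proof. by exists setT; split=> [|//|k]; [exact: openT|exact: Ck_cst]. Qed.

Lemma smooth_near_linear m n p q (L : {linear 'M[R]_(m, n) -> 'M[R]_(p, q)}) z :
  smooth_near L z.
Proof. by exists setT; split=> [|//|k]; [exact: openT|exact: Ck_lin]. Qed.

Lemma smooth_near_comp m n p q V (f : V -> 'M[R]_(m, n))
  (g : 'M[R]_(m, n) -> 'M[R]_(p, q)) z :
  smooth_near f z -> smooth_near g (f z) -> smooth_near (fun y => g (f y)) z.
Proof.
move=> sf [U' [oU' U'f sg]]; have cf := smooth_near_cont sf.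
have [U [oU Uz {}sf]] := sf.
have fU' : nbhs z (f @^-1` U') by apply: cf; exact: open_nbhs_nbhs.
exists (U `&` (f @^-1` U')^°); have oI : open (U `&` (f @^-1` U')^°).
  by apply: openI => //; exact: open_interior.
split=> // k; apply: (Ck_comp (U' := U')) (sg k) => //.
  by move=> y [_ /interior_subset].
by apply: Ck_subset (sf k) => y [].
Qed.

Lemma smooth_near_lin m n p q (L : {linear 'M[R]_(m, n) -> 'M[R]_(p, q)})
  V (f : V -> 'M[R]_(m, n)) z :
  smooth_near f z -> smooth_near (fun y => L (f y)) z.
Proof. by move=> sf; apply: smooth_near_comp sf _; exact: smooth_near_linear. Qed.

Let smooth_near2 V W1 W2 W3 (op : (V -> W1) -> (V -> W2) -> V -> W3) f g z :
  (forall k U, open U -> Ck k U f -> Ck k U g -> Ck k U (op f g)) ->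
  smooth_near f z -> smooth_near g z -> smooth_near (op f g) z.
Proof.
move=> H [U [oU Uz sf]] [U' [oU' U'z sg]]; exists (U `&` U'); split=> //.
  exact: openI.
move=> k; apply: H; first exact: openI.
  by apply: Ck_subset (sf k) => y [].
by apply: Ck_subset (sg k) => y [].
Qed.

Lemma smooth_nearD V W (f g : V -> W) z :
  smooth_near f z -> smooth_near g z -> smooth_near (fun y => f y + g y) z.
Proof.
by apply: (@smooth_near2 _ _ _ _ (fun f g y => f y + g y)) => k U; exact: CkD.
Qed.

Lemma smooth_nearM V (f g : V -> R) z :
  smooth_near f z -> smooth_near g z -> smooth_near (fun y => f y * g y) z.
Proof.
by apply: (smooth_near2 (op := fun (f g : V -> R) y => f y * g y)) => k U; exact: CkM.
Qed.

Lemma smooth_near_sum V W (I : Type) (r : seq I) (f : I -> V -> W) z :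
  (forall i, smooth_near (f i) z) -> smooth_near (fun y => \sum_(i <- r) f i y) z.
Proof.
move=> sf; elim: r => [|i r IH].
  by under eq_fun do rewrite big_nil; exact: smooth_near_cst.
by under eq_fun do rewrite big_cons; exact: smooth_nearD.
Qed.

Lemma smooth_near_entry m n V (f : V -> 'M[R]_(m, n)) z i j :
  smooth_near f z -> smooth_near (fun y => f y i j) z.
Proof.
by move=> [U [oU Uz sf]]; exists U; split=> // k; exact: Ck_entry.
Qed.

Lemma smooth_near_mx m n V (f : V -> 'M[R]_(m, n)) z :
  (forall i j, smooth_near (fun y => f y i j) z) -> smooth_near f z.
Proof.
move=> sf; pose B i j := sval (cid (sf i j)).
have BP i j : [/\ open (B i j), B i j z & smooth_on (B i j) (fun y => f y i j)].
  by rewrite /B; case: cid.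
(* There are finitely many entries, so their domains share a neighbourhood of z. *)
pose O := [set y | forall i j, B i j y]^°.
have Oz : O z.
  apply: filter_forall => i; apply: filter_forall => j.
  by have [oB Bz _] := BP i j; exact: open_nbhs_nbhs.
exists O; split=> //; first exact: open_interior.
move=> k; apply: Ck_mx; first exact: open_interior.
move=> i j; have [_ _ /(_ k)] := BP i j; apply: Ck_subset.
by move=> y /interior_subset /(_ i j).
Qed.

Lemma smooth_near_mulmx m n p V (f : V -> 'M[R]_(m, n)) (g : V -> 'M[R]_(n, p)) z :
  smooth_near f z -> smooth_near g z -> smooth_near (fun y => f y *m g y) z.
Proof.
move=> sf sg; apply: smooth_near_mx => i j; under eq_fun do rewrite mxE.
by apply: smooth_near_sum => k; apply: smooth_nearM; exact: smooth_near_entry.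
Qed.

Lemma smooth_near_derive V W (f : V -> W) z v :
  smooth_near f z -> smooth_near ('D_v f) z.
Proof. by move=> [U [oU Uz sf]]; exists U; split=> // k; have [_] := sf k.+1; apply. Qed.

Lemma smooth_near_jacobian n m (f : 'rV[R]_n -> 'rV[R]_m) z :
  smooth_near f z -> smooth_near (jacobian f) z.
Proof.
move=> sf; apply: smooth_near_mx => i j.
have := smooth_near_entry 0 j (smooth_near_derive (delta_mx 0 i) sf).
apply: smooth_near_ext; apply: filterS (smooth_near_near sf) => y sfy.
by rewrite deriveEjacobian -?rowE ?mxE//; exact: smooth_near_diff.
Qed.

(** * Symmetry of second derivatives *)

Lemma is_diff_line V (z u : V) (s : R) :
  is_diff s (fun s : R => z + s *: u) ( *:%R ^~ u).
Proof.
have H : is_diff s (cst z + ( *:%R ^~ u : R -> V)) (0 + ( *:%R ^~ u : R -> V)).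
  exact: is_diffD.
by rewrite add0r in H.
Qed.

Lemma derive_line V (z u : V) (s : R) : 'D_1 (fun s : R => z + s *: u) s = u.
Proof.
have dl := is_diff_line z u s.
by rewrite deriveE; [rewrite (@diff_val _ _ _ _ _ _ _ dl) scale1r|exact: ex_diff].
Qed.

Lemma MVT_line V (f : V -> R) z u (h : R) : 0 < h ->
  (forall s : R, 0 <= s <= h -> differentiable f (z + s *: u)) ->
  exists2 s : R, 0 <= s <= h & f (z + h *: u) - f z = h * 'D_u f (z + s *: u).
Proof.
move=> h0 df; pose g (s : R) := f (z + s *: u).
have dl := is_diff_line z u; have Dl := derive_line z u.
have dg s : 0 <= s <= h -> differentiable g s.
  move=> sh; apply: (@differentiable_comp _ _ _ _ (fun s : R => z + s *: u) f).
    exact: ex_diff.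
  exact: df.
have Dg s : 0 <= s <= h -> 'D_1 g s = 'D_u f (z + s *: u).
  move=> sh; rewrite /g (@derive_comp _ _ _ (fun s : R => z + s *: u) f)/= ?Dl//.
  exact: df.
have [||s] := @MVT R g (fun s => 'D_u f (z + s *: u)) 0 h h0.
- move=> s; rewrite in_itv/= => /andP[s0 sh]; have sh' : 0 <= s <= h by rewrite !ltW.
  by split; [exact/diff_derivable/dg|exact: Dg].
- apply: continuous_in_subspaceT => s /set_mem /=; rewrite in_itv/= => sh.
  exact/differentiable_continuous/dg.
rewrite in_itv/= => /andP[s0 sh]; rewrite /g subr0 scale0r addr0 mulrC => E.
by exists s => //; rewrite !ltW.
Qed.

(** The left side is the second difference of f over the parallelogram with sides hu and hv. It is
    symmetric in u and v, while two applications of the mean value theorem evaluate it by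
    derivatives in a definite order, along u and then along v. *)
Lemma schwarz_half V (f : V -> R) z u v (h : R) (U : set V) :
  0 < h -> Ck 2 U f ->
  (forall s t : R, 0 <= s <= h -> 0 <= t <= h -> U (z + s *: u + t *: v)) ->
  exists s t : R, [/\ 0 <= s <= h, 0 <= t <= h &
    f (z + h *: u + h *: v) - f (z + h *: u) - f (z + h *: v) + f z
    = h * (h * 'D_v ('D_u f) (z + s *: u + t *: v))].
Proof.
move=> h0 [df Df] UP; have h00 : 0 <= (0 : R) <= h by rewrite lexx ltW.
have hh : 0 <= h <= h by rewrite lexx ltW.
have Ddf := (Df u).1.
pose g y := f (y + h *: v) - f y.
have dT y : differentiable (fun y : V => y + h *: v) y.
  apply: (@differentiableD _ _ _ id (cst (h *: v))) => //; exact: differentiable_cst.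
have DT y w : 'D_w (fun y : V => y + h *: v) y = w.
  rewrite (@derive_add _ _ id (cst (h *: v)))//.
  by rewrite derive_id derive_cst addr0.
have U1 s : 0 <= s <= h -> U (z + s *: u).
  by move=> sh; have := UP s 0 sh h00; rewrite scale0r addr0.
have dg s : 0 <= s <= h -> differentiable g (z + s *: u).
  move=> sh; apply: differentiableB; last exact/df/U1.
  by apply: (@differentiable_comp _ _ _ _ (fun y : V => y + h *: v)) => //;
    exact: (df _ (UP s h sh hh)).
have [s sh Es] := MVT_line h0 dg.
have Dg : 'D_u g (z + s *: u) = 'D_u f (z + s *: u + h *: v) - 'D_u f (z + s *: u).
  rewrite /g derive_sub; last 2 first.
  - by apply: (@differentiable_comp _ _ _ _ (fun y : V => y + h *: v)) => //;
    exact: (df _ (UP s h sh hh)).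
  - exact/df/U1.
  by rewrite (@derive_comp _ _ _ (fun y : V => y + h *: v))// ?DT//; exact: (df _ (UP s h sh hh)).
have [t th Et] := @MVT_line V ('D_u f) (z + s *: u) v h h0 (fun t th => Ddf _ (UP s t sh th)).
exists s, t; split=> //; rewrite -Et -Dg -Es /g opprB; ring.
Qed.

Lemma derive_comm V (f : V -> R) z u v :
  smooth_near f z -> 'D_v ('D_u f) z = 'D_u ('D_v f) z.
Proof.
move=> sf; have [U [oU Uz sfU]] := sf.
have cuv := smooth_near_cont (smooth_near_derive v (smooth_near_derive u sf)).
have cvu := smooth_near_cont (smooth_near_derive u (smooth_near_derive v sf)).
apply/eqP; rewrite -subr_eq0 -normr_eq0; apply/negPn/negP => n0.
set a := 'D_v _ _ in cuv n0; set b := 'D_u _ _ in cvu n0.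
(* Two errors smaller than half of |a - b| cannot add up to |a - b|. *)
pose e := `|a - b| / 2; have e0 : 0 < e by rewrite divr_gt0// lt_def n0 normr_ge0.
have nb : \forall y \near z, [/\ U y, `|a - 'D_v ('D_u f) y| < e & `|b - 'D_u ('D_v f) y| < e].
  have n1 : \forall y \near z, `|a - 'D_v ('D_u f) y| < e.
    by move/cvgrPdist_lt: cuv => /(_ _ e0).
  have n2 : \forall y \near z, `|b - 'D_u ('D_v f) y| < e.
    by move/cvgrPdist_lt: cvu => /(_ _ e0).
  have n3 : \forall y \near z, U y by exact: open_nbhs_nbhs.
  by apply: filterS3 n3 n1 n2.
have [d /= d0 Bd] := (nbhs_ballP _ _).1 nb.
(* With this h the parallelogram at z with sides hu and hv stays in the ball of radius d; the
   summand 1 keeps the denominator positive. *)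
pose h := d / 2 / (1 + `|u| + `|v|).
have k0 : 0 < 1 + `|u| + `|v| by rewrite -addrA ltr_pwDl// addr_ge0.
have h0 : 0 < h by rewrite !divr_gt0.
have Bh s t : 0 <= s <= h -> 0 <= t <= h -> ball z d (z + s *: u + t *: v).
  move=> /andP[s0 sh] /andP[t0 th]; rewrite -ball_normE /= -addrA opprD addNKr.
  rewrite normrN (le_lt_trans (ler_normD _ _))// !normrZ !ger0_norm//.
  apply: (@le_lt_trans _ _ (h * (`|u| + `|v|))).
    by rewrite mulrDr lerD// ler_wpM2r.
  apply: (@le_lt_trans _ _ (h * (1 + `|u| + `|v|))).
    by rewrite (ler_pM2l h0) -addrA lerDr.
  by rewrite /h divfK ?gt_eqF// ltr_pdivrMr// ltr_pMr// ltr1n.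
have Uh s t : 0 <= s <= h -> 0 <= t <= h -> U (z + s *: u + t *: v).
  by move=> sh th; have [] := Bd _ (Bh s t sh th).
have Uh' s t : 0 <= s <= h -> 0 <= t <= h -> U (z + s *: v + t *: u).
  by move=> sh th; rewrite addrAC; exact: Uh.
have [s [t [sh th E]]] := schwarz_half h0 (sfU 2%N) Uh.
have [s' [t' [sh' th' E']]] := schwarz_half h0 (sfU 2%N) Uh'.
have hn : h != 0 by rewrite gt_eqF.
have EE : h * (h * 'D_v ('D_u f) (z + s *: u + t *: v)) =
    h * (h * 'D_u ('D_v f) (z + s' *: v + t' *: u)).
  apply: etrans (esym E) _; apply: etrans E'.
  by rewrite [z + h *: v + _]addrAC; congr (_ + _); exact: addrAC.
have {}EE := mulfI hn (mulfI hn EE).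
have [_ B1 _] := Bd _ (Bh _ _ sh th); have [_ _ B2] := Bd _ (Bh _ _ th' sh').
have : `|a - b| < `|a - b|.
  rewrite {2}(splitr `|a - b|) -/e; apply: le_lt_trans (ltrD B1 B2).
  rewrite addrAC in B2 *; rewrite EE [X in _ <= _ + X]distrC.
  apply: le_trans (ler_normD _ _).
  by rewrite addrA subrK.
by rewrite ltxx.
Qed.

Lemma derive_comm_mx m n V (f : V -> 'M[R]_(m, n)) z u v :
  smooth_near f z -> 'D_v ('D_u f) z = 'D_u ('D_v f) z.
Proof.
have E w w' : smooth_near f z ->
    'D_w' ('D_w f) z = \matrix_(i, j) 'D_w' ('D_w (fun y => f y i j)) z.
  move=> sf; apply/matrixP => i j; rewrite mxE.
  rewrite -derive_entry; last exact/smooth_near_diff/smooth_near_derive.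
  apply: near_eq_derive; apply: filterS (smooth_near_near sf) => y sfy.
  by rewrite derive_entry//; exact: smooth_near_diff.
move=> sf; rewrite (E u v sf) (E v u sf); apply/matrixP => i j.
rewrite [LHS]mxE [RHS]mxE; exact/derive_comm/smooth_near_entry.
Qed.

End Calculus.

Local Notation coord := Defs.coord.
Local Notation Hom := Defs.Hom.
Opaque jacobian derive diff mulmx row_mx lsubmx rsubmx mxvec vec_mx.

(** * Charts *)

(* The chart laws that M shares with TB and Hom, which carry no topology. *)
Record atlas (R : realType) (N : charted R) : Prop := Atlas {
  at_center : forall x : N, cdom x x;
  at_K : forall x y : N, cdom x y -> cinv x (coord x y) = y;
  at_open : forall a b : N, open (coord a @` (cdom a `&` cdom b));
  at_smooth : forall a b y : N, cdom a y -> cdom b y ->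
    smooth_near (coord b \o cinv a) (coord a y) }.

(** The matrices [tc] and [tc_inv] are the instances in which one of the two charts is centred at
    the point. The cocycle rule [tr_comp] needs three arbitrary charts. *)
HB.lock Definition tr (R : realType) (N : charted R) (a b y : N) : 'M[R]_(cdim N) :=
  jacobian (coord b \o cinv a) (coord a y).

(** The bundles carry no topology, so continuity into [P] is replaced by remaining in the domain of
    one chart. That chart need not be centred at [g z] and can be kept while the point moves. *)
Definition smooth_to (R : realType) (V : normedModType R) (P : charted R)
    (b : P) (g : V -> P) (z : V) :=
  (\forall y \near z, cdom b (g y)) /\ smooth_near (coord b \o g) z.

Definition smooth_in (R : realType) (N P : charted R) (a : N) (b : P)
    (f : N -> P) (x : N) := smooth_to b (f \o cinv a) (coord a x).

HB.lock Definition dch (R : realType) (N P : charted R) (a : N) (b : P)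
    (f : N -> P) (x : N) : 'M[R]_(cdim N, cdim P) :=
  jacobian (coord b \o f \o cinv a) (coord a x).

Section Charts.
Context {R : realType}.
Implicit Types (N P Q : charted R) (V : normedModType R).

Lemma dchE N P (a : N) (b : P) (f : N -> P) x :
  dch a b f x = jacobian (coord b \o f \o cinv a) (coord a x).
Proof. by rewrite dch.unlock. Qed.

Lemma dmatE N P (f : N -> P) x : dmat f x = dch x (f x) f x.
Proof. by rewrite dch.unlock. Qed.

Lemma trE N (a b y : N) : tr a b y = jacobian (coord b \o cinv a) (coord a y).
Proof. by rewrite tr.unlock. Qed.

Lemma tr_dch N (a b y : N) : tr a b y = dch a b id y.
Proof. by rewrite tr.unlock dch.unlock. Qed.

Lemma tcE N (x y : N) : tc x y = tr y x y.
Proof. by rewrite tr.unlock. Qed.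

Lemma tc_invE N (x y : N) : tc_inv x y = tr x y y.
Proof. by rewrite tr.unlock. Qed.

Lemma near_chart N (a b y : N) : atlas N -> cdom a y -> cdom b y ->
  \forall z \near coord a y,
    [/\ cdom a (cinv a z), cdom b (cinv a z) & coord a (cinv a z) = z].
Proof.
move=> aN ay bY.
have : nbhs (coord a y) (coord a @` (cdom a `&` cdom b)).
  by apply: open_nbhs_nbhs; split; [exact: at_open|exists y].
by apply: filterS => z [q [aq bq] <-]; rewrite (at_K aN aq).
Qed.

Lemma near_center N (a y : N) : atlas N -> cdom a y ->
  \forall z \near coord a y, cdom a (cinv a z) /\ coord a (cinv a z) = z.
Proof.
by move=> aN ay; apply: filterS (near_chart aN ay ay) => z [].
Qed.

Lemma smooth_to_dom V P (b : P) (g : V -> P) z : smooth_to b g z -> cdom b (g z).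
Proof. by move=> [/nbhs_singleton]. Qed.

Lemma smooth_to_diff V P (b : P) (g : V -> P) z :
  smooth_to b g z -> differentiable (coord b \o g) z.
Proof. by move=> [_ /smooth_near_diff]. Qed.

Lemma near_to V P (b : P) (g : V -> P) z (A : set P) :
  atlas P -> smooth_to b g z ->
  (\forall w \near coord b (g z), A (cinv b w)) -> \forall y \near z, A (g y).
Proof.
move=> aP [dg sg] nA.
have : (coord b \o g) @ z --> (coord b \o g) z := smooth_near_cont sg.
move=> /(_ _ nA).
by apply: filterS2 dg => y dy /=; rewrite (at_K aP dy).
Qed.

Lemma smooth_to_comp V P Q (b : P) (c : Q) (h : V -> P) (g : P -> Q) z :
  atlas P -> smooth_to b h z -> smooth_in b c g (h z) -> smooth_to c (g \o h) z.
Proof.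
move=> aP sh sg; split.
  exact: (near_to (A := [set y | cdom c (g y)]) aP sh sg.1).
have [dh sh'] := sh; have := smooth_near_comp sh' sg.2.
apply: smooth_near_ext; apply: filterS dh => y dy /=.
by rewrite (at_K aP dy).
Qed.

Lemma derive_to_comp V P Q (b : P) (c : Q) (h : V -> P) (g : P -> Q) z v :
  atlas P -> smooth_to b h z -> smooth_in b c g (h z) ->
  'D_v (coord c \o (g \o h)) z = 'D_v (coord b \o h) z *m dch b c g (h z).
Proof.
move=> aP sh sg; have dh := smooth_to_diff sh; have dg := smooth_to_diff sg.
rewrite dchE; apply: etrans (deriveEjacobian _ dg).
rewrite -(@derive_comp _ _ _ _ (coord b \o h) (coord c \o (g \o cinv b)))//.
apply: near_eq_derive; apply: filterS sh.1 => y dy /=.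
by rewrite (at_K aP dy).
Qed.

Lemma smooth_to_cinv N (a x : N) : atlas N -> cdom a x ->
  smooth_to a (cinv a) (coord a x).
Proof.
move=> aN ax; have nc := near_center aN ax; split; first by apply: filterS nc => z [].
apply: (@smooth_near_ext _ _ _ id); first by apply: filterS nc => z [].
exact: (smooth_near_linear idfun).
Qed.

Lemma derive_cinv N (a x : N) v : atlas N -> cdom a x ->
  'D_v (coord a \o cinv a) (coord a x) = v.
Proof.
move=> aN ax; rewrite -[RHS](derive_id (coord a x) v); apply: near_eq_derive.
by apply: filterS (near_center aN ax) => z [].
Qed.

Lemma smooth_in_id N (a b x : N) : atlas N -> cdom a x -> cdom b x ->
  smooth_in a b id x.
Proof.
move=> aN ax bx; split; last exact: at_smooth.
by apply: filterS (near_chart aN ax bx) => z [].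
Qed.

Lemma smooth_to_chart V P (b b' : P) (g : V -> P) z : atlas P ->
  smooth_to b g z -> cdom b' (g z) -> smooth_to b' g z.
Proof.
move=> aP sg b'g; have bg := smooth_to_dom sg.
exact: (smooth_to_comp (g := id)) (smooth_in_id aP bg b'g).
Qed.

Lemma derive_to_chart V P (b b' : P) (g : V -> P) z v : atlas P ->
  smooth_to b g z -> cdom b' (g z) ->
  'D_v (coord b' \o g) z = 'D_v (coord b \o g) z *m tr b b' (g z).
Proof.
move=> aP sg b'g; have bg := smooth_to_dom sg.
rewrite tr_dch; exact: (derive_to_comp v aP sg (smooth_in_id aP bg b'g)).
Qed.

Lemma tr_id N (a x : N) : atlas N -> cdom a x -> tr a a x = 1%:M.
Proof.
move=> aN ax; rewrite trE; apply: jacobianP => [|v].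
  exact: smooth_to_diff (smooth_to_cinv aN ax).
by rewrite derive_cinv// mulmx1.
Qed.

Lemma dchP N P (a : N) (b : P) (f : N -> P) x v : smooth_in a b f x ->
  'D_v (coord b \o (f \o cinv a)) (coord a x) = v *m dch a b f x.
Proof. by move=> sf; rewrite dchE; exact: deriveEjacobian (smooth_to_diff sf). Qed.

Lemma smooth_in_comp N P Q (a : N) (b : P) (c : Q) (f : N -> P) (g : P -> Q) x :
  atlas N -> atlas P -> cdom a x -> smooth_in a b f x -> smooth_in b c g (f x) ->
  smooth_in a c (g \o f) x.
Proof.
move=> aN aP ax sf sg; apply: (smooth_to_comp (h := f \o cinv a)) aP sf _.
by rewrite /= (at_K aN ax).
Qed.

Lemma dch_comp N P Q (a : N) (b : P) (c : Q) (f : N -> P) (g : P -> Q) x :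
  atlas N -> atlas P -> cdom a x -> smooth_in a b f x -> smooth_in b c g (f x) ->
  dch a c (g \o f) x = dch a b f x *m dch b c g (f x).
Proof.
move=> aN aP ax sf sg; have sgf := smooth_in_comp aN aP ax sf sg.
rewrite [LHS]dchE; apply: jacobianP => [|v]; first exact: smooth_to_diff sgf.
rewrite mulmxA -(dchP v sf).
have := @derive_to_comp _ _ _ b c (f \o cinv a) g (coord a x) v aP sf.
by rewrite /= (at_K aN ax); apply.
Qed.

Lemma tr_comp N (a b c x : N) : atlas N -> cdom a x -> cdom b x -> cdom c x ->
  tr a b x *m tr b c x = tr a c x.
Proof.
move=> aN ax bx cx; apply/esym; rewrite !tr_dch.
exact: (dch_comp (f := id) (g := id) aN aN ax (smooth_in_id _ _ _) (smooth_in_id _ _ _)).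
Qed.

Lemma tr_inv N (a b x : N) : atlas N -> cdom a x -> cdom b x ->
  tr a b x *m tr b a x = 1%:M.
Proof. by move=> aN ax bx; rewrite tr_comp// tr_id. Qed.

Lemma tr_unit N (a b x : N) : atlas N -> cdom a x -> cdom b x -> tr a b x \in unitmx.
Proof. by move=> aN ax bx; have [U _] := mulmx1_unit (tr_inv aN ax bx). Qed.

Lemma smooth_in_chart N P (a a' : N) (b b' : P) (f : N -> P) x :
  atlas N -> atlas P -> smooth_in a b f x -> cdom a x -> cdom a' x -> cdom b' (f x) ->
  smooth_in a' b' f x.
Proof.
move=> aN aP sf ax a'x b'f; apply: (smooth_to_chart (b := b)) => //; last first.
  by rewrite /= (at_K aN a'x).
apply: (smooth_to_comp (b := a)); rewrite ?(at_K aN a'x)//.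
exact: smooth_in_id a'x ax.
Qed.

Lemma dch_chart N P (a a' : N) (b b' : P) (f : N -> P) x :
  atlas N -> atlas P -> smooth_in a b f x -> cdom a x -> cdom a' x -> cdom b' (f x) ->
  dch a' b' f x = tr a' a x *m dch a b f x *m tr b b' (f x).
Proof.
move=> aN aP sf ax a'x b'f; have si := smooth_in_id aN a'x ax.
have bf : cdom b (f x) by have := smooth_to_dom sf; rewrite /= (at_K aN ax).
have sb := smooth_in_comp (g := f) aN aN a'x si sf.
have sj := smooth_in_id aP bf b'f.
rewrite !tr_dch -(dch_comp (f := id) (g := f) aN aN a'x si sf).
exact: (dch_comp (f := f) (g := id) aN aP a'x sb sj).
Qed.

Lemma smooth_atP N P (f : N -> P) x : smooth_at f x <-> smooth_in x (f x) f x.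
Proof. by []. Qed.

Lemma smooth_at_in N P (a : N) (b : P) (f : N -> P) x : atlas N -> atlas P ->
  cdom a x -> cdom b (f x) -> smooth_at f x -> smooth_in a b f x.
Proof.
by move=> aN aP ax bf /smooth_atP sf; apply: smooth_in_chart sf _ _ _ => //; exact: at_center.
Qed.

Lemma smooth_in_at N P (a : N) (b : P) (f : N -> P) x : atlas N -> atlas P ->
  cdom a x -> smooth_in a b f x -> smooth_at f x.
Proof.
move=> aN aP ax sf; apply/smooth_atP; apply: smooth_in_chart sf _ _ _ => //.
  exact: at_center.
exact: at_center.
Qed.

Lemma dmat_dch N P (a : N) (b : P) (f : N -> P) x : atlas N -> atlas P ->
  cdom a x -> cdom b (f x) -> smooth_at f x ->
  dch a b f x = tr a x x *m dmat f x *m tr (f x) b (f x).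
Proof.
move=> aN aP ax bf sf; rewrite dmatE; apply: dch_chart => //; exact: at_center.
Qed.

Lemma smooth_at_comp N P Q (f : N -> P) (g : P -> Q) x :
  atlas N -> atlas P -> smooth_at f x -> smooth_at g (f x) -> smooth_at (g \o f) x.
Proof. by move=> aN aP sf sg; apply: smooth_in_comp sf sg => //; exact: at_center. Qed.

Lemma dmat_comp N P Q (f : N -> P) (g : P -> Q) x :
  atlas N -> atlas P -> smooth_at f x -> smooth_at g (f x) ->
  dmat (g \o f) x = dmat f x *m dmat g (f x).
Proof. by move=> aN aP sf sg; rewrite !dmatE; apply: dch_comp sf sg => //; exact: at_center. Qed.

End Charts.

(** * Smooth charts on tangent bundles and bundles of linear maps *)

Section BundleCharts.
Context {R : realType}.
Implicit Types (N P : charted R) (V : normedModType R).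

(** Makes concatenation a combination of products with constant matrices, so that its calculus
    reduces to that of [mulmx]. *)
Lemma row_mxE m n1 n2 (A : 'M[R]_(m, n1)) (B : 'M[R]_(m, n2)) :
  row_mx A B = A *m row_mx 1%:M 0 + B *m row_mx 0 1%:M.
Proof. by rewrite !mul_mx_row !mulmx1 !mulmx0 add_row_mx addr0 add0r. Qed.

Lemma smooth_near_row_mx m n1 n2 V (f : V -> 'M[R]_(m, n1)) (g : V -> 'M[R]_(m, n2)) z :
  smooth_near f z -> smooth_near g z -> smooth_near (fun y => row_mx (f y) (g y)) z.
Proof.
move=> sf sg; under eq_fun do rewrite row_mxE.
by apply: smooth_nearD; apply: smooth_near_mulmx => //; exact: smooth_near_cst.
Qed.

Lemma differentiable_row_mx m n1 n2 V (f : V -> 'M[R]_(m, n1)) (g : V -> 'M[R]_(m, n2)) z :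
  differentiable f z -> differentiable g z ->
  differentiable (fun y => row_mx (f y) (g y)) z.
Proof.
move=> df dg; under eq_fun do rewrite row_mxE.
by apply: differentiableD; apply: differentiable_mulmx => //; exact: differentiable_cst.
Qed.

Lemma derive_row_mx m n1 n2 V (f : V -> 'M[R]_(m, n1)) (g : V -> 'M[R]_(m, n2)) z v :
  differentiable f z -> differentiable g z ->
  'D_v (fun y => row_mx (f y) (g y)) z = row_mx ('D_v f z) ('D_v g z).
Proof.
move=> df dg; have dfg := differentiable_row_mx df dg.
rewrite -[LHS]hsubmxK; congr row_mx.
  rewrite -(derive_lin lsubmx v dfg); congr ('D_v _ z).
  by apply/funext => y; exact: row_mxKl.
rewrite -(derive_lin rsubmx v dfg); congr ('D_v _ z).
by apply/funext => y; exact: row_mxKr.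
Qed.

Lemma atlas_manifold n (M : manifold R n) : atlas M.
Proof.
(* Openness of an overlap in coordinates comes from the continuity of the inverse chart on its open
   range. *)
have H (a b y : M) : cdom a y -> cdom b y ->
    nbhs (coord a y) (coord a @` (cdom a `&` cdom b)).
  move=> ay bY.
  have az : (mcoord (a : mtop M) @` mdom a) (coord a y) by exists y.
  have c : mcinv a @ coord a y --> mcinv (a : mtop M) (coord a y) := m_cinv_cont az.
  have Db : nbhs (mcinv (a : mtop M) (coord a y)) (mdom (b : mtop M)).
    by apply: open_nbhs_nbhs; split; [exact: m_open_dom|rewrite (m_coordK ay)].
  have := c _ Db; have : nbhs (coord a y) (mcoord (a : mtop M) @` mdom a).
    by apply: open_nbhs_nbhs; split=> //; exact: m_open_range.
  apply: filterS2 => z [q aq <-] /=; rewrite m_coordK// => bq.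
  by exists q.
split.
- exact: m_center.
- exact: m_coordK.
- by move=> a b; rewrite openE => z [y [ay bY] <-]; exact: H.
- move=> a b y ay bY; exists (coord a @` (cdom a `&` cdom b)); split.
  + by rewrite openE => z [q [aq bq] <-]; exact: H.
  + by exists y.
  + exact: m_compat.
Qed.

Lemma near_lsub m n1 n2 (z : 'M[R]_(m, n1 + n2)) (A : set 'M[R]_(m, n1)) :
  nbhs (lsubmx z) A -> \forall y \near z, A (lsubmx y).
Proof. by move=> nA; exact: continuous_lsubmx nA. Qed.

(** The chart change of [TB N] as a function of the coordinates alone: it is the tangent map of the
    base chart change, and its smoothness can be read off. *)
Lemma TB_cinv_coord N (a b v : TB N) : atlas N -> cdom a v -> cdom b v ->
  coord b v = row_mx ((coord b.1 \o cinv a.1) (lsubmx (coord a v)))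
    (rsubmx (coord a v) *m jacobian (coord b.1 \o cinv a.1) (lsubmx (coord a v))).
Proof.
move=> aN av bv; have av1 : cdom a.1 v.1 := av; have bv1 : cdom b.1 v.1 := bv.
have vv := at_center aN v.1.
rewrite /= row_mxKl row_mxKr (at_K aN av1).
by rewrite -mulmxA -[jacobian _ _]trE !tcE tr_comp.
Qed.

Lemma atlas_TB N : atlas N -> atlas (TB N).
Proof.
move=> aN.
have KT (x y : TB N) : cdom x y -> cinv x (coord x y) = y.
  move=> xy; have xy1 : cdom x.1 y.1 := xy; rewrite /= row_mxKl row_mxKr (at_K aN xy1).
  have yy := at_center aN y.1.
  by rewrite -mulmxA tc_invE tcE tr_comp// tr_id// mulmx1; case: (y).
(* Fibres are whole vector spaces, so the coordinate image is a full cylinder over that of the base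
   overlap. *)
have oT (a b : TB N) : coord a @` (cdom a `&` cdom b) =
    lsubmx @^-1` (coord a.1 @` (cdom a.1 `&` cdom b.1)).
  apply/seteqP; split=> [z [v [av bv] <-]|z [y [ay bY] yz]] /=.
    by exists v.1 => //; rewrite row_mxKl.
  exists (y, rsubmx z *m tc_inv a.1 y) => //=.
  have yy := at_center aN y.
  by rewrite -mulmxA tc_invE tcE tr_comp// tr_id// mulmx1 yz hsubmxK.
split=> //.
- by move=> x; exact: (at_center aN x.1).
- move=> a b; rewrite oT; apply: open_comp; last exact: at_open.
  by move=> x _; exact: continuous_lsubmx.
move=> a b v av bv.
have nz : nbhs (coord a v) (coord a @` (cdom a `&` cdom b)).
  apply: open_nbhs_nbhs; split; last by exists v.
  rewrite oT; apply: open_comp; last exact: at_open.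
  by move=> x _; exact: continuous_lsubmx.
have sl : smooth_near (fun z : 'rV[R]_(cdim N + cdim N) => lsubmx z) (coord a v).
  exact: smooth_near_linear.
have sT : smooth_near (coord b.1 \o cinv a.1) (lsubmx (coord a v)).
  by rewrite /= row_mxKl; exact: at_smooth.
pose f z := row_mx ((coord b.1 \o cinv a.1) (lsubmx z))
    (rsubmx z *m jacobian (coord b.1 \o cinv a.1) (lsubmx z)).
apply: (@smooth_near_ext _ _ _ f).
  apply: filterS nz => z [w [aw bw] <-]; rewrite [RHS]/comp (KT _ _ aw).
  by apply/esym; exact: TB_cinv_coord.
apply: smooth_near_row_mx; first exact: smooth_near_comp sl sT.
apply: smooth_near_mulmx; first exact: smooth_near_linear.
exact: smooth_near_comp sl (smooth_near_jacobian sT).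
Qed.

(** Linear maps are contravariant in the source: the Jacobian there is that of the inverse chart
    change, taken at the new coordinates [t1 z1]. *)
Lemma Hom_cinv_coord N P (a b j : Hom N P) : atlas N -> atlas P -> cdom a j -> cdom b j ->
  let z1 := lsubmx (lsubmx (coord a j)) in let z2 := rsubmx (lsubmx (coord a j)) in
  let t1 := coord b.1.1 \o cinv a.1.1 in let t2 := coord b.1.2 \o cinv a.1.2 in
  coord b j = row_mx (row_mx (t1 z1) (t2 z2))
    (mxvec (jacobian (coord a.1.1 \o cinv b.1.1) (t1 z1) *m vec_mx (rsubmx (coord a j))
       *m jacobian t2 z2)).
Proof.
move=> aN aP [aj1 aj2] [bj1 bj2] /=.
rewrite !row_mxKl !row_mxKr (at_K aN aj1) (at_K aP aj2) mxvecK.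
have jj1 := at_center aN j.1.1; have jj2 := at_center aP j.1.2.
rewrite -[jacobian _ (coord b.1.1 _)]trE -[jacobian _ (coord a.1.2 _)]trE.
rewrite !tcE !tc_invE -(tr_comp aN bj1 aj1 jj1) -(tr_comp aP jj2 aj2 bj2).
by rewrite !mulmxA.
Qed.

Lemma atlas_Hom N P : atlas N -> atlas P -> atlas (Hom N P).
Proof.
move=> aN aP.
have KT (x y : Hom N P) : cdom x y -> cinv x (coord x y) = y.
  move=> [xy1 xy2]; rewrite /= !row_mxKl !row_mxKr (at_K aN xy1) (at_K aP xy2) mxvecK.
  have jj1 := at_center aN y.1.1; have jj2 := at_center aP y.1.2.
  rewrite !tcE !tc_invE !mulmxA tr_comp// tr_id// mul1mx -!mulmxA tr_comp// tr_id// mulmx1.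
  by case: (y) => -[].
have oT (a b : Hom N P) : coord a @` (cdom a `&` cdom b) =
    (lsubmx \o lsubmx) @^-1` (coord a.1.1 @` (cdom a.1.1 `&` cdom b.1.1)) `&`
    (rsubmx \o lsubmx) @^-1` (coord a.1.2 @` (cdom a.1.2 `&` cdom b.1.2)).
  apply/seteqP; split=> [z [v [[av1 av2] [bv1 bv2]] <-]|z [[y [ay bY] yz] [w [aw bw] wz]]] /=.
    by split; [exists v.1.1|exists v.1.2]; rewrite ?row_mxKl ?row_mxKr.
  exists (y, w, tc a.1.1 y *m vec_mx (rsubmx z) *m tc_inv a.1.2 w) => //=.
  have yy := at_center aN y; have ww := at_center aP w.
  rewrite !tcE !tc_invE !mulmxA tr_comp// tr_id// mul1mx -!mulmxA tr_comp// tr_id// mulmx1.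
  by rewrite yz wz vec_mxK !hsubmxK.
have oO (a b : Hom N P) : open (coord a @` (cdom a `&` cdom b)).
  rewrite oT; apply: openI; apply: open_comp; try exact: at_open.
    by move=> x _; apply: continuous_comp; exact: continuous_lsubmx.
  by move=> x _; apply: continuous_comp; [exact: continuous_lsubmx|exact: continuous_rsubmx].
split=> //.
- by move=> x; split; [exact: (at_center aN)|exact: (at_center aP)].
move=> a b j aj bj; have [aj1 aj2] := aj; have [bj1 bj2] := bj.
have nz : nbhs (coord a j) (coord a @` (cdom a `&` cdom b)).
  by apply: open_nbhs_nbhs; split; [exact: oO|exists j].
pose t1 := coord b.1.1 \o cinv a.1.1; pose t2 := coord b.1.2 \o cinv a.1.2.
pose f z := row_mx (row_mx (t1 (lsubmx (lsubmx z))) (t2 (rsubmx (lsubmx z))))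
    (mxvec (jacobian (coord a.1.1 \o cinv b.1.1) (t1 (lsubmx (lsubmx z))) *m vec_mx (rsubmx z)
       *m jacobian t2 (rsubmx (lsubmx z)))).
apply: (@smooth_near_ext _ _ _ f).
  apply: filterS nz => z [w [aw bw] <-]; rewrite [RHS]/comp (KT _ _ aw).
  by apply/esym; exact: Hom_cinv_coord.
have sl : smooth_near (fun z : 'rV[R]_(cdim N + cdim P + cdim N * cdim P) => lsubmx z) (coord a j).
  exact: smooth_near_linear.
have sll := smooth_near_lin lsubmx sl; have slr := smooth_near_lin rsubmx sl.
have s1 : smooth_near t1 (lsubmx (lsubmx (coord a j))).
  by rewrite /= !row_mxKl; exact: at_smooth.
have s2 : smooth_near t2 (rsubmx (lsubmx (coord a j))).
  by rewrite /= row_mxKl row_mxKr; exact: at_smooth.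
have st1 := smooth_near_comp sll s1; have st2 := smooth_near_comp slr s2.
apply: smooth_near_row_mx; first exact: smooth_near_row_mx.
apply: (smooth_near_lin mxvec); apply: smooth_near_mulmx; last first.
  exact: smooth_near_comp slr (smooth_near_jacobian s2).
apply: smooth_near_mulmx; last first.
  by apply: (smooth_near_lin vec_mx); exact: smooth_near_linear.
apply: smooth_near_comp st1 (smooth_near_jacobian _).
rewrite /t1 /= !row_mxKl (at_K aN aj1); exact: at_smooth.
Qed.

End BundleCharts.

(** * Jets and their actions in charts *)

(** Source, target and linear part read off the coordinates of an element of [Hom]. Being linear,
    they commute with derivatives; on a tangent vector of [Hom] they give the variation of each
    part. *)
Definition jsrc (R : realType) (p q : nat) (w : 'rV[R]_(p + q + p * q)) : 'rV[R]_p :=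
  lsubmx (lsubmx w).
Definition jtgt (R : realType) (p q : nat) (w : 'rV[R]_(p + q + p * q)) : 'rV[R]_q :=
  rsubmx (lsubmx w).
Definition jlin (R : realType) (p q : nat) (w : 'rV[R]_(p + q + p * q)) : 'M[R]_(p, q) :=
  vec_mx (rsubmx w).

Fact jsrc_is_linear R p q : linear (@jsrc R p q).
Proof. by move=> a u v; rewrite /jsrc !linearP. Qed.
HB.instance Definition _ (R : realType) (p q : nat) :=
  GRing.isLinear.Build R _ _ _ (@jsrc R p q) (@jsrc_is_linear R p q).
Fact jtgt_is_linear R p q : linear (@jtgt R p q).
Proof. by move=> a u v; rewrite /jtgt !linearP. Qed.
HB.instance Definition _ (R : realType) (p q : nat) :=
  GRing.isLinear.Build R _ _ _ (@jtgt R p q) (@jtgt_is_linear R p q).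
Fact jlin_is_linear R p q : linear (@jlin R p q).
Proof. by move=> a u v; rewrite /jlin !linearP. Qed.
HB.instance Definition _ (R : realType) (p q : nat) :=
  GRing.isLinear.Build R _ _ _ (@jlin R p q) (@jlin_is_linear R p q).

Definition jmk (R : realType) (p q : nat) (x : 'rV[R]_p) (y : 'rV[R]_q) (A : 'M[R]_(p, q)) :
  'rV[R]_(p + q + p * q) := row_mx (row_mx x y) (mxvec A).

Section JetCharts.
Context {R : realType}.
Implicit Types (N P : charted R) (V : normedModType R).

Lemma jmkK p q (x : 'rV[R]_p) (y : 'rV[R]_q) A :
  (jsrc (jmk x y A) = x) * (jtgt (jmk x y A) = y) * (jlin (jmk x y A) = A).
Proof.
by rewrite /jsrc /jtgt /jlin /jmk !row_mxKl !row_mxKr mxvecK.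
Qed.

Lemma jmkE p q (w : 'rV[R]_(p + q + p * q)) : w = jmk (jsrc w) (jtgt w) (jlin w).
Proof. by rewrite /jmk /jsrc /jtgt /jlin vec_mxK !hsubmxK. Qed.

Lemma derive_lsubmx m n1 n2 V (f : V -> 'M[R]_(m, n1 + n2)) z v : differentiable f z ->
  'D_v (fun y => lsubmx (f y)) z = lsubmx ('D_v f z).
Proof. exact: derive_lin. Qed.

Lemma derive_rsubmx m n1 n2 V (f : V -> 'M[R]_(m, n1 + n2)) z v : differentiable f z ->
  'D_v (fun y => rsubmx (f y)) z = rsubmx ('D_v f z).
Proof. exact: derive_lin. Qed.

Lemma derive_vec_mx p q V (f : V -> 'rV[R]_(p * q)) z v : differentiable f z ->
  'D_v (fun y => vec_mx (f y)) z = vec_mx ('D_v f z).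
Proof. exact: derive_lin. Qed.

Lemma derive_jsrc p q V (f : V -> 'rV[R]_(p + q + p * q)) z v : differentiable f z ->
  'D_v (fun y => jsrc (f y)) z = jsrc ('D_v f z).
Proof. exact: derive_lin. Qed.

Lemma derive_jtgt p q V (f : V -> 'rV[R]_(p + q + p * q)) z v : differentiable f z ->
  'D_v (fun y => jtgt (f y)) z = jtgt ('D_v f z).
Proof. exact: derive_lin. Qed.

Lemma derive_jlin p q V (f : V -> 'rV[R]_(p + q + p * q)) z v : differentiable f z ->
  'D_v (fun y => jlin (f y)) z = jlin ('D_v f z).
Proof. exact: derive_lin. Qed.

Lemma coord_Hom N P (a j : Hom N P) : coord a j = jmk (coord a.1.1 j.1.1)
  (coord a.1.2 j.1.2) (tr a.1.1 j.1.1 j.1.1 *m j.2 *m tr j.1.2 a.1.2 j.1.2).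
Proof. by rewrite -tc_invE -tcE. Qed.

Lemma coord_TB N (a v : TB N) :
  coord a v = row_mx (coord a.1 v.1) (v.2 *m tr v.1 a.1 v.1).
Proof. by rewrite -tcE. Qed.

Lemma lsub_coord_TB N (a v : TB N) :
  lsubmx (coord a v : 'rV_(cdim N + cdim N)) = coord a.1 v.1.
Proof. by rewrite coord_TB row_mxKl. Qed.

Lemma rsub_coord_TB N (a v : TB N) :
  rsubmx (coord a v : 'rV_(cdim N + cdim N)) = v.2 *m tr v.1 a.1 v.1.
Proof. by rewrite coord_TB row_mxKr. Qed.

Lemma coord_jet1 N P (J : Hom N P) (f : N -> P) x : atlas N -> atlas P ->
  smooth_at f x -> cdom J.1.1 x -> cdom J.1.2 (f x) ->
  coord J (jet1 f x) = jmk (coord J.1.1 x) (coord J.1.2 (f x)) (dch J.1.1 J.1.2 f x).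
Proof.
by move=> aN aP sf ax bf; rewrite coord_Hom (dmat_dch (a := J.1.1) (b := J.1.2)).
Qed.

Lemma smooth_to_proj V N (a : TB N) (g : V -> TB N) z :
  smooth_to a g z -> smooth_to a.1 (@tproj R N \o g) z.
Proof.
move=> [dg sg]; split=> //; apply: smooth_near_ext (smooth_near_lin lsubmx sg).
by apply: nearW => y; exact: lsub_coord_TB.
Qed.

Lemma derive_proj V N (a : TB N) (g : V -> TB N) z v : smooth_to a g z ->
  'D_v (coord a.1 \o (@tproj R N \o g)) z = lsubmx ('D_v (coord a \o g) z).
Proof.
move=> sg; rewrite -(derive_lin lsubmx v (smooth_to_diff sg)).
by congr ('D_v _ z); apply/funext => y; exact/esym/lsub_coord_TB.
Qed.

Lemma velocityE N (c : R -> N) : velocity c = (c 0, 'D_1 (coord (c 0) \o c) 0).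
Proof. by rewrite /velocity derive1E. Qed.

Lemma coord_velocity N (a : TB N) (c : R -> N) : atlas N -> smooth_to a.1 c 0 ->
  coord a (velocity c) = row_mx (coord a.1 (c 0)) ('D_1 (coord a.1 \o c) 0).
Proof.
move=> aN sc; have c0 := at_center aN (c 0); have ac := smooth_to_dom sc.
rewrite velocityE coord_TB /=.
by rewrite -(derive_to_chart (1 : R) aN (smooth_to_chart aN sc c0) ac).
Qed.

(** A straight line in the chart at [v.1] has velocity [v], so the selection never falls back on its
    default. *)
Lemma curve_ofP N (v : TB N) : atlas N ->
  [/\ smooth_to v.1 (curve_of v) 0, curve_of v 0 = v.1 & velocity (curve_of v) = v].
Proof.
move=> aN; rewrite /curve_of; set A := [set c | _].
suff [c Ac] : exists c, A c.
  have : A (xget (fun=> v.1) A) by apply: xgetPex; exists c.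
  case=> s E; have E0 : xget (fun=> v.1) A 0 = v.1 by rewrite -[in RHS]E.
  by split=> //; have := s; rewrite /smooth_curve E0.
have vv := at_center aN v.1.
pose l (t : R) : 'rV[R]_(cdim N) := coord v.1 v.1 + t *: v.2.
have El : l = (fun t => coord v.1 v.1 + t%:M *m v.2).
  by apply/funext => t; rewrite mul_scalar_mx.
have st (t : R) : smooth_near (fun t : R => t%:M : 'M[R]_1) t.
  apply: smooth_near_mx => i j; under eq_fun do rewrite mxE !ord1 mulr1n.
  exists setT; split=> //; first exact: openT.
  case=> [z _|k]; first exact: cvg_id.
  split=> [z _|w]; first exact: ex_diff.
  have -> : 'D_w (fun t : R => t) = (fun=> w) by apply/funext => y; exact: derive_id.
  exact: Ck_cst.
have sl t : smooth_near l t.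
  rewrite El; apply: smooth_nearD; first exact: smooth_near_cst.
  by apply: smooth_near_mulmx; [exact: st|exact: smooth_near_cst].
have l0 : l 0 = coord v.1 v.1 by rewrite /l scale0r addr0.
have nl : \forall t \near (0 : R), cdom v.1 (cinv v.1 (l t)) /\ coord v.1 (cinv v.1 (l t)) = l t.
  have cl : l @ (0 : R) --> l 0 := smooth_near_cont (sl 0).
  by have := near_center aN vv; rewrite -l0 => /cl.
pose c t := cinv v.1 (l t); have c0 : c 0 = v.1 by rewrite /c l0 (at_K aN vv).
exists c; split.
  rewrite /smooth_curve c0; split; first by apply: filterS nl => t [].
  by apply: smooth_near_ext (sl 0); apply: filterS nl => t [].
have Dl : 'D_1 (coord v.1 \o c) 0 = v.2.
  rewrite -[RHS](derive_line (coord v.1 v.1) v.2 0).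
  by apply: near_eq_derive; apply: filterS nl => t [].
by rewrite velocityE c0 Dl; case: (v).
Qed.

End JetCharts.

(** * Coordinate formulas for the actions *)

Definition act1_loc (R : realType) (n : nat) (w : 'rV[R]_(n + n + n * n))
    (X : 'rV[R]_(n + n)) : 'rV[R]_(n + n) :=
  row_mx (jtgt w) (rsubmx X *m jlin w).

(** For X = ((x, v), (u, w)) and an arrow [jtgt W] with target y and linear part A, this is (y, v A)
    together with its derivative when the base point moves along u and v along w; the arrow then
    varies by [u *m jlin W]. *)
Definition act2_loc (R : realType) (n : nat)
    (W : 'rV[R]_(n + (n + n + n * n) + n * (n + n + n * n)))
    (X : 'rV[R]_(n + n + (n + n))) : 'rV[R]_(n + n + (n + n)) :=
  row_mx (act1_loc (jtgt W) (lsubmx X))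
    (row_mx (jtgt (lsubmx (rsubmx X) *m jlin W))
       (rsubmx (rsubmx X) *m jlin (jtgt W)
        + rsubmx (lsubmx X) *m jlin (lsubmx (rsubmx X) *m jlin W))).

Lemma act2_locE (R : realType) (n : nat) (w w' : 'rV[R]_(n + n + n * n))
    (h h' : 'rV[R]_(n + n)) W (X : 'rV[R]_(n + n + (n + n))) :
  w = jtgt W -> w' = lsubmx h' *m jlin W -> row_mx h h' = X ->
  row_mx (act1_loc w h) (row_mx (jtgt w') (rsubmx h' *m jlin w + rsubmx h *m jlin w'))
  = act2_loc W X.
Proof. by move=> -> -> <-; rewrite /act2_loc !row_mxKl !row_mxKr. Qed.

(** The differential of [act2_loc] at (W, X) in the direction (W', X'). With W' the derivative of a
    bisection of the second groupoid, it is the fibre part of the action on T^3M. *)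
Definition dact2_loc (R : realType) (n : nat)
    (W W' : 'rV[R]_(n + (n + n + n * n) + n * (n + n + n * n)))
    (X X' : 'rV[R]_(n + n + (n + n))) : 'rV[R]_(n + n + (n + n)) :=
  row_mx (row_mx (jtgt (jtgt W'))
      (rsubmx (lsubmx X') *m jlin (jtgt W) + rsubmx (lsubmx X) *m jlin (jtgt W')))
    (row_mx (jtgt (lsubmx (rsubmx X') *m jlin W + lsubmx (rsubmx X) *m jlin W'))
       (rsubmx (rsubmx X') *m jlin (jtgt W) + rsubmx (rsubmx X) *m jlin (jtgt W')
        + (rsubmx (lsubmx X') *m jlin (lsubmx (rsubmx X) *m jlin W)
           + rsubmx (lsubmx X) *m
               jlin (lsubmx (rsubmx X') *m jlin W + lsubmx (rsubmx X) *m jlin W')))).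

Lemma derive_act2_loc (R : realType) (n : nat) (V : normedModType R)
    (f : V -> 'rV[R]_(n + (n + n + n * n) + n * (n + n + n * n)))
    (g : V -> 'rV[R]_(n + n + (n + n))) z v :
  differentiable f z -> differentiable g z ->
  'D_v (fun t => act2_loc (f t) (g t)) z
  = dact2_loc (f z) ('D_v f z) (g z) ('D_v g z).
Proof.
move=> df dg; rewrite /act2_loc /act1_loc.
have dl := differentiable_lin lsubmx dg; have dr := differentiable_lin rsubmx dg.
have dlr := differentiable_lin rsubmx dl.
have drl := differentiable_lin lsubmx dr; have drr := differentiable_lin rsubmx dr.
have dj := differentiable_lin (@jtgt _ _ _) df.
have djt := differentiable_lin (@jtgt _ _ _) dj.
have djl := differentiable_lin (@jlin _ _ _) dj.
have dL := differentiable_lin (@jlin _ _ _) df.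
have du := differentiable_mulmx drl dL.
have dut := differentiable_lin (@jtgt _ _ _) du.
have dul := differentiable_lin (@jlin _ _ _) du.
have d1 := differentiable_mulmx dlr djl.
have d2 := differentiable_mulmx drr djl.
have d3 := differentiable_mulmx dlr dul.
rewrite (derive_row_mx v (differentiable_row_mx djt d1)
   (differentiable_row_mx dut (differentiableD d2 d3))).
rewrite (derive_row_mx v djt d1) (derive_row_mx v dut (differentiableD d2 d3)).
rewrite (derive_add v d2 d3) (derive_mulmx v dlr djl) (derive_mulmx v drr djl)
  (derive_mulmx v dlr dul).
rewrite (derive_jtgt v dj) (derive_jlin v dj) (derive_jtgt v du) (derive_jlin v du).
rewrite (derive_mulmx v drl dL) (derive_jlin v df) (derive_jtgt v df).
rewrite (derive_rsubmx v dl) (derive_lsubmx v dr) (derive_rsubmx v dr).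
by rewrite (derive_lsubmx v dg) (derive_rsubmx v dg).
Qed.

Section Actions.
Context {R : realType} {n : nat} (M : manifold R n).
Let aM : atlas M. Proof. exact: atlas_manifold M. Qed.
Let aTM : atlas (TB M). Proof. exact: atlas_TB aM. Qed.
Let aTTM : atlas (TB (TB M)). Proof. exact: atlas_TB aTM. Qed.
Let aB : atlas (Hom M M). Proof. exact: atlas_Hom aM aM. Qed.
Let aBB : atlas (Hom M (Hom M M)). Proof. exact: atlas_Hom aM aB. Qed.

(** Indices for bundle charts. The chart at an element of [TB] or [Hom] depends only on base points,
    so a zero fibre part serves for every element over them. *)
Definition t1 (x : M) : TB M := (x, 0).
Definition t2 (x : M) : TB (TB M) := (t1 x, 0).
Definition c1 (x y : M) : Hom M M := (x, y, 0).
Definition c2 (x y : M) : Hom M (Hom M M) := (x, c1 x y, 0).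

Lemma repP (G : groupoid M) (j : gspace (jets G)) : gset j ->
  [/\ bisection (rep j).1 (rep j).2, (rep j).1 j.1.1 & j = jet1 (rep j).2 j.1.1].
Proof.
move=> [U [b [H1 H2 H3]]]; rewrite /rep; set A := [set Ub | _].
by have : A (xget (set0, fun=> j.1.2) A); [apply: xgetPex; exists (U, b)|].
Qed.

Lemma near_M (x0 x : M) (U : set (mtop M)) : cdom x0 x -> nbhs (x : mtop M) U ->
  \forall z \near coord x0 x, U (cinv x0 z).
Proof.
move=> dx nU.
have az : (mcoord (x0 : mtop M) @` mdom x0) (coord x0 x) by exists x.
have c : mcinv x0 @ coord x0 x --> mcinv (x0 : mtop M) (coord x0 x) := m_cinv_cont az.
by apply: c; rewrite (m_coordK dx).
Qed.

Lemma near_bis (V : normedModType R) (x0 : M) (g : V -> M) z (U : set (mtop M)) :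
  smooth_to x0 g z -> open U -> U (g z) -> \forall y \near z, U (g y).
Proof.
move=> sg oU Uz.
have nU : nbhs (g z : mtop M) U by apply: open_nbhs_nbhs.
exact: (@near_to _ _ M x0 g z U aM sg (near_M (smooth_to_dom sg) nU)).
Qed.

Lemma act1_coord (xi : Hom M M) (v : TB M) (x0 y0 : M) : xi.1.1 = v.1 ->
  cdom x0 v.1 -> cdom y0 xi.1.2 ->
  coord (t1 y0) (act1 (xi : gspace (B1 M)) v) =
    act1_loc (coord (c1 x0 y0) xi) (coord (t1 x0) v).
Proof.
move=> E dx dy; have xx := at_center aM v.1.
have K : v.2 *m xi.2 *m tr xi.1.2 y0 xi.1.2 = v.2 *m tr v.1 x0 v.1 *m
    (tr x0 xi.1.1 xi.1.1 *m xi.2 *m tr xi.1.2 y0 xi.1.2).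
  rewrite E.
  rewrite !mulmxA.
  congr (_ *m _ *m _).
  rewrite -mulmxA.
  rewrite (tr_comp aM xx dx xx).
  by rewrite (tr_id aM xx) mulmx1.
rewrite /act1_loc rsub_coord_TB (coord_Hom (c1 x0 y0)) !jmkK coord_TB.
exact: (congr1 (row_mx (coord y0 xi.1.2)) K).
Qed.

(** The chosen bisection and curve enter through their values and first derivatives at one point,
    which are coordinates of [j] and [V]. Charts around the endpoints are arbitrary because the
    action on T^3M differentiates this formula along a curve. *)
Lemma act2_coord (j : gspace (B11nh M)) (V : TB (TB M)) (x0 y0 : M) :
  gset j -> V.1.1 = j.1.1 -> cdom x0 j.1.1 -> cdom y0 j.1.2.1.2 ->
  (act2 j V).1.1 = j.1.2.1.2 /\
  coord (t2 y0) (act2 j V) = act2_loc (coord (c2 x0 y0) j) (coord (t2 x0) V).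
Proof.
move=> gj Vj dx dy; have [[oU bU dU] Ux jE] := repP gj.
have [sc c0 vc] := curve_ofP V aTM.
rewrite /act2; set b := (rep j).2 in bU dU jE *; set U := (rep j).1 in oU bU dU Ux.
set c := curve_of V in sc c0 vc *.
have sc0 : smooth_to (t1 x0) c 0.
  by apply: smooth_to_chart sc _ => //; rewrite c0 -[cdom _ _]/(cdom x0 V.1.1) Vj.
have sp := smooth_to_proj sc0; have p0 : (@tproj R M \o c) 0 = j.1.1.
  by rewrite /comp c0 /tproj Vj.
have [_ _ sb] := bU _ Ux.
have bE : b j.1.1 = j.1.2 by rewrite [in RHS]jE.
have bs x : U x -> (b x).1.1 = x by move=> /bU[].
have sb' : smooth_in x0 (c1 x0 y0) b j.1.1.
  apply: smooth_at_in => //; rewrite bE; split=> //.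
  by rewrite -[X in cdom X _]/x0 -bE bs.
have dJ : cdom (c1 x0 y0) (b j.1.1) by have := smooth_to_dom sb'; rewrite /comp (at_K aM dx).
have WE := etrans (congr1 (coord (c2 x0 y0)) jE) (coord_jet1 (J := c2 x0 y0) aM aB sb dx dJ).
have sg : smooth_to (c1 x0 y0) (b \o (@tproj R M \o c)) 0.
  by apply: smooth_to_comp aM sp _; rewrite p0.
have nU : \forall t \near (0 : R), U (c t).1 by apply: near_bis sp oU _; rewrite p0.
pose g t := coord (c1 x0 y0) (b (c t).1); pose h t := coord (t1 x0) (c t).
have dg : differentiable g 0 := smooth_to_diff sg.
have dh : differentiable h 0 := smooth_to_diff sc0.
pose k t := act1 (b (c t).1) (c t).
have nk : \forall t \near (0 : R), cdom (t1 y0) (k t) /\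
    act1_loc (g t) (h t) = coord (t1 y0) (k t).
  apply: filterS3 nU sg.1 sc0.1 => t Ut [d1 d2] d3; split; first exact: d2.
  by apply/esym/act1_coord; [exact: bs|exact: d3|exact: d2].
have sk : smooth_to (t1 y0) k 0.
  split; first by apply: filterS nk => t [].
  apply: (@smooth_near_ext _ _ _ (fun t => act1_loc (g t) (h t))).
    by apply: filterS nk => t [].
  apply: smooth_near_row_mx; first exact: smooth_near_lin sg.2.
  apply: smooth_near_mulmx; first exact: smooth_near_lin sc0.2.
  exact: smooth_near_lin sg.2.
have k0 : (k 0).1 = j.1.2.1.2 by rewrite /k /= c0 Vj bE.
split; first exact: k0.
rewrite (coord_velocity (a := t2 y0)) //.
have -> : 'D_1 (coord (t1 y0) \o k) 0 = 'D_1 (fun t => act1_loc (g t) (h t)) 0.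
  by apply/esym/near_eq_derive; apply: filterS nk => t [].
rewrite -(nbhs_singleton nk).2 /act1_loc derive_row_mx; last 2 first.
- exact: differentiable_lin.
- by apply: differentiable_mulmx; exact: differentiable_lin.
rewrite derive_mulmx; [|exact: differentiable_lin..].
rewrite (derive_jtgt (1 : R) dg) (derive_jlin (1 : R) dg) (derive_rsubmx (1 : R) dh).
have hE : row_mx (h 0) ('D_1 h 0) = coord (t2 x0) V.
  by rewrite -vc (coord_velocity (a := t2 x0) aTM sc0).
have gE : g 0 = jtgt (coord (c2 x0 y0) j).
  by rewrite WE jmkK /g c0 Vj.
have DgE : 'D_1 g 0 = lsubmx ('D_1 h 0) *m jlin (coord (c2 x0 y0) j).
  rewrite WE jmkK -(derive_proj (1 : R) sc0) -[X in dch _ _ _ X]p0.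
  by apply: (derive_to_comp (1 : R) aM sp); rewrite p0.
exact: act2_locE gE DgE hE.
Qed.

Lemma act2_tgt (j : gspace (B11nh M)) (V : TB (TB M)) :
  gset j -> V.1.1 = j.1.1 -> (act2 j V).1.1 = j.1.2.1.2.
Proof.
move=> gj Vj.
have [] := act2_coord gj Vj (at_center aM _) (at_center aM _).
by [].
Qed.

Lemma coord_t2 (a : TB (TB M)) : coord a = coord (t2 a.1.1).
Proof. by []. Qed.

Lemma coord_c2 (j : Hom M (Hom M M)) (x : M) : j.1.1 = x -> j.1.2.1.1 = x ->
  coord j = coord (c2 x j.1.2.1.2).
Proof.
move=> E1 E2; rewrite -[LHS]/(coord ((j.1.1, (j.1.2.1.1, j.1.2.1.2, 0), 0) : Hom M (Hom M M))).
by rewrite E1 E2.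
Qed.

Lemma B1_src (j : gspace (B11nh M)) : gset j -> j.1.2.1.1 = j.1.1.
Proof.
move=> /repP[[_ /(_ j.1.1) bU _] Ux jE].
have jb : j.1.2 = (rep j).2 j.1.1 by rewrite {1}jE.
by have [_ + _] := bU Ux; rewrite -jb.
Qed.

Lemma B11_src (j : gspace (B111nh M)) : gset j -> gset j.1.2 /\ j.1.2.1.1 = j.1.1.
Proof.
move=> /repP[[_ /(_ j.1.1) bU _] Ux jE].
have jb : j.1.2 = (rep j).2 j.1.1 by rewrite {1}jE.
by have [+ + _] := bU Ux; rewrite -jb.
Qed.

(** Differentiates the formula for the 2-jet action along a curve. In charts centred at source and
    target, [V.2] and [j.2] appear without transition matrices. *)
Lemma act3E (j : gspace (B111nh M)) (V : TB (TB (TB M))) :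
  gset j -> V.1.1.1 = j.1.1 ->
  act3 j V = (act2 j.1.2 V.1,
    dact2_loc (coord (c2 j.1.1 j.1.2.1.2.1.2) j.1.2) (lsubmx (lsubmx V.2) *m j.2)
      (coord (t2 j.1.1) V.1) V.2).
Proof.
move=> gj Vj; have [gj1 sj1] := B11_src gj; have [[oU bU dU] Ux jE] := repP gj.
have sj2 := B1_src gj1.
have [sc c0 vc] := curve_ofP V aTTM.
rewrite /act3; set b := (rep j).2 in bU dU jE *; set U := (rep j).1 in oU bU dU Ux.
set c := curve_of V in sc c0 vc *.
set x := j.1.1 in Vj Ux jE sj1 *; set y := j.1.2.1.2.1.2.
have xx := at_center aM x; have yy := at_center aM y.
have sc0 : smooth_to (t2 V.1.1.1) c 0 := sc; rewrite Vj in sc0.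
have sp := smooth_to_proj (smooth_to_proj sc0).
have bE : b x = j.1.2 by rewrite [in RHS]jE.
have bs z : U z -> [/\ gset (b z), (b z).1.1 = z & (b z).1.2.1.1 = z].
  by move=> /bU[g1 g2 _]; split=> //; rewrite (B1_src g1).
have [_ _ sb] := bU _ Ux.
have p0 : (@tproj R M \o (@tproj R (TB M) \o c)) 0 = x by rewrite /comp c0 /tproj Vj.
have c2E : coord (b x) = coord (c2 x y).
  rewrite bE; exact: (coord_c2 sj1 (etrans sj2 sj1)).
have sb' : smooth_in x (c2 x y) b x.
  have sb0 : smooth_in x (b x) b x := sb.
  have db : cdom (c2 x y) (b x).
    rewrite bE -[cdom _ _]/(cdom x j.1.2.1.1 /\ (cdom x j.1.2.1.2.1.1 /\ cdom y y)).
    by rewrite sj2 sj1; exact: (conj xx (conj xx yy)).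
  exact: (smooth_in_chart aM aBB sb0 xx xx db).
have sg : smooth_to (c2 x y) (b \o (@tproj R M \o (@tproj R (TB M) \o c))) 0.
  by apply: smooth_to_comp aM sp _; rewrite p0.
have nU : \forall t \near (0 : R), U (c t).1.1 by apply: near_bis sp oU _; rewrite p0.
pose g t := coord (c2 x y) (b (c t).1.1); pose h t := coord (t2 x) (c t).
have dg : differentiable g 0 := smooth_to_diff sg.
have dh : differentiable h 0 := smooth_to_diff sc0.
pose k t := act2 (b (c t).1.1) (c t).
have nk : \forall t \near (0 : R), act2_loc (g t) (h t) = coord (t2 y) (k t).
  apply: filterS3 nU sg.1 sc0.1 => t Ut [d1 [_ d2]] d3; have [b1 b2 _] := bs _ Ut.
  by have [_ ->] := act2_coord (j := b (c t).1.1) (V := c t) (x0 := x) (y0 := y) b1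
    (esym b2) d1 d2.
have k0 : k 0 = act2 j.1.2 V.1 by rewrite /k c0 Vj bE.
(* The velocity is taken in the chart at [k 0], which is the chart at y because y is the base point
   of [k 0]. *)
have cy : coord (k 0) = coord (t2 y).
  have k1 : (k 0).1.1 = y by rewrite k0; exact: act2_tgt gj1 (etrans Vj (esym sj1)).
  by rewrite -k1; exact: coord_t2.
have VE : velocity k = (k 0, 'D_1 (coord (t2 y) \o k) 0) by rewrite velocityE cy.
have Dk : 'D_1 (coord (t2 y) \o k) 0 = 'D_1 (fun t => act2_loc (g t) (h t)) 0.
  exact/esym/near_eq_derive.
apply: etrans VE _; rewrite {}Dk {1}k0.
rewrite (derive_act2_loc (1 : R) dg dh).
have h0 : h 0 = coord (t2 x) V.1 by rewrite /h c0.
have Dh : 'D_1 h 0 = V.2.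
  have hx : coord (c 0) = coord (t2 x) by rewrite c0 -Vj; exact: coord_t2.
  have v2 : (velocity c).2 = 'D_1 (coord (c 0) \o c) 0 by rewrite velocityE.
  by rewrite hx in v2; exact: etrans (esym v2) (congr1 snd vc).
have g0 : g 0 = coord (c2 x y) j.1.2 by rewrite /g c0 Vj bE.
have Dg : 'D_1 g 0 = lsubmx (lsubmx V.2) *m j.2.
  have j2 : j.2 = dch x (c2 x y) b x by rewrite [in LHS]jE /= dmatE !dchE c2E.
  rewrite j2 -Dh -(derive_proj (1 : R) sc0).
  have := derive_proj (1 : R) (smooth_to_proj sc0) => <-.
  rewrite -[X in dch _ _ _ X]p0.
  by apply: (derive_to_comp (1 : R) aM sp); rewrite p0.
by rewrite h0 Dh g0 Dg.
Qed.

End Actions.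

(** * The connection in charts *)

Section HomProj.
Context {R : realType}.
Implicit Types (N P : charted R) (V : normedModType R).

Lemma jsrc_coord N P (J j : Hom N P) : jsrc (coord J j) = coord J.1.1 j.1.1.
Proof. by rewrite coord_Hom jmkK. Qed.

Lemma jtgt_coord N P (J j : Hom N P) : jtgt (coord J j) = coord J.1.2 j.1.2.
Proof. by rewrite coord_Hom jmkK. Qed.

Lemma jlin_coord N P (J j : Hom N P) : jlin (coord J j) =
  tr J.1.1 j.1.1 j.1.1 *m j.2 *m tr j.1.2 J.1.2 j.1.2.
Proof. by rewrite coord_Hom jmkK. Qed.

Lemma smooth_to_tgt V N P (J : Hom N P) (g : V -> Hom N P) z :
  smooth_to J g z -> smooth_to J.1.2 (fun y => (g y).1.2) z.
Proof.
move=> [dg sg]; split; first by apply: filterS dg => y [].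
apply: smooth_near_ext (smooth_near_lin (@jtgt _ _ _) sg).
by apply: nearW => y; exact: jtgt_coord.
Qed.

Lemma derive_tgt V N P (J : Hom N P) (g : V -> Hom N P) z v : smooth_to J g z ->
  'D_v (fun y => coord J.1.2 (g y).1.2) z = jtgt ('D_v (coord J \o g) z).
Proof.
move=> sg; apply: etrans (derive_jtgt v (smooth_to_diff sg)).
by congr ('D_v _ z); apply/funext => y; exact/esym/jtgt_coord.
Qed.

Lemma derive_src V N P (J : Hom N P) (g : V -> Hom N P) z v : smooth_to J g z ->
  'D_v (fun y => coord J.1.1 (g y).1.1) z = jsrc ('D_v (coord J \o g) z).
Proof.
move=> sg; apply: etrans (derive_jsrc v (smooth_to_diff sg)).
by congr ('D_v _ z); apply/funext => y; exact/esym/jsrc_coord.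
Qed.

End HomProj.

Lemma derive_comp_eq (R : realType) (U V W : normedModType R) (f : U -> V) (g : V -> W)
    z v w u : differentiable f z -> f z = w -> 'D_v f z = u -> differentiable g w ->
  'D_v (fun y => g (f y)) z = 'D_u g w.
Proof. by move=> df <- <- dg; exact: derive_comp. Qed.

Lemma derive_mulmx_comp0 (R : realType) m n p k l (V : normedModType R)
    (h : V -> 'M[R]_(k, l)) (f : 'M[R]_(k, l) -> 'M[R]_(m, n))
    (g : 'M[R]_(k, l) -> 'M[R]_(n, p)) z u :
  differentiable h z -> differentiable f (h z) -> differentiable g (h z) -> f (h z) = 0 ->
  'D_u (fun y => f (h y) *m g (h y)) z = 'D_('D_u h z) f (h z) *m g (h z).
Proof.
move=> dh df dg f0.
have dfh := differentiable_comp dh df; have dgh := differentiable_comp dh dg.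
apply: etrans (derive_mulmx u dfh dgh) _.
rewrite /comp f0 mul0mx addr0.
exact: (congr1 (fun A => A *m g (h z)) (derive_comp u dh df)).
Qed.

Section Fields.
Context {R : realType} {n : nat} (M : manifold R n).
Let aM : atlas M. Proof. exact: atlas_manifold M. Qed.
Let aTM : atlas (TB M). Proof. exact: atlas_TB aM. Qed.
Let aB : atlas (Hom M M). Proof. exact: atlas_Hom aM aM. Qed.

Lemma rep_chart (j : gspace (B11nh M)) (x0 y0 : M) : gset j ->
  cdom x0 j.1.1 -> cdom y0 j.1.2.1.2 ->
  [/\ bisection (rep j).1 (rep j).2, (rep j).1 j.1.1,
      smooth_in x0 (c1 x0 y0) (rep j).2 j.1.1, (rep j).2 j.1.1 = j.1.2
    & coord (c2 x0 y0) j = jmk (coord x0 j.1.1) (coord (c1 x0 y0) j.1.2)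
        (dch x0 (c1 x0 y0) (rep j).2 j.1.1)].
Proof.
move=> gj dx dy; have [bb Ux jE] := repP gj; have [oU bU dU] := bb.
set b := (rep j).2 in bb bU dU jE *.
have bE : b j.1.1 = j.1.2 by rewrite [in RHS]jE.
have [_ _ sb] := bU _ Ux.
have dJ : cdom (c1 x0 y0) (b j.1.1).
  have dx' : cdom x0 j.1.2.1.1 by rewrite (B1_src gj).
  by rewrite bE; exact: (conj dx' dy).
have sb' := smooth_at_in (a := x0) (b := c1 x0 y0) aM aB dx dJ sb.
split=> //; apply: etrans (congr1 (coord (c2 x0 y0)) jE) _.
apply: etrans (coord_jet1 (J := c2 x0 y0) aM aB sb dx dJ) _.
by rewrite bE.
Qed.

Lemma dch_tgt (b : M -> Hom M M) (x0 y0 x : M) : cdom x0 x ->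
  smooth_in x0 (c1 x0 y0) b x ->
  smooth_in x0 y0 (fun x => (b x).1.2) x /\
  forall u, u *m dch x0 y0 (fun x => (b x).1.2) x = jtgt (u *m dch x0 (c1 x0 y0) b x).
Proof.
move=> dx sb; have st := smooth_to_tgt sb; split=> // u.
rewrite -(dchP u sb) -(derive_tgt u sb); apply/esym.
exact: (dchP u (st : smooth_in x0 y0 (fun x => (b x).1.2) x)).
Qed.

Lemma B11sh_coord (j : gspace (B11nh M)) (x0 y0 : M) u : B11sh j ->
  cdom x0 j.1.1 -> cdom y0 j.1.2.1.2 ->
  jtgt (u *m jlin (coord (c2 x0 y0) j)) = u *m jlin (jtgt (coord (c2 x0 y0) j)).
Proof.
move=> [gj E] dx dy; have [bb Ux sb bE ->] := rep_chart gj dx dy.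
have [st Et] := dch_tgt dx sb.
have {}E : j.1.2 = jet1 (fun x => ((rep j).2 x).1.2) j.1.1 := E.
have dy' : cdom y0 ((rep j).2 j.1.1).1.2 by rewrite bE.
have sa := smooth_in_at aM aM dx st.
have F : jlin (coord (c1 x0 y0) j.1.2) =
    dch x0 y0 (fun x => ((rep j).2 x).1.2) j.1.1.
  have C := coord_jet1 (J := c1 x0 y0) aM aM sa dx dy'.
  apply: etrans (congr1 (fun h => jlin (coord (c1 x0 y0) h)) E) _.
  exact: etrans (congr1 (@jlin R n n) C) (jmkK _ _ _).2.
by move: (coord (c1 x0 y0) _) F => cj F; rewrite !jmkK F Et.
Qed.

(** A bisection is a section of the source map: its source component is the identity near the point,
    and so is the derivative. *)
Lemma B11_srcE (j : gspace (B11nh M)) (x0 y0 : M) u : gset j ->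
  cdom x0 j.1.1 -> cdom y0 j.1.2.1.2 ->
  jsrc (u *m jlin (coord (c2 x0 y0) j)) = u.
Proof.
move=> gj dx dy; have [[oU bU _] Ux sb bE ->] := rep_chart gj dx dy.
move: (coord (c1 x0 y0) _) => cj; rewrite !jmkK -(dchP u sb) -(derive_src u sb).
rewrite -[RHS](derive_cinv u aM dx); apply: near_eq_derive.
have nU := near_bis (smooth_to_cinv aM dx) oU.
rewrite (at_K aM dx) in nU.
by apply: filterS (nU Ux) => z /bU[_ E _]; exact: (congr1 (coord x0) E).
Qed.

Lemma vlocal_coord (X : vfield M) (x0 x : M) : cdom x0 x ->
  vlocal x0 X (coord x0 x) = X x *m tr x x0 x.
Proof. by move=> dx; rewrite /vlocal (at_K aM dx) -tcE. Qed.

Lemma vlocal_center (X : vfield M) (x : M) : vlocal x X (coord x x) = X x.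
Proof.
have xx := at_center aM x.
by rewrite vlocal_coord// (tr_id aM xx) mulmx1.
Qed.

Lemma vlocal_smooth (X : vfield M) (x0 x : M) : cdom x0 x ->
  smooth_vfield_at X x -> smooth_near (vlocal x0 X) (coord x0 x).
Proof.
move=> dx sX; have [_ s2] := smooth_at_in (a := x0) (b := t1 x0) (f := sec X) aM aTM dx dx sX.
have E : (fun z => rsubmx ((coord (t1 x0) \o (sec X \o cinv x0)) z)) = vlocal x0 X.
  by apply/funext => z; rewrite /vlocal tcE; exact: (rsub_coord_TB (t1 x0) (sec X (cinv x0 z))).
by rewrite -E; exact: (smooth_near_lin rsubmx s2).
Qed.

Lemma smooth_vlocal (X : vfield M) (x : M) :
  smooth_near (vlocal x X) (coord x x) -> smooth_vfield_at X x.
Proof.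
move=> sX; have xx := at_center aM x; have nx := near_center aM xx.
split; first by apply: filterS nx => z [].
apply: (@smooth_near_ext _ _ _ (fun z => row_mx z (vlocal x X z))).
  apply: filterS nx => z [dz cz].
  exact: (congr1 (fun w => row_mx w (vlocal x X z)) (esym cz)).
apply: smooth_near_row_mx => //; exact: (smooth_near_linear idfun).
Qed.

Lemma vlocal_chart (X : vfield M) (a b x : M) : cdom a x -> cdom b x ->
  \forall z \near coord a x,
  vlocal b X (coord b (cinv a z)) *m
    jacobian (coord a \o cinv b) (coord b (cinv a z)) = vlocal a X z.
Proof.
move=> ax bx; apply: filterS (near_chart aM ax bx) => z [az bz _].
have zz := at_center aM (cinv a z).
rewrite (vlocal_coord X bz) -mulmxA -trE (tr_comp aM zz bz az) -tcE.
by [].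
Qed.

Lemma differentiable_vlocal_chart (X : vfield M) (a b x : M) : cdom a x -> cdom b x ->
  differentiable (vlocal b X) (coord b x) -> differentiable (vlocal a X) (coord a x).
Proof.
move=> ax bx dX; apply: near_eq_differentiable (vlocal_chart X ax bx) _.
have st := at_smooth aM ax bx; have Ex := at_K aM ax.
have sj : smooth_near (jacobian (coord a \o cinv b)) (coord b (cinv a (coord a x))).
  by rewrite Ex; exact/smooth_near_jacobian/at_smooth.
apply: differentiable_mulmx.
  apply: (@differentiable_comp _ _ _ _ (coord b \o cinv a) (vlocal b X)).
    exact: smooth_near_diff st.
  by rewrite /comp Ex.
exact: (smooth_near_diff (smooth_near_comp st sj)).
Qed.

(** Where the field vanishes its derivative is tensorial: the derivative of the transition matrix is
    multiplied by the value of the field, which is 0. *)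
Lemma derive_vlocal_chart (X : vfield M) (a b x : M) u : cdom a x -> cdom b x ->
  differentiable (vlocal b X) (coord b x) -> vlocal b X (coord b x) = 0 ->
  'D_u (vlocal a X) (coord a x) = 'D_(u *m tr a b x) (vlocal b X) (coord b x) *m tr b a x.
Proof.
move=> ax bx dX X0; apply: etrans (esym (near_eq_derive u (vlocal_chart X ax bx))) _.
have st := at_smooth aM ax bx; have Ex := at_K aM ax.
have sj : smooth_near (jacobian (coord a \o cinv b)) (coord b (cinv a (coord a x))).
  by rewrite Ex; exact/smooth_near_jacobian/at_smooth.
have dt := smooth_near_diff st.
have dX' : differentiable (vlocal b X) ((coord b \o cinv a) (coord a x)).
  by rewrite /comp Ex.
have sj' : smooth_near (jacobian (coord a \o cinv b)) ((coord b \o cinv a) (coord a x)).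
  exact: sj.
have E1 : 'D_u (coord b \o cinv a) (coord a x) = u *m tr a b x.
  by rewrite trE; exact: deriveEjacobian.
have E2 : (coord b \o cinv a) (coord a x) = coord b x := congr1 (coord b) Ex.
have X0' : vlocal b X ((coord b \o cinv a) (coord a x)) = 0 := etrans (congr1 _ E2) X0.
apply: etrans (derive_mulmx_comp0 u dt dX' (smooth_near_diff sj') X0') _.
apply: etrans (congr2 (fun w y => 'D_w (vlocal b X) y *m jacobian (coord a \o cinv b) y) E1 E2) _.
exact: (congr1 (mulmx _) (esym (trE b a x))).
Qed.

(** The target map of a bisection has a left inverse [g], so the selected preimage in [push] is the
    intended one. *)
Lemma push_val (Ub : set (mtop M) * (M -> gspace (B1 M))) (Y : vfield M) (x : M) :
  bisection Ub.1 Ub.2 -> Ub.1 x ->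
  push Ub Y (gtgt (Ub.2 x)) = Y x *m ((Ub.2 x).2 : 'M[R]_n).
Proof.
move=> [_ _ [_ [g gP]]] Ux; rewrite /push; set A := [set _ | _].
have [Ua Ea] : A (xget (gtgt (Ub.2 x)) A) by apply: xgetPex; exists x.
have gx y : Ub.1 y -> g ((gtgt (g := B1 M) \o Ub.2) y) = y by move=> /gP[].
by rewrite -(gx _ Ua) /comp Ea -[gtgt _]/((gtgt (g := B1 M) \o Ub.2) x) gx.
Qed.

(** Through the inverse g of the target map, the pushed field at v is the value of Y at g v times
    the arrow there. Differentiating in the direction of the image of u makes the derivative of g
    disappear. *)
Lemma push_local (Ub : set (mtop M) * (M -> gspace (B1 M))) (Y : vfield M) (x x0 y0 : M) :
  bisection Ub.1 Ub.2 -> Ub.1 x -> cdom x0 x -> cdom y0 (Ub.2 x).1.2 ->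
  let P := vlocal y0 (push Ub Y) in let w := coord y0 (Ub.2 x).1.2 in
  let Y0 := vlocal x0 Y in let z := coord x0 x in
  let A := jlin (coord (c1 x0 y0) (Ub.2 x)) in
  P w = Y0 z *m A /\
  (differentiable Y0 z -> differentiable P w /\
    forall u, 'D_(jtgt (u *m dch x0 (c1 x0 y0) Ub.2 x)) P w =
      'D_u Y0 z *m A + Y0 z *m jlin (u *m dch x0 (c1 x0 y0) Ub.2 x)).
Proof.
move=> bb Ux dx dy P w Y0 z A; have [oU bU [oV [g gP]]] := bb.
set U := Ub.1 in bb Ux oU bU oV gP; set b := Ub.2 in bb dy bU oV gP w A *.
pose f x := (b x).1.2; pose y := f x.
have bs x' : U x' -> (b x').1.1 = x' by move=> /bU[].
have gf x' : U x' -> g (f x') = x' by move=> /gP[].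
have gy : g y = x by exact: gf.
have sg : smooth_at g y by have [] := gP x Ux.
have dgy : cdom x0 (g y) by rewrite gy.
have sg' : smooth_in y0 x0 g y := smooth_at_in aM aM dy dgy sg.
have dJ : cdom (c1 x0 y0) (b x).
  have dx' : cdom x0 (b x).1.1 by rewrite bs.
  exact: (conj dx' dy).
have sb : smooth_in x0 (c1 x0 y0) b x.
  by have [_ _ sb] := bU x Ux; exact: smooth_at_in aM aB dx dJ sb.
pose G := g \o cinv y0.
have Gw : G w = x by rewrite /G /comp (at_K aM dy).
have sG : smooth_to x0 G w := sg'.
have sbG : smooth_to (c1 x0 y0) (b \o G) w.
  by apply: (smooth_to_comp aM sG); rewrite Gw.
have key x' : U x' -> cdom x0 x' -> Y x' *m (b x').2 *m tr (f x') y0 (f x') =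
    vlocal x0 Y (coord x0 x') *m jlin (coord (c1 x0 y0) (b x')).
  move=> Ux' dx'; have xx := at_center aM x'.
  rewrite vlocal_coord// jlin_coord bs//.
  rewrite -[tr (c1 x0 y0).1.1 _ _]/(tr x0 x' x') -[tr _ (c1 x0 y0).1.2 _]/(tr (f x') y0 (f x')).
  rewrite !mulmxA; congr (_ *m _ *m _).
  by rewrite -mulmxA (tr_comp aM xx dx' xx) (tr_id aM xx) mulmx1.
have nP : \forall v \near w, Y0 (coord x0 (G v)) *m jlin (coord (c1 x0 y0) (b (G v))) = P v.
  have nV := near_bis (smooth_to_cinv aM dy) oV.
  rewrite (at_K aM dy) in nV.
  have Vy : ((gtgt (g := B1 M) \o b : mtop M -> mtop M) @` U) y by exists x.
  apply: filterS2 (nV Vy) sG.1 => v [x' Ux' E] dv.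
  have Ev : G v = x' by rewrite /G /comp -E; exact: gf.
  have dx' : cdom x0 x' by rewrite -Ev.
  have PE : P v = push Ub Y (f x') *m tr (f x') y0 (f x') by rewrite /P /vlocal -E -tcE.
  have pv : push Ub Y (f x') = Y x' *m (b x').2 := push_val Y bb Ux'.
  by rewrite PE pv (key x' Ux' dx') Ev.
have P0 : P w = Y0 z *m A by rewrite -(nbhs_singleton nP) Gw.
split=> // dY.
have dG := smooth_to_diff sG.
have dYG : differentiable (fun v => Y0 (coord x0 (G v))) w.
  apply: (@differentiable_comp _ _ _ _ (coord x0 \o G) Y0) => //.
  by rewrite /comp Gw.
have djb := smooth_to_diff sbG.
have dj : differentiable (fun v => jlin (coord (c1 x0 y0) (b (G v)))) w.
  exact: differentiable_lin djb.
split; first exact: near_eq_differentiable nP (differentiable_mulmx dYG dj).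
move=> u; set v := jtgt _; apply: etrans (esym (near_eq_derive v nP)) _.
rewrite (derive_mulmx v dYG dj).
have [sf Ef] := dch_tgt dx sb.
(* The target map f carries u to v, and g o f is the identity near x, so the derivative of g returns
   u. *)
have Dv : 'D_v (coord x0 \o G) w = u.
  apply: etrans (dchP v sg') _; rewrite /v -Ef -mulmxA.
  rewrite -(dch_comp (f := f) aM aM dx sf); last by rewrite -/y.
  have sgf : smooth_in x0 x0 (g \o f) x by apply: smooth_in_comp sf _ => //.
  rewrite -(dchP u sgf) -[RHS](derive_cinv u aM dx); apply: near_eq_derive.
  have nU := near_bis (smooth_to_cinv aM dx) oU; rewrite (at_K aM dx) in nU.
  by apply: filterS (nU Ux) => z' Uz'; rewrite /comp gf.
have cG : (coord x0 \o G) w = z := congr1 (coord x0) Gw.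
have DY : 'D_v (fun v => Y0 (coord x0 (G v))) w = 'D_u Y0 z.
  exact: (derive_comp_eq dG cG Dv dY).
have DJ : 'D_v (fun v => jlin (coord (c1 x0 y0) (b (G v)))) w =
    jlin (u *m dch x0 (c1 x0 y0) b x).
  apply: etrans (derive_jlin v djb) (congr1 _ _).
  have sbG' : smooth_in x0 (c1 x0 y0) b (G w) by rewrite Gw.
  apply: etrans (derive_to_comp v aM sG sbG') _.
  exact: (congr2 (fun a c => a *m dch x0 (c1 x0 y0) b c) Dv Gw).
have EA : jlin (coord (c1 x0 y0) (b (G w))) = A by rewrite Gw.
exact: (congr2 +%R (congr2 mulmx DY EA) (congr2 mulmx (congr1 Y0 cG) DJ)).
Qed.

Variable s : M -> gspace (B11nh M).

(* Christoffel matrices: s_x Y has value - Y at x, so half of the derivative of Y + s_x Y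
   is D_u Y minus Y times half the second-order part of s x. *)
Definition gam (x0 : M) (z u : 'rV[R]_n) : 'M[R]_n :=
  - (2^-1 *: jlin (u *m jlin (coord (c2 x0 x0) (s (cinv x0 z)) :
     'rV[R]_(n + (n + n + n * n) + n * (n + n + n * n))))).

Hypothesis hs : symmetry_jet s.

(** The field Y + s_x Y vanishes at x, so its bracket with X there is its derivative along X, in
    every chart. In the derivative of s_x Y two signs cancel: the target map of s_x has derivative
    -1 and its arrow at x is -1. An arbitrary chart around x is allowed because second covariant
    derivatives differentiate at neighbouring points. Differentiability is the form of regularity
    that [push_local] provides for pushed fields. *)
Lemma nabla_local (X Y : vfield M) (x x0 : M) : cdom x0 x ->
  differentiable (vlocal x0 Y) (coord x0 x) ->
  nabla s X Y x *m tr x x0 x =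
    'D_(X x *m tr x x0 x) (vlocal x0 Y) (coord x0 x)
    + Y x *m tr x x0 x *m gam x0 (coord x0 x) (X x *m tr x x0 x).
Proof.
move=> dx dY; have xx := at_center aM x.
have [_ shs srcs pjs] := hs x; have gs := shs.1.
have tgs : (s x).1.2.1.2 = x := congr1 (fun j => j.1.2) pjs.
have dx1 : cdom x0 (s x).1.1 by rewrite [X in cdom _ X]srcs.
have dy1 : cdom x0 (s x).1.2.1.2 by rewrite tgs.
have [bb Ux sb bE cE] := rep_chart gs dx1 dy1.
have shc u := B11sh_coord u shs dx1 dy1.
have srcs' : (s x).1.1 = x := srcs.
rewrite srcs' in Ux sb bE cE.
set Ub := rep (s x) in bb Ux sb bE cE.
have dy2 : cdom x0 (Ub.2 x).1.2 by rewrite bE.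
have [] := push_local Y bb Ux dx dy2.
have -> : (Ub.2 x).1.2 = x by rewrite bE.
set A := jlin (coord (c1 x0 x0) (Ub.2 x)); set D := dch x0 (c1 x0 x0) Ub.2 x.
have AE : A = - 1%:M.
  rewrite /A bE [(s x).1.2]pjs jlin_coord.
  have -> : tr (c1 x0 x0).1.1 (x, x, - 1%:M : 'M[R]_n).1.1 (x, x, - 1%:M : 'M[R]_n).1.1 *m
     (x, x, - 1%:M : 'M[R]_n).2 *m tr (x, x, - 1%:M : 'M[R]_n).1.2 (c1 x0 x0).1.2
     (x, x, - 1%:M : 'M[R]_n).1.2 = tr x0 x x *m (- 1%:M) *m tr x x0 x by [].
  by rewrite mulmxN mulmx1 mulNmx (tr_inv aM dx xx).
set z := coord x0 x in dY *; set Y0 := vlocal x0 Y in dY *.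
set P := vlocal x0 (push Ub Y) => P0 /(_ dY)[dP DP].
have DW : jlin (coord (c2 x0 x0) (s x)) = D by rewrite cE; exact: (jmkK _ _ _).2.
have jD u : jtgt (u *m D) = - u.
  rewrite -DW shc cE.
  have -> : jlin (jtgt (jmk (coord x0 x) (coord (c1 x0 x0) (s x).1.2) D)) = - 1%:M.
    by rewrite -AE /A bE; exact: (congr1 _ (jmkK _ _ _).1.2).
  by rewrite mulmxN mulmx1.
have deriveN_dir (f : 'rV[R]_n -> 'rV[R]_n) w u : differentiable f w -> 'D_(- u) f w = - 'D_u f w.
  by move=> df; rewrite !(deriveE _ df) linearN.
(* The formula for the pushed field is in the direction of the image of its argument; starting from
   -u makes that image u. *)
have DP' u : 'D_u P z = 'D_u Y0 z - Y0 z *m jlin (u *m D).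
  have := DP (- u); rewrite jD opprK => ->.
  rewrite (deriveN_dir _ _ _ dY) AE mulmxN mulmx1 opprK; congr (_ + _).
  by rewrite mulNmx linearN mulmxN.
pose W : vfield M := fun y => Y y + push Ub Y y.
have WE : vlocal x0 W = fun v => Y0 v + P v.
  by apply/funext => v; rewrite /vlocal mulmxDl.
have W0 : vlocal x0 W z = 0 by rewrite WE P0 AE mulmxN mulmx1 subrr.
have dW : differentiable (vlocal x0 W) z by rewrite WE; exact: differentiableD.
have DWz u : 'D_u (vlocal x0 W) z = 2 *: 'D_u Y0 z - Y0 z *m jlin (u *m D).
  by rewrite WE (derive_add u dY dP) DP' addrA scaler_nat mulr2n.
have Wx : W x = 0.
  have : W x *m tr x x0 x = 0 by rewrite -vlocal_coord.
  move=> /(congr1 (mulmx ^~ (tr x0 x x))).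
  by rewrite mul0mx -mulmxA (tr_inv aM xx dx) mulmx1.
have Wc : vlocal x W (coord x x) = 0 by rewrite vlocal_center.
have dWx := differentiable_vlocal_chart xx dx dW.
have nE : nabla s X Y x = 2^-1 *: (X x *m jacobian (vlocal x W) (coord x x)).
  by rewrite /nabla /bracket -/W Wc mul0mx subr0 vlocal_center.
have JE : X x *m jacobian (vlocal x W) (coord x x) =
    'D_(X x *m tr x x0 x) (vlocal x0 W) z *m tr x0 x x.
  apply: etrans (esym (deriveEjacobian (X x) dWx)) _.
  exact: (derive_vlocal_chart (X x) xx dx dW W0).
pose K := X x *m tr x x0 x.
have alg1 (c : R) (N Q : 'rV[R]_n) (T T' : 'M[R]_n) :
    T' *m T = 1%:M -> N = Q *m T' -> (c *: N) *m T = c *: Q.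
  by move=> TT ->; rewrite -scalemxAl -mulmxA TT mulmx1.
have N1 : nabla s X Y x *m tr x x0 x = 2^-1 *: 'D_K (vlocal x0 W) z.
  apply: etrans (congr1 (mulmx ^~ _) nE) _.
  exact: (alg1 _ _ _ _ _ (tr_inv aM dx xx) JE).
have gE : gam x0 z K = - (2^-1 *: jlin (K *m D)).
  by rewrite -DW /gam /z (at_K aM dx).
have YE : Y x *m tr x x0 x = Y0 z := esym (vlocal_coord Y dx).
apply: etrans N1 _; apply: etrans (congr1 _ (DWz K)) _.
rewrite -/K gE YE; move: ('D_K Y0 z) (Y0 z) (jlin (K *m D)) => B C E.
by rewrite scalerBr scalerA mulVf ?pnatr_eq0// scale1r mulmxN -scalemxAr.
Qed.

End Fields.

(** The cancellation in the curvature of X, Y, Z with values u, v, w: a is the derivative of Y along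
    u and b that of X along v, Da and Db are the derivatives of Z along a and b, and S is the mixed
    second derivative of Z, common to both orders. *)
Lemma curvature_algebra (R : realType) (n : nat) (Da Db S Zu Zv a b u v w : 'rV[R]_n)
    (Gu Gv G : 'M[R]_(n, n * n)) :
  Da + S + Zu *m vec_mx (v *m G) + w *m vec_mx (a *m G + v *m Gu)
  + (Zv + w *m vec_mx (v *m G)) *m vec_mx (u *m G)
  - (Db + S + Zv *m vec_mx (u *m G) + w *m vec_mx (b *m G + u *m Gv)
     + (Zu + w *m vec_mx (u *m G)) *m vec_mx (v *m G))
  - (Da - Db + w *m vec_mx ((a - b) *m G))
  = w *m (vec_mx (v *m Gu) - vec_mx (u *m Gv) + vec_mx (v *m G) *m vec_mx (u *m G)
          - vec_mx (u *m G) *m vec_mx (v *m G)).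
Proof.
have vD (p q : 'rV[R]_(n * n)) : vec_mx (p + q) = vec_mx p + vec_mx q by rewrite linearD.
rewrite mulmxBl -![a *m G - _]/(a *m G + - (b *m G)) !vD.
have -> : vec_mx (- (b *m G)) = - vec_mx (b *m G) :> 'M[R]_n by rewrite linearN.
rewrite !mulmxDr !mulmxDl !mulmxN !mulmxA.
move: (w *m vec_mx (v *m G) *m _) (w *m vec_mx (u *m G) *m _) (w *m vec_mx (a *m G)) => e1 e2 e3.
move: (w *m vec_mx (b *m G)) (w *m vec_mx (v *m Gu)) (w *m vec_mx (u *m Gv)) => e4 e5 e6.
move: (Zu *m _) (Zv *m _) => e7 e8.
by apply/rowP => i; rewrite !mxE; ring.
Qed.

(** * Torsion and curvature through Christoffel matrices *)

Section Curvature.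
Context {R : realType} {n : nat} (M : manifold R n).
Let aM : atlas M. Proof. exact: atlas_manifold M. Qed.
Let aB : atlas (Hom M M). Proof. exact: atlas_Hom aM aM. Qed.
Let aBB : atlas (Hom M (Hom M M)). Proof. exact: atlas_Hom aM aB. Qed.

Lemma vextP (x : M) u : smooth_vfield_at (vext x u) x /\ vext x u x = u.
Proof.
rewrite /vext; set S := [set X | _].
suff [X SX] : exists X, S X by have : S (xget (fun=> u) S) by apply: xgetPex; exists X.
have xx := at_center aM x; have nx := near_center aM xx.
(* The field with constant components u in the chart at x. *)
pose X : vfield M := fun y => u *m tr x y y; exists X.
have XE : \forall z \near coord x x, u = vlocal x X z.
  apply: filterS nx => z [dz _]; have zz := at_center aM (cinv x z).
  by rewrite /vlocal /X tcE -mulmxA (tr_inv aM dz zz) mulmx1.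
split; last by rewrite /X (tr_id aM xx) mulmx1.
apply: smooth_vlocal; apply: smooth_near_ext XE _; exact: smooth_near_cst.
Qed.

Variable s : M -> gspace (B11nh M).
Hypothesis hs : symmetry_jet s.

(** Since [gam] is linear in the direction, one n by n^2 matrix holds all of it. This makes it a
    matrix-valued function of the point alone, whose derivatives enter the curvature. *)
Definition gam_mx (x0 : M) (z : 'rV[R]_n) : 'M[R]_(n, n * n) :=
  - (2^-1 *: rsubmx (jlin (coord (c2 x0 x0) (s (cinv x0 z)) :
     'rV[R]_(n + (n + n + n * n) + n * (n + n + n * n))))).

Lemma gamE (x0 : M) (z u : 'rV[R]_n) : gam s x0 z u = vec_mx (u *m gam_mx x0 z).
Proof.
rewrite /gam /gam_mx.
move: (jlin (_ : 'rV[R]_(n + (n + n + n * n) + n * (n + n + n * n)))) => D; rewrite /jlin.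
have -> : rsubmx (u *m D) = u *m rsubmx D by rewrite mulmx_rsub.
by rewrite mulmxN -scalemxAr linearN; congr (- _); rewrite linearZ.
Qed.

Lemma gam_mx_smooth (x0 x : M) : cdom x0 x -> smooth_near (gam_mx x0) (coord x0 x).
Proof.
move=> dx; have [ss shs srcs pjs] := hs x.
have dJ : cdom (c2 x0 x0) (s x).
  have srcs' : (s x).1.1 = x := srcs.
  have d1 : cdom x0 (s x).1.1 by rewrite [X in cdom _ X]srcs.
  have d2 : cdom x0 (s x).1.2.1.2 by rewrite [X in cdom _ X](congr1 (fun j => j.1.2) pjs).
  have d3 : cdom x0 (s x).1.2.1.1 by rewrite [X in cdom _ X](congr1 (fun j => j.1.1) pjs).
  exact: (conj d1 (conj d3 d2)).
have [_ sJ] := smooth_at_in (a := x0) (b := c2 x0 x0) aM aBB dx dJ ss.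
have E : gam_mx x0 = (fun z => (- (2^-1 : R))%:M *m
    rsubmx (jlin ((coord (c2 x0 x0) \o (s \o cinv x0)) z))).
  by apply/funext => z; rewrite /gam_mx mul_scalar_mx scaleNr.
rewrite E; apply: smooth_near_mulmx; first exact: smooth_near_cst.
apply: (smooth_near_lin rsubmx); exact: (smooth_near_lin (@jlin _ _ _) sJ).
Qed.

Lemma nabla_center (X Y : vfield M) (x : M) : smooth_vfield_at Y x ->
  nabla s X Y x = 'D_(X x) (vlocal x Y) (coord x x) + Y x *m gam s x (coord x x) (X x).
Proof.
move=> sY; have xx := at_center aM x.
have := nabla_local hs X xx (smooth_near_diff (vlocal_smooth xx sY)).
by rewrite (tr_id aM xx) !mulmx1.
Qed.

Lemma bracket_center (X Y : vfield M) (x : M) :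
  smooth_vfield_at X x -> smooth_vfield_at Y x ->
  bracket X Y x = 'D_(X x) (vlocal x Y) (coord x x) - 'D_(Y x) (vlocal x X) (coord x x).
Proof.
move=> sX sY; have xx := at_center aM x.
rewrite (deriveEjacobian _ (smooth_near_diff (vlocal_smooth xx sX))).
rewrite (deriveEjacobian _ (smooth_near_diff (vlocal_smooth xx sY))).
by rewrite /bracket !vlocal_center.
Qed.

Lemma torsion_atE (x : M) u v : torsion_at s x u v =
  v *m gam s x (coord x x) u - u *m gam s x (coord x x) v.
Proof.
have [sX Xx] := vextP x u; have [sY Yx] := vextP x v.
rewrite /torsion_at /torsion !nabla_center// bracket_center// Xx Yx.
move: ('D_u _ _ : 'rV[R]_n) ('D_v _ _ : 'rV[R]_n) (v *m _) (u *m _) => a b c d.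
by apply/rowP => i; rewrite !mxE; ring.
Qed.

Lemma vlocal_nabla (X Y : vfield M) (x : M) :
  smooth_vfield_at X x -> smooth_vfield_at Y x ->
  \forall z \near coord x x, vlocal x X z *m jacobian (vlocal x Y) z
    + vlocal x Y z *m vec_mx (vlocal x X z *m gam_mx x z) = vlocal x (nabla s X Y) z.
Proof.
move=> sX sY; have xx := at_center aM x.
have nY := smooth_near_near (vlocal_smooth xx sY).
apply: filterS2 nY (near_center aM xx) => z sYz [dz cz].
have dY : differentiable (vlocal x Y) (coord x (cinv x z)).
  by rewrite cz; exact: smooth_near_diff.
have := nabla_local hs X dz dY; rewrite -!(vlocal_coord _ dz) cz => ->.
by rewrite gamE (deriveEjacobian _ (smooth_near_diff sYz)).
Qed.

Lemma derive_nabla (X Y : vfield M) (x : M) h :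
  smooth_vfield_at X x -> smooth_vfield_at Y x ->
  let z := coord x x in let X0 := vlocal x X in let Y0 := vlocal x Y in
  smooth_near (vlocal x (nabla s X Y)) z /\
  'D_h (vlocal x (nabla s X Y)) z =
    'D_('D_h X0 z) Y0 z + 'D_h ('D_(X x) Y0) z + 'D_h Y0 z *m vec_mx (X x *m gam_mx x z)
    + Y x *m vec_mx ('D_h X0 z *m gam_mx x z + X x *m 'D_h (gam_mx x) z).
Proof.
move=> sX sY z X0 Y0; have xx := at_center aM x.
have nE := vlocal_nabla sX sY.
have sX0 : smooth_near X0 z := vlocal_smooth xx sX.
have sY0 : smooth_near Y0 z := vlocal_smooth xx sY.
have sG : smooth_near (gam_mx x) z := gam_mx_smooth xx.
have sJ := smooth_near_jacobian sY0.
have sXJ := smooth_near_mulmx sX0 sJ.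
have sXG := smooth_near_mulmx sX0 sG.
have sXV : smooth_near (fun z => vec_mx (X0 z *m gam_mx x z)) z := smooth_near_lin vec_mx sXG.
have sYV := smooth_near_mulmx sY0 sXV.
split; first exact: smooth_near_ext nE (smooth_nearD sXJ sYV).
have dX := smooth_near_diff sX0; have dY := smooth_near_diff sY0.
have dG := smooth_near_diff sG; have dJ := smooth_near_diff sJ.
have X0x : X0 z = X x by exact: vlocal_center.
have Y0x : Y0 z = Y x by exact: vlocal_center.
apply: etrans (esym (near_eq_derive h nE)) _.
apply: etrans (derive_add h (smooth_near_diff sXJ) (smooth_near_diff sYV)) _.
(* The product is the derivative of [Y0] along [X0 z]; this direction varies with z, whence the
   first term. *)
have E1 : 'D_h (fun z => X0 z *m jacobian Y0 z) z = 'D_('D_h X0 z) Y0 z + 'D_h ('D_(X x) Y0) z.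
  apply: etrans (derive_mulmx h dX dJ) _.
  apply: (congr2 +%R); first exact/esym/deriveEjacobian.
  have nJ : \forall y \near z, X x *m jacobian Y0 y = 'D_(X x) Y0 y.
    by apply: filterS (smooth_near_near sY0) => y sy; exact/esym/deriveEjacobian/smooth_near_diff.
  apply: etrans (near_eq_derive h nJ).
  apply/esym; apply: etrans (derive_mulmx h (differentiable_cst (X x) z) dJ) _.
  by rewrite derive_cst mul0mx add0r X0x.
have E2 : 'D_h (fun z => Y0 z *m vec_mx (X0 z *m gam_mx x z)) z =
    'D_h Y0 z *m vec_mx (X x *m gam_mx x z)
    + Y x *m vec_mx ('D_h X0 z *m gam_mx x z + X x *m 'D_h (gam_mx x) z).
  apply: etrans (derive_mulmx h dY (smooth_near_diff sXV)) _.
  have E3 : 'D_h (fun z => vec_mx (X0 z *m gam_mx x z)) z =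
      vec_mx ('D_h X0 z *m gam_mx x z + X x *m 'D_h (gam_mx x) z).
    apply: etrans (derive_vec_mx h (smooth_near_diff sXG)) (congr1 _ _).
    by apply: etrans (derive_mulmx h dX dG) _; rewrite X0x.
  by rewrite E3 X0x Y0x.
by apply: etrans (congr2 +%R E1 E2) _; rewrite !addrA.
Qed.

Lemma curvature_atE (x : M) u v w : let z := coord x x in
  curvature_at s x u v w =
  w *m (vec_mx (v *m 'D_u (gam_mx x) z) - vec_mx (u *m 'D_v (gam_mx x) z)
        + gam s x z v *m gam s x z u - gam s x z u *m gam s x z v).
Proof.
move=> z; have xx := at_center aM x.
have [sX Xx] := vextP x u; have [sY Yx] := vextP x v; have [sZ Zx] := vextP x w.
rewrite /curvature_at /curvature; move: (vext x u) (vext x v) (vext x w) sX sY sZ Xx Yx Zx.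
move=> X Y Z sX sY sZ Xx Yx Zx.
have [sYZ DYZ] := derive_nabla u sY sZ; have [sXZ DXZ] := derive_nabla v sX sZ.
have nYZ := smooth_vlocal sYZ; have nXZ := smooth_vlocal sXZ.
have dZ := smooth_near_diff (vlocal_smooth xx sZ).
have DB a b : 'D_(a - b) (vlocal x Z) z = 'D_a (vlocal x Z) z - 'D_b (vlocal x Z) z.
  by rewrite !(deriveE _ dZ) linearB.
(* Symmetry of second derivatives makes the second-order terms in Z cancel. *)
have DS : 'D_u ('D_v (vlocal x Z)) z = 'D_v ('D_u (vlocal x Z)) z.
  exact: derive_comm_mx (vlocal_smooth xx sZ).
rewrite Yx Zx -/z DS in DYZ; rewrite Xx Zx -/z in DXZ.
have EYZ : nabla s Y Z x = 'D_v (vlocal x Z) z + w *m vec_mx (v *m gam_mx x z).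
  by rewrite (nabla_center Y sZ) Yx Zx gamE.
have EXZ : nabla s X Z x = 'D_u (vlocal x Z) z + w *m vec_mx (u *m gam_mx x z).
  by rewrite (nabla_center X sZ) Xx Zx gamE.
have EB : bracket X Y x = 'D_u (vlocal x Y) z - 'D_v (vlocal x X) z.
  by rewrite (bracket_center sX sY) Xx Yx.
have E1 : nabla s X (nabla s Y Z) x = 'D_u (vlocal x (nabla s Y Z)) z
    + nabla s Y Z x *m vec_mx (u *m gam_mx x z).
  by rewrite (nabla_center X nYZ) Xx gamE.
have E2 : nabla s Y (nabla s X Z) x = 'D_v (vlocal x (nabla s X Z)) z
    + nabla s X Z x *m vec_mx (v *m gam_mx x z).
  by rewrite (nabla_center Y nXZ) Yx gamE.
have E3 : nabla s (bracket X Y) Z x = 'D_('D_u (vlocal x Y) z) (vlocal x Z) z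
   - 'D_('D_v (vlocal x X) z) (vlocal x Z) z
   + w *m vec_mx (('D_u (vlocal x Y) z - 'D_v (vlocal x X) z) *m gam_mx x z).
  by rewrite (nabla_center (bracket X Y) sZ) gamE EB Zx DB.
rewrite !gamE; apply: etrans (congr2 (fun a b => a - b) (congr2 (fun a b => a - b) E1 E2) E3) _.
rewrite EYZ EXZ.
apply: etrans (congr2 (fun a b => a + _ - (b + _) - _) DYZ DXZ) _.
exact: (curvature_algebra ('D_('D_u (vlocal x Y) z) (vlocal x Z) z)
  ('D_('D_v (vlocal x X) z) (vlocal x Z) z)
  ('D_v ('D_u (vlocal x Z)) z) ('D_u (vlocal x Z) z) ('D_v (vlocal x Z) z)
  ('D_u (vlocal x Y) z) ('D_v (vlocal x X) z) u v w
  ('D_u (gam_mx x) z) ('D_v (gam_mx x) z) (gam_mx x z)).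
Qed.

End Curvature.

(** * Jets with prescribed derivative *)

(** Source and target parts of a tangent vector of [Hom] transform by the base charts alone, so the
    conditions on the jet of a bisection can be tested in any chart. *)
Lemma tr_Hom (R : realType) (N P : charted R) (a b j : Hom N P) v :
  atlas N -> atlas P -> cdom a j -> cdom b j ->
  jsrc (v *m tr a b j) = jsrc v *m tr a.1.1 b.1.1 j.1.1 /\
  jtgt (v *m tr a b j) = jtgt v *m tr a.1.2 b.1.2 j.1.2.
Proof.
move=> aN aP aj bj; have aH := atlas_Hom aN aP.
have [aj1 aj2] := aj; have [bj1 bj2] := bj.
have si := smooth_in_id aH aj bj.
have dl : differentiable (id : 'rV[R]_(cdim N + cdim P + cdim N * cdim P) -> _) (coord a j).
  exact: ex_diff.
rewrite tr_dch -(dchP v si) -(derive_src v si) -(derive_tgt v si).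
split.
  have s1 := smooth_in_id aN aj1 bj1; rewrite tr_dch -(dchP _ s1).
  apply: (derive_comp_eq (f := fun y => jsrc y)) (smooth_to_diff s1).
  - exact: differentiable_lin dl.
  - exact: jsrc_coord.
  - by rewrite (derive_jsrc v dl) derive_id.
have s1 := smooth_in_id aP aj2 bj2; rewrite tr_dch -(dchP _ s1).
apply: (derive_comp_eq (f := fun y => jtgt y)) (smooth_to_diff s1).
- exact: differentiable_lin dl.
- exact: jtgt_coord.
- by rewrite (derive_jtgt v dl) derive_id.
Qed.

Lemma jsrcD (R : realType) p q (u v : 'rV[R]_(p + q + p * q)) : jsrc (u + v) = jsrc u + jsrc v.
Proof. exact: linearD. Qed.
Lemma jtgtD (R : realType) p q (u v : 'rV[R]_(p + q + p * q)) : jtgt (u + v) = jtgt u + jtgt v.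
Proof. exact: linearD. Qed.
Lemma jlinD (R : realType) p q (u v : 'rV[R]_(p + q + p * q)) : jlin (u + v) = jlin u + jlin v.
Proof. exact: linearD. Qed.

Definition jtgt_mx (R : realType) (m p q : nat) (D : 'M[R]_(m, p + q + p * q)) : 'M[R]_(m, q) :=
  rsubmx (lsubmx D).

Lemma jtgt_mxE (R : realType) (m p q : nat) (D : 'M[R]_(m, p + q + p * q)) u :
  jtgt (u *m D) = u *m jtgt_mx D.
Proof. by rewrite /jtgt /jtgt_mx mulmx_rsub mulmx_lsub. Qed.

Lemma smooth_near_det (R : realType) p (V : normedModType R) (f : V -> 'M[R]_p) z :
  smooth_near f z -> smooth_near (fun y => \det (f y)) z.
Proof.
move=> sf; rewrite /determinant; apply: smooth_near_sum => sg.
apply: smooth_nearM; first exact: smooth_near_cst.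
elim: (index_enum _) => [|i r IH].
  by under eq_fun do rewrite big_nil; exact: smooth_near_cst.
by under eq_fun do rewrite big_cons; apply: smooth_nearM => //; exact: smooth_near_entry.
Qed.

Lemma near_unitmx (R : realType) p (V : normedModType R) (f : V -> 'M[R]_p) z :
  smooth_near f z -> f z \in unitmx -> \forall y \near z, f y \in unitmx.
Proof.
move=> sf; rewrite unitmxE unitfE => d0.
have c : (fun y => \det (f y)) @ z --> \det (f z) := smooth_near_cont (smooth_near_det sf).
have nd : \forall d \near \det (f z), d != 0.
  have o := @open_neq R 0; exact: (open_nbhs_nbhs (conj o d0)).
have H : \forall y \near z, \det (f y) != 0 := c _ nd.
by apply: filterS H => y dy; rewrite unitmxE unitfE.
Qed.

Section Build.
Context {R : realType} {n : nat} (M : manifold R n).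
Let aM : atlas M. Proof. exact: atlas_manifold M. Qed.
Let aB : atlas (Hom M M). Proof. exact: atlas_Hom aM aM. Qed.

Lemma smooth_near_affine p q (a c : 'rV[R]_p) (b : 'rV[R]_q) (D : 'M[R]_(p, q)) :
  smooth_near (fun z => b + (z - a) *m D) c.
Proof.
apply: smooth_nearD; first exact: smooth_near_cst.
apply: smooth_near_mulmx; last exact: smooth_near_cst.
by apply: smooth_nearD; [exact: (smooth_near_linear idfun)|exact: smooth_near_cst].
Qed.

Lemma derive_affine p q (a c : 'rV[R]_p) (b : 'rV[R]_q) (D : 'M[R]_(p, q)) u :
  'D_u (fun z => b + (z - a) *m D) c = u *m D.
Proof.
have di : differentiable (id : 'rV[R]_p -> 'rV[R]_p) c by exact: ex_diff.
have dz : differentiable (fun z : 'rV[R]_p => z - a) c.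
  exact: differentiableB di (differentiable_cst a c).
have dD := differentiable_cst D c.
apply: etrans (derive_add u (differentiable_cst b c) (differentiable_mulmx dz dD)) _.
rewrite derive_cst add0r; apply: etrans (derive_mulmx u dz dD) _.
rewrite derive_cst mulmx0 addr0; congr (_ *m _).
by apply: etrans (derive_sub u di (differentiable_cst a c)) _; rewrite derive_cst subr0 derive_id.
Qed.

Lemma affineK p (a c z : 'rV[R]_p) (F : 'M[R]_p) : F \in unitmx ->
  a + (c + (z - a) *m F - c) *m invmx F = z.
Proof.
by move=> uF; rewrite (addrC c) addrK -mulmxA mulmxV// mulmx1 addrC subrK.
Qed.

Lemma affineVK p (a c z : 'rV[R]_p) (F : 'M[R]_p) : F \in unitmx ->
  c + (a + (z - c) *m invmx F - a) *m F = z.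
Proof.
by move=> uF; rewrite (addrC a) addrK -mulmxA mulVmx// mulmx1 addrC subrK.
Qed.

(** The section is affine in the charts, with derivative [D]. The hypothesis near x asks that it
    stay in the groupoid over the right source and that its target be affine with matrix [F]; the
    inverse of the target map is then explicit, through [invmx F]. *)
Lemma build_bisection (G : groupoid M) (e0 j0 : gspace G) (x y : M)
    (F : 'M[R]_n) (D : 'M[R]_(n, cdim (gspace G))) :
  atlas (gspace G) -> F \in unitmx -> cdom e0 j0 -> gtgt j0 = y ->
  (\forall z \near coord x x,
     let e : gspace G := cinv e0 (coord e0 j0 + (z - coord x x) *m D) in
     [/\ gset e, gsrc e = cinv x z, cdom y (gtgt e)
       & coord y (gtgt e) = coord y y + (z - coord x x) *m F]) ->
  exists U b, [/\ @bisection R n M G U b, U x, b x = j0, smooth_in x e0 b x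
    & dch x e0 b x = D].
Proof.
move=> aG uF dj0 tj0 nH; have xx := at_center aM x; have yy := at_center aM y.
pose bh z := coord e0 j0 + (z - coord x x) *m D.
have sbh z : smooth_near bh z by exact: smooth_near_affine.
have bh0 : bh (coord x x) = coord e0 j0 by rewrite /bh subrr mul0mx addr0.
pose b (x' : M) : gspace G := cinv e0 (bh (coord x x')).
have nE : \forall z \near coord x x, cdom e0 (cinv e0 (bh z)) /\ coord e0 (cinv e0 (bh z)) = bh z.
  have c : bh @ coord x x --> bh (coord x x) := smooth_near_cont (sbh _).
  by have := near_center aG dj0; rewrite -bh0 => /c.
pose Q z := [/\ cdom x (cinv x z) /\ coord x (cinv x z) = z,
  cdom e0 (cinv e0 (bh z)) /\ coord e0 (cinv e0 (bh z)) = bh z &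
  let e : gspace G := cinv e0 (bh z) in
     [/\ gset e, gsrc e = cinv x z, cdom y (gtgt e)
       & coord y (gtgt e) = coord y y + (z - coord x x) *m F]].
have nQ : \forall z \near coord x x, Q z by apply: filterS3 (near_center aM xx) nE nH.
(* A bisection has an open domain, so the neighbourhood is shrunk to an open set on which all
   conditions hold pointwise. *)
have [ O [oO Ox OQ]] : exists O : set 'rV[R]_n, [/\ open O, O (coord x x) & forall z, O z -> Q z].
  exists [set z | Q z]^°; split; [exact: open_interior|exact: nQ|].
  by move=> z /interior_subset.
have nbO z : O z -> \forall z' \near z, O z' by move=> Oz; apply: open_nbhs_nbhs.
pose U : set (mtop M) := [set x' | cdom x (x' : M) /\ O (coord x (x' : M))].
have Ux : U x := conj xx Ox.
have UO (z : 'rV[R]_n) : O z -> U (cinv x z).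
  move=> Oz; have [[d c] _ _] := OQ _ Oz; split; first exact: d.
  by rewrite c.
have be z : O z -> b (cinv x z) = cinv e0 (bh z) by move=> /OQ[[_ c] _ _]; rewrite /b c.
have smU x' : U x' -> smooth_in x e0 b x'.
  move=> [dx' Ox']; have nO := nbO _ Ox'.
  split; first by apply: filterS nO => z Oz; rewrite /comp be//; have [_ [d _] _] := OQ _ Oz.
  apply: smooth_near_ext (sbh _); apply: filterS nO => z Oz.
  by rewrite /comp be//; have [_ [_ c] _] := OQ _ Oz.
have bU x' : U x' -> [/\ gset (b x'), gsrc (b x') = x', cdom y (gtgt (b x'))
    & coord y (gtgt (b x')) = coord y y + (coord x x' - coord x x) *m F].
  move=> [dx' Ox']; have [_ _] := OQ _ Ox'; rewrite -/(b x') (at_K aM dx').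
  by [].
have oU : open U.
  rewrite openE => x' [dx' Ox']; have c : mcoord (x : mtop M) @ x' --> _ := m_coord_cont dx'.
  have nO : nbhs (mcoord (x : mtop M) x') O := nbO _ Ox'.
  have nd : nbhs (x' : mtop M) (mdom (x : mtop M)).
    by apply: open_nbhs_nbhs; split; [exact: m_open_dom|].
  by apply: filterS2 nd (c _ nO) => q dq Oq; exact: (conj dq Oq).
pose f : M -> M := gtgt (g := G) \o b.
pose gh w := coord x x + (w - coord y y) *m invmx F.
have sgh w : smooth_near gh w by exact: smooth_near_affine.
have ghK x' : U x' -> gh (coord y (f x')) = coord x x'.
  by move=> /bU[_ _ _ E]; rewrite /gh /f /comp E; exact: affineK.
pose g (q : M) : M := cinv x (gh (coord y q)).
have gf x' : U x' -> g (f x') = x' by move=> Ux'; rewrite /g ghK// (at_K aM Ux'.1).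
have fbh x' : U x' -> cdom y (f x') by move=> /bU[].
have sf x' : U x' -> smooth_in x y f x'.
  move=> [dx' Ox']; have nO := nbO _ Ox'.
  split; first by apply: filterS nO => z /UO/bU[].
  apply: (@smooth_near_ext _ _ _ (fun z => coord y y + (z - coord x x) *m F)).
    apply: filterS nO => z Oz; have [_ _ _ E] := bU _ (UO _ Oz).
    have [[_ c] _ _] := OQ _ Oz.
    by rewrite /f /comp E c.
  exact: smooth_near_affine.
have sg x' : U x' -> smooth_in y x g (f x').
  move=> Ux'; have dfy := fbh _ Ux'; have Ox' := Ux'.2.
  have nO : \forall w \near coord y (f x'), O (gh w).
    have c : gh @ coord y (f x') --> gh (coord y (f x')) := smooth_near_cont (sgh _).
    by apply: c; rewrite ghK//; exact: nbO.
  have ny := near_center aM dfy.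
  split.
    by apply: filterS2 nO ny => w Ow [_ c]; rewrite /comp /g c; have [] := UO _ Ow.
  apply: smooth_near_ext (sgh _); apply: filterS2 nO ny => w Ow [_ c].
  by rewrite /comp /g c; have [[_ ->]] := OQ _ Ow.
have oV : open ((f : mtop M -> mtop M) @` U).
  rewrite openE => _ [x' Ux' <-]; have dfy := fbh _ Ux'.
  have c : mcoord (y : mtop M) @ (f x' : mtop M) --> _ := m_coord_cont dfy.
  have nd : nbhs (f x' : mtop M) (mdom (y : mtop M)).
    by apply: open_nbhs_nbhs; split; [exact: m_open_dom|].
  have nO : nbhs (mcoord (y : mtop M) (f x')) (fun w => O (gh w)).
    have cg : gh @ coord y (f x') --> gh (coord y (f x')) := smooth_near_cont (sgh _).
    by apply: cg; rewrite ghK//; exact: nbO Ux'.2.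
  apply: filterS2 nd (c _ nO) => q dq Oq.
  exists (g q); first exact: UO Oq.
  have [_ _ dg E] := bU _ (UO _ Oq); have [[_ cq] _ _] := OQ _ Oq.
  rewrite -[RHS](at_K aM dq) -[LHS](at_K aM dg); congr (cinv y _).
  by apply: etrans E _; rewrite cq; exact: affineVK.
have sbU x' : U x' -> smooth_at b x'.
  by move=> Ux'; apply: smooth_in_at (smU _ Ux') => //; exact: Ux'.1.
exists U, b; split.
- split=> //.
    by move=> x' Ux'; have [b1 b2 _ _] := bU _ Ux'; split=> //; exact: sbU.
  split; first exact: oV.
  exists g => x' Ux'; split; first exact: gf.
    exact: smooth_in_at aM aM Ux'.1 (sf _ Ux').
  exact: smooth_in_at aM aM (fbh _ Ux') (sg _ Ux').
- exact: Ux.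
- by rewrite /b bh0 (at_K aG dj0).
- exact: smU.
- rewrite dchE; apply: jacobianP => [|u]; first exact: smooth_to_diff (smU _ Ux).
  rewrite -[RHS](derive_affine (coord x x) (coord x x) (coord e0 j0)).
  apply: near_eq_derive; have nO := nbO _ Ox.
  by apply: filterS nO => z Oz; rewrite /comp be//; have [_ [_ c] _] := OQ _ Oz.
Qed.

Lemma B1_gset (xi : gspace (B1 M)) (x y : M) : cdom x xi.1.1 -> cdom y xi.1.2 ->
  gset xi <-> jlin (coord (c1 x y) xi) \in unitmx.
Proof.
move=> dx dy; rewrite jlin_coord !unitmx_mul.
have -> : tr (c1 x y).1.1 xi.1.1 xi.1.1 \in unitmx by apply: tr_unit aM _ _ => //; exact: at_center.
have -> : tr xi.1.2 (c1 x y).1.2 xi.1.2 \in unitmx by apply: tr_unit aM _ _ => //; exact: at_center.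
by rewrite andbT.
Qed.

(* The first-order conditions on the 1-jet of a bisection of B1: the source is
   preserved and the target moves diffeomorphically. *)
Definition jet_ok (D : 'M[R]_(n, n + n + n * n)) :=
  (forall u, jsrc (u *m D) = u) /\ jtgt_mx D \in unitmx.

Lemma near_affine_cinv (N : charted R) (e0 j0 : N) (a : 'rV[R]_n) (D : 'M[R]_(n, cdim N)) :
  atlas N -> cdom e0 j0 -> \forall z \near a,
  cdom e0 (cinv e0 (coord e0 j0 + (z - a) *m D)) /\
  coord e0 (cinv e0 (coord e0 j0 + (z - a) *m D)) = coord e0 j0 + (z - a) *m D.
Proof.
move=> aN dj; pose bh z := coord e0 j0 + (z - a) *m D.
have c : bh @ a --> bh a := smooth_near_cont (smooth_near_affine _ _ _ _).
have bh0 : bh a = coord e0 j0 by rewrite /bh subrr mul0mx addr0.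
have nc := near_center aN dj; rewrite -bh0 in nc; exact: c _ nc.
Qed.

(** Along the affine section the source is preserved exactly, because its source component has
    derivative 1; invertibility of the arrows persists near x by continuity of the determinant. *)
Lemma B11_build (j : gspace (B11nh M)) : j.1.2.1.1 = j.1.1 -> j.1.2.2 \in unitmx ->
  jet_ok j.2 -> gset j.
Proof.
move=> sj uA [sD uF]; set x := j.1.1 in sj *; set y : M := j.1.2.1.2.
have xx := at_center aM x; have yy := at_center aM y.
have dj : cdom (c1 x y) j.1.2.
  have dx : cdom x j.1.2.1.1 by rewrite sj.
  exact: (conj dx yy).
have [|U [b [bb Ux b0 sb Db]]] := @build_bisection (B1 M) (c1 x y) j.1.2 x y
    (jtgt_mx (j.2 : 'M[R]_(n, n + n + n * n))) j.2 aB uF dj erefl.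
  have uA' : jlin (coord (c1 x y) j.1.2) \in unitmx by apply/B1_gset; rewrite ?sj.
  have n2 : \forall z \near coord x x,
      jlin (coord (c1 x y) j.1.2 + (z - coord x x) *m j.2) \in unitmx.
    apply: near_unitmx; first exact: (smooth_near_lin (@jlin _ _ _) (smooth_near_affine _ _ _ _)).
    by rewrite subrr mul0mx addr0.
  apply: filterS2 n2 (near_affine_cinv (coord x x) j.2 aB dj) => z.
  set e : gspace (B1 M) := cinv _ _ => uz [[de1 de2] ce].
  have es : e.1.1 = cinv x z.
    rewrite -(at_K aM de1); congr (cinv x _).
    apply: etrans (esym (jsrc_coord (c1 x y) e)) _; rewrite ce jsrcD sD.
    by rewrite jsrc_coord sj addrC subrK.
  split=> //.
    by apply/(B1_gset de1 de2); rewrite ce.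
  apply: etrans (esym (jtgt_coord (c1 x y) e)) _; rewrite ce jtgtD jtgt_mxE.
  by rewrite jtgt_coord.
exists U, b; split=> //.
have Dj : j.2 = dmat b x.
  rewrite dmatE -Db !dchE; have -> // : coord (b x) = coord (c1 x y).
  rewrite b0 -[LHS]/(coord ((j.1.2.1.1, y, 0) : Hom M M)).
  by rewrite sj.
by rewrite /jet1 b0 -Dj; case: (j) => -[].
Qed.

End Build.

(** * Affine extensions *)

(** Writes the second-order part u -> G(u) A - A G'(u A) as one matrix acting on u, the form
    required of the derivative of a jet. *)
Lemma lin_mx_commutator (R : realType) (n : nat) (G G' : 'M[R]_(n, n * n)) (A : 'M[R]_n)
    (u : 'rV[R]_n) :
  vec_mx (u *m (G *m lin_mx (mulmxr A) - A *m G' *m lin_mx (mulmx A))) =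
  vec_mx (u *m G) *m A - A *m vec_mx (u *m A *m G').
Proof. by rewrite mulmxBr !mulmxA !mul_rV_lin linearB /= !mxvecK. Qed.

(** The hypothesis identifies the terms A G'(u B(h)) and A G'(h B(u)), which then cancel. The mixed
    products G(u) A G'(h) and G(h) A G'(u) cancel in pairs, and the rest groups into the curvature
    at the source followed by A and the curvature at the target. *)
Lemma curvature_difference (R : realType) (n : nat) (u h v : 'rV[R]_n) (A : 'M[R]_n)
    (G G' D1 D2 E1 E2 : 'M[R]_(n, n * n)) :
  let B (w : 'rV[R]_n) := vec_mx (w *m G) *m A - A *m vec_mx (w *m A *m G') in
  u *m B h = h *m B u ->
  v *m (vec_mx (u *m D1) *m A + vec_mx (u *m G) *m B h
        - (B h *m vec_mx (u *m A *m G') + A *m vec_mx (u *m B h *m G' + u *m A *m E1))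
        - (vec_mx (h *m D2) *m A + vec_mx (h *m G) *m B u
        - (B u *m vec_mx (h *m A *m G') + A *m vec_mx (h *m B u *m G' + h *m A *m E2)))) =
  v *m (vec_mx (u *m D1) - vec_mx (h *m D2) + vec_mx (u *m G) *m vec_mx (h *m G)
        - vec_mx (h *m G) *m vec_mx (u *m G)) *m A
  - v *m A *m (vec_mx (u *m A *m E1) - vec_mx (h *m A *m E2)
        + vec_mx (u *m A *m G') *m vec_mx (h *m A *m G')
        - vec_mx (h *m A *m G') *m vec_mx (u *m A *m G')).
Proof.
have vD (p q : 'rV[R]_(n * n)) : vec_mx (p + q) = vec_mx p + vec_mx q by rewrite linearD.
move=> B E; rewrite E !vD {E}; move: (vec_mx (h *m B u *m _)) => K; rewrite /B.
move: (vec_mx (u *m D1)) (vec_mx (h *m D2)) (vec_mx (u *m G)) (vec_mx (h *m G)).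
move: (vec_mx (u *m A *m G')) (vec_mx (h *m A *m G')).
move: (vec_mx (u *m A *m E1)) (vec_mx (h *m A *m E2)) => F1 F2 gu gh d1 d2 Gu Gh.
have alg (C1 C2 : 'M[R]_n) : C1 = C2 -> v *m C1 = v *m C2 by move=> ->.
rewrite -!(mulmxA v) -mulmxBr; apply: alg.
rewrite !(mulmxDl, mulmxDr, mulNmx, mulmxN) !mulmxA.
move: (A *m K) (d1 *m A) (d2 *m A) (A *m F1) (A *m F2) (Gu *m Gh *m A) (Gh *m Gu *m A)
  (Gu *m A *m gh) (Gh *m A *m gu) (A *m gu *m gh) (A *m gh *m gu) =>
  a1 a2 a3 a4 a5 a6 a7 a8 a9 b1 b2.
by apply/matrixP => i j; rewrite !mxE; ring.
Qed.

Section Affine.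
Context {R : realType} {n : nat} (M : manifold R n).
Let aM : atlas M. Proof. exact: atlas_manifold M. Qed.
Let aB : atlas (Hom M M). Proof. exact: atlas_Hom aM aM. Qed.
Let aBB : atlas (Hom M (Hom M M)). Proof. exact: atlas_Hom aM aB. Qed.

Lemma rep_dch (j : gspace (B11nh M)) : gset j ->
  dch j.1.1 (c1 j.1.1 j.1.2.1.2) (rep j).2 j.1.1 = j.2.
Proof.
move=> gj; have xx := at_center aM j.1.1; have yy := at_center aM j.1.2.1.2.
have [_ _ _ bE _] := rep_chart gj xx yy; have [_ _ jE] := repP gj.
apply/esym; apply: etrans (congr1 snd jE) _.
apply: etrans (dmatE _ _) _; rewrite !dchE.
have -> // : coord ((rep j).2 j.1.1) = coord (c1 j.1.1 j.1.2.1.2).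
rewrite bE -[LHS]/(coord ((j.1.2.1.1, j.1.2.1.2, 0) : Hom M M)).
by rewrite (B1_src gj).
Qed.

Lemma coord_center (j : gspace (B11nh M)) : gset j ->
  coord (c2 j.1.1 j.1.2.1.2) j =
  jmk (coord j.1.1 j.1.1) (coord (c1 j.1.1 j.1.2.1.2) j.1.2) j.2.
Proof.
move=> gj; have xx := at_center aM j.1.1; have yy := at_center aM j.1.2.1.2.
by have [_ _ _ _ ->] := rep_chart gj xx yy; rewrite rep_dch.
Qed.

Lemma B11sh_build (j : gspace (B11nh M)) : gset j ->
  jtgt_mx (j.2 : 'M[R]_(n, n + n + n * n)) = j.1.2.2 -> B11sh j.
Proof.
move=> gj E; split=> //.
have xx := at_center aM j.1.1; have yy := at_center aM j.1.2.1.2.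
have [_ _ sb bE _] := rep_chart gj xx yy; have D := rep_dch gj.
have [st Et] := dch_tgt xx sb.
have E2 : dmat (fun x => ((rep j).2 x).1.2) j.1.1 = j.1.2.2.
  rewrite dmatE bE -E; apply/row_matrixP => i; rewrite !rowE Et D.
  exact: jtgt_mxE.
have E3 : pstar2 j = (j.1.1, ((rep j).2 j.1.1).1.2, dmat (fun x => ((rep j).2 x).1.2) j.1.1).
  by [].
apply: etrans (esym E3); rewrite E2 bE /pj -[X in (X, _, _)](B1_src gj).
by case: (j.1.2) => -[].
Qed.

Variable s : M -> gspace (B11nh M).
Hypothesis hs : symmetry_jet s.

(* The second-order part of the affine extension of the arrow with coordinates w. *)
Definition aff_form (x0 y0 : M) (w : 'rV[R]_(n + n + n * n)) (u : 'rV[R]_n) : 'M[R]_n :=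
  vec_mx (u *m gam_mx s x0 (jsrc w)) *m jlin w
  - jlin w *m vec_mx (u *m jlin w *m gam_mx s y0 (jtgt w)).

(** Both sides contain the derivative of Y followed by the arrow. It cancels, and the remaining
    condition depends only on the value of Y at the source. *)
Lemma affine_eq (xi : gspace (B1 M)) (j : gspace (B11nh M)) (x0 y0 : M)
    (u : 'rV[R]_n) (Y : vfield M) :
  B11sh j -> pj j = xi -> cdom x0 xi.1.1 -> cdom y0 xi.1.2 ->
  smooth_vfield_at Y xi.1.1 ->
  let w := coord (c1 x0 y0) xi in let W := coord (c2 x0 y0) j in
  let v := u *m tr xi.1.1 x0 xi.1.1 in let Yx := Y xi.1.1 *m tr xi.1.1 x0 xi.1.1 in
  app xi (nabla_at s (gsrc xi) u Y) = nabla_at s (gtgt xi) (app xi u) (push (rep j) Y) <->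
  Yx *m jlin (v *m jlin W) = Yx *m aff_form x0 y0 w v.
Proof.
move=> shj pjj dx dy sY w W v Yx.
have gj := shj.1; have xx := at_center aM xi.1.1; have yy := at_center aM xi.1.2.
have pj1 : j.1.2 = xi := pjj.
have sj : j.1.1 = xi.1.1 by rewrite -(B1_src gj) pj1.
have dxj : cdom x0 j.1.1 by rewrite sj.
have dyj : cdom y0 j.1.2.1.2 by rewrite pj1.
have [bb Ux sb bE WE] := rep_chart gj dxj dyj.
have shc := B11sh_coord v shj dxj dyj.
rewrite sj pj1 in sb bE WE; rewrite sj in Ux.
set Ub := rep j in bb Ux sb bE WE *.
have Wt : jtgt W = w by rewrite /W WE; exact: (jmkK _ _ _).1.2.
have Wl : jlin W = dch x0 (c1 x0 y0) Ub.2 xi.1.1 by rewrite /W WE; exact: (jmkK _ _ _).2.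
rewrite -/W Wt in shc.
have dyb : cdom y0 (Ub.2 xi.1.1).1.2 by rewrite bE.
have := push_local Y bb Ux dx dyb; rewrite bE -/w -Wl.
set z := coord x0 xi.1.1; set z' := coord y0 xi.1.2.
have sY0 := vlocal_smooth dx sY; have dY := smooth_near_diff sY0.
move=> [P0 /(_ dY)[dP /(_ v) DP]]; rewrite shc in DP.
have Yz : vlocal x0 Y z = Yx by exact: vlocal_coord.
have wz : jsrc w = z by exact: jsrc_coord.
have wz' : jtgt w = z' by exact: jtgt_coord.
have [_ vx] := vextP xi.1.1 u; have [_ vy] := vextP xi.1.2 (app xi u).
have wl : jlin w = tr x0 xi.1.1 xi.1.1 *m xi.2 *m tr xi.1.2 y0 xi.1.2 by exact: jlin_coord.
have N1 : nabla_at s (gsrc xi) u Y *m tr xi.1.1 x0 xi.1.1 =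
    'D_v (vlocal x0 Y) z + Yx *m vec_mx (v *m gam_mx s x0 z).
  have := nabla_local hs (vext xi.1.1 u) dx dY; rewrite vx gamE.
  by apply.
have uA : app xi u *m tr xi.1.2 y0 xi.1.2 = v *m jlin w.
  rewrite wl /v /app !mulmxA; congr (_ *m _ *m _).
  by rewrite -mulmxA (tr_inv aM xx dx) mulmx1.
have N2 : nabla_at s (gtgt xi) (app xi u) (push Ub Y) *m tr xi.1.2 y0 xi.1.2 =
    'D_(v *m jlin w) (vlocal y0 (push Ub Y)) z'
    + vlocal y0 (push Ub Y) z' *m vec_mx (v *m jlin w *m gam_mx s y0 z').
  have := nabla_local hs (vext xi.1.2 (app xi u)) dy dP.
  have Pz : vlocal y0 (push Ub Y) z' = push Ub Y xi.1.2 *m tr xi.1.2 y0 xi.1.2.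
    exact: vlocal_coord.
  rewrite vy gamE uA -Pz.
  by apply.
have aT : app xi (nabla_at s (gsrc xi) u Y) *m tr xi.1.2 y0 xi.1.2 =
    ('D_v (vlocal x0 Y) z + Yx *m vec_mx (v *m gam_mx s x0 z)) *m jlin w.
  rewrite -N1 wl /app !mulmxA; congr (_ *m _ *m _).
  by rewrite -mulmxA (tr_inv aM xx dx) mulmx1.
have bT : nabla_at s (gtgt xi) (app xi u) (push Ub Y) *m tr xi.1.2 y0 xi.1.2 =
    'D_v (vlocal x0 Y) z *m jlin w + Yx *m jlin (v *m jlin W)
    + Yx *m jlin w *m vec_mx (v *m jlin w *m gam_mx s y0 z').
  rewrite Yz in P0 DP.
  exact: etrans N2 (congr2 +%R DP (congr1 (mulmx^~ _) P0)).
have cancel (a b : 'rV[R]_n) : a = b <-> a *m tr xi.1.2 y0 xi.1.2 = b *m tr xi.1.2 y0 xi.1.2.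
  split=> [->//|/(congr1 (mulmx ^~ (tr y0 xi.1.2 xi.1.2)))].
  by rewrite -!mulmxA (tr_inv aM yy dy) !mulmx1.
apply: iff_trans (cancel _ _) _; rewrite aT bT /aff_form wz wz'.
have alg (d Y1 : 'rV[R]_n) (G A L G' : 'M[R]_n) :
    (d + Y1 *m G) *m A = d *m A + Y1 *m L + Y1 *m A *m G' <->
    Y1 *m L = Y1 *m (G *m A - A *m G').
  rewrite mulmxDl mulmxBr !mulmxA -addrA.
  by split=> [/addrI ->|->]; [rewrite addrK|rewrite subrK].
exact: alg.
Qed.

Lemma affine_iff (xi : gspace (B1 M)) (j : gspace (B11nh M)) (x0 y0 : M) :
  B11sh j -> pj j = xi -> cdom x0 xi.1.1 -> cdom y0 xi.1.2 ->
  affine s xi j <-> forall v, jlin (v *m jlin (coord (c2 x0 y0) j)) =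
    aff_form x0 y0 (coord (c1 x0 y0) xi) v.
Proof.
move=> shj pjj dx dy; have xx := at_center aM xi.1.1; split.
  move=> aff v; apply/row_matrixP => i; rewrite !rowE.
  (* Chosen so that in the chart at x0 the components of u and e are v and the i-th basis vector. *)
  pose u := v *m tr x0 xi.1.1 xi.1.1; pose e := delta_mx 0 i *m tr x0 xi.1.1 xi.1.1 : 'rV[R]_n.
  have [sY Yx] := vextP xi.1.1 e.
  have := (affine_eq u shj pjj dx dy sY).1 (aff u _ sY).
  have uE : u *m tr xi.1.1 x0 xi.1.1 = v by rewrite /u -mulmxA (tr_inv aM dx xx) mulmx1.
  have eE : e *m tr xi.1.1 x0 xi.1.1 = delta_mx 0 i by rewrite /e -mulmxA (tr_inv aM dx xx) mulmx1.
  by rewrite Yx uE eE.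
move=> E u Y sY; apply: (affine_eq u shj pjj dx dy sY).2.
by rewrite E.
Qed.

Lemma jlin_center (xi : gspace (B1 M)) : jlin (coord (c1 xi.1.1 xi.1.2) xi) = xi.2.
Proof.
have xx := at_center aM xi.1.1; have yy := at_center aM xi.1.2.
apply: etrans (jlin_coord (c1 xi.1.1 xi.1.2) xi) _.
by rewrite (tr_id aM xx) (tr_id aM yy) mul1mx mulmx1.
Qed.

Lemma affine_extP (xi : gspace (B1 M)) : gset xi ->
  [/\ B11sh (affine_ext s xi), pj (affine_ext s xi) = xi & affine s xi (affine_ext s xi)].
Proof.
move=> gxi; rewrite /affine_ext; set P := [set j | _].
suff [j Pj] : exists j, P j by have : P (xget (gsrc xi, xi, 0) P) by apply: xgetPex; exists j.
have xx := at_center aM xi.1.1; have yy := at_center aM xi.1.2.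
set x := xi.1.1 in xx *; set y := xi.1.2 in yy *.
pose A : 'M[R]_n := xi.2; pose w := coord (c1 x y) xi.
have wl : jlin w = A by exact: jlin_center.
pose L : 'M[R]_(n, n * n) := gam_mx s x (jsrc w) *m lin_mx (mulmxr A)
  - A *m gam_mx s y (jtgt w) *m lin_mx (mulmx A).
have LE u : vec_mx (u *m L) = aff_form x y w u.
  by rewrite /aff_form wl; exact: lin_mx_commutator.
(* The block 1 preserves the source, the block A makes the jet semiholonomic, and L is the
   second-order part forced by [affine_iff]. *)
pose D : 'M[R]_(n, n + n + n * n) := row_mx (row_mx 1%:M A) L.
have DE u : u *m D = jmk u (u *m A) (aff_form x y w u).
  by rewrite /jmk -LE vec_mxK /D !mul_mx_row mulmx1.
pose j : gspace (B11nh M) := (x, xi, D).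
have tD : jtgt_mx D = A by rewrite /jtgt_mx /D row_mxKl row_mxKr.
have okD : jet_ok D.
  split; last by rewrite tD.
  by move=> u; rewrite DE; exact: (jmkK _ _ _).1.1.
have gj : gset j by apply: B11_build.
have shj : B11sh j by apply: B11sh_build.
exists j; split=> //; apply/(affine_iff shj (erefl _) xx yy) => v.
have -> : coord (c2 x y) j = jmk (coord x x) (coord (c1 x y) xi) D := coord_center gj.
rewrite (jmkK _ _ _).2 DE; exact: (jmkK _ _ _).2.
Qed.

(** Every coordinate of the selected extension is an explicit function of the coordinates of [xi].
    Having this in arbitrary charts is what allows the extension to be differentiated along a
    bisection. *)
Lemma affine_ext_coord (xi : gspace (B1 M)) (x0 y0 : M) : gset xi ->
  cdom x0 xi.1.1 -> cdom y0 xi.1.2 ->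
  let w := coord (c1 x0 y0) xi in let W := coord (c2 x0 y0) (affine_ext s xi) in
  [/\ jsrc W = jsrc w, jtgt W = w
    & forall v, v *m jlin W = jmk v (v *m jlin w) (aff_form x0 y0 w v)].
Proof.
move=> gxi dx dy w W; have [shj pjj aff] := affine_extP gxi.
have gj := shj.1; set j := affine_ext s xi in W gj shj pjj aff *.
have j1 : j.1.2 = xi := pjj.
have s1 : j.1.1 = xi.1.1 by rewrite -(B1_src gj) j1.
have dxj : cdom x0 j.1.1 by rewrite s1.
have dyj : cdom y0 j.1.2.1.2 by rewrite j1.
have Wt : jtgt W = w.
  by apply: etrans (jtgt_coord (c2 x0 y0) j) _; rewrite j1.
split=> //.
  by apply: etrans (jsrc_coord (c2 x0 y0) j) _; rewrite s1; apply/esym; exact: jsrc_coord.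
move=> v; rewrite [LHS]jmkE; congr jmk.
- exact: B11_srcE.
- apply: etrans (B11sh_coord v shj dxj dyj) _.
  by rewrite -/W Wt.
- exact: ((affine_iff shj pjj dx dy).1 aff v).
Qed.

(** The default value in the selection also projects to [xi], so the identity holds everywhere and
    the target maps of b and of S o b are equal as functions. *)
Lemma affine_ext_pj (xi : gspace (B1 M)) : (affine_ext s xi).1.2 = xi.
Proof. by rewrite /affine_ext; case: xgetP => [j -> [_ e _]|_]. Qed.

Lemma smooth_near_aff_form (V : normedModType R) (w : V -> 'rV[R]_(n + n + n * n)) z u
    (x0 p y0 q : M) : cdom x0 p -> cdom y0 q ->
  smooth_near w z -> jsrc (w z) = coord x0 p -> jtgt (w z) = coord y0 q ->
  smooth_near (fun y => aff_form x0 y0 (w y) u) z.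
Proof.
move=> dx dy sw wx wy; rewrite /aff_form.
have sx := gam_mx_smooth hs dx; rewrite -wx in sx.
have sy := gam_mx_smooth hs dy; rewrite -wy in sy.
have sl : smooth_near (fun y => jlin (w y)) z := smooth_near_lin _ sw.
have sgx : smooth_near (fun y => gam_mx s x0 (jsrc (w y))) z.
  by apply: (smooth_near_comp (f := fun y => jsrc (w y))) sx; exact: smooth_near_lin.
have sgy : smooth_near (fun y => gam_mx s y0 (jtgt (w y))) z.
  by apply: (smooth_near_comp (f := fun y => jtgt (w y))) sy; exact: smooth_near_lin.
apply: (smooth_nearD (f := fun y => vec_mx (u *m gam_mx s x0 (jsrc (w y))) *m jlin (w y))).
  apply: smooth_near_mulmx sl; apply: smooth_near_lin.
  by apply: smooth_near_mulmx sgx; exact: smooth_near_cst.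
apply: smooth_near_lin; apply: smooth_near_mulmx => //; apply: smooth_near_lin.
by apply: smooth_near_mulmx sgy; apply: smooth_near_mulmx sl; exact: smooth_near_cst.
Qed.

Lemma derive_aff_form (V : normedModType R) (w : V -> 'rV[R]_(n + n + n * n)) z h u
    (x0 p y0 q : M) : cdom x0 p -> cdom y0 q ->
  smooth_near w z -> jsrc (w z) = coord x0 p -> jtgt (w z) = coord y0 q ->
  let w0 := w z in let w' := 'D_h w z in
  'D_h (fun y => aff_form x0 y0 (w y) u) z =
    vec_mx (u *m 'D_(jsrc w') (gam_mx s x0) (jsrc w0)) *m jlin w0
    + vec_mx (u *m gam_mx s x0 (jsrc w0)) *m jlin w'
    - (jlin w' *m vec_mx (u *m jlin w0 *m gam_mx s y0 (jtgt w0))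
       + jlin w0 *m vec_mx (u *m jlin w' *m gam_mx s y0 (jtgt w0)
            + u *m jlin w0 *m 'D_(jtgt w') (gam_mx s y0) (jtgt w0))).
Proof.
move=> dx dy sw wx wy w0 w'.
have sx := gam_mx_smooth hs dx; rewrite -wx in sx.
have sy := gam_mx_smooth hs dy; rewrite -wy in sy.
have dw := smooth_near_diff sw.
pose l y := jlin (w y).
have dl : differentiable l z := smooth_near_diff (smooth_near_lin _ sw).
have Dl : 'D_h l z = jlin w' := derive_jlin h dw.
pose gx y := gam_mx s x0 (jsrc (w y)); pose gy y := gam_mx s y0 (jtgt (w y)).
have djs : differentiable (fun y => jsrc (w y)) z := smooth_near_diff (smooth_near_lin _ sw).
have djt : differentiable (fun y => jtgt (w y)) z := smooth_near_diff (smooth_near_lin _ sw).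
have dgx : differentiable gx z.
  apply: smooth_near_diff; apply: (smooth_near_comp (f := fun y => jsrc (w y))) sx.
  exact: smooth_near_lin.
have dgy : differentiable gy z.
  apply: smooth_near_diff; apply: (smooth_near_comp (f := fun y => jtgt (w y))) sy.
  exact: smooth_near_lin.
have Dgx : 'D_h gx z = 'D_(jsrc w') (gam_mx s x0) (jsrc w0).
  exact: (derive_comp_eq djs (erefl _) (derive_jsrc h dw) (smooth_near_diff sx)).
have Dgy : 'D_h gy z = 'D_(jtgt w') (gam_mx s y0) (jtgt w0).
  exact: (derive_comp_eq djt (erefl _) (derive_jtgt h dw) (smooth_near_diff sy)).
have dc (m k : nat) (c : 'M[R]_(m, k)) : differentiable (fun=> c : 'M[R]_(m, k)) z.
  exact: smooth_near_diff (smooth_near_cst _ _).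
have Dc (m k : nat) (c : 'M[R]_(m, k)) : 'D_h (fun=> c : 'M[R]_(m, k)) z = 0 by exact: derive_cst.
have dux : differentiable (fun y => u *m gx y) z := differentiable_mulmx (dc _ _ u) dgx.
have Dux : 'D_h (fun y => u *m gx y) z = u *m 'D_h gx z.
  by apply: etrans (derive_mulmx h (dc _ _ u) dgx) _; rewrite Dc mul0mx add0r.
have dul : differentiable (fun y => u *m l y) z := differentiable_mulmx (dc _ _ u) dl.
have Dul : 'D_h (fun y => u *m l y) z = u *m 'D_h l z.
  by apply: etrans (derive_mulmx h (dc _ _ u) dl) _; rewrite Dc mul0mx add0r.
have dulg : differentiable (fun y => u *m l y *m gy y) z := differentiable_mulmx dul dgy.
have Dulg := derive_mulmx h dul dgy; rewrite Dul in Dulg.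
have dvx : differentiable (fun y => vec_mx (u *m gx y) : 'M[R]_n) z := differentiable_lin _ dux.
have Dvx : 'D_h (fun y => vec_mx (u *m gx y) : 'M[R]_n) z = vec_mx (u *m 'D_h gx z).
  by apply: etrans (derive_vec_mx h dux) _; rewrite Dux.
have dvl : differentiable (fun y => vec_mx (u *m l y *m gy y) : 'M[R]_n) z :=
  differentiable_lin _ dulg.
have Dvl := derive_vec_mx (p := n) (q := n) h dulg; rewrite Dulg in Dvl.
have d1 := differentiable_mulmx dvx dl; have d2 := differentiable_mulmx dl dvl.
have D1 := derive_mulmx h dvx dl; have D2 := derive_mulmx h dl dvl.
rewrite Dvx Dgx Dl in D1; rewrite Dvl Dgy Dl in D2.
exact: etrans (derive_sub h d1 d2) (congr2 (fun a b => a - b) D1 D2).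
Qed.

Lemma smooth_near_rows (m k : nat) (V : normedModType R) (f : V -> 'M[R]_(m, k)) z :
  (forall u : 'rV[R]_m, smooth_near (fun y => u *m f y) z) -> smooth_near f z.
Proof.
move=> H; apply: smooth_near_mx => i j.
have -> : (fun y => f y i j) = (fun y => ((delta_mx 0 i : 'rV[R]_m) *m f y) 0 j).
  by apply/funext => y; rewrite -rowE mxE.
exact: smooth_near_entry.
Qed.

Lemma affine_ext_near (U : set (mtop M)) (b : M -> gspace (B1 M)) (p x0 y0 : M) :
  bisection U b -> U p -> cdom x0 p -> cdom y0 (b p).1.2 ->
  \forall z \near coord x0 p,
    cdom (c2 x0 y0) ((affine_ext s \o b) (cinv x0 z)) /\
    let w := coord (c1 x0 y0) (b (cinv x0 z)) in
    let W := coord (c2 x0 y0) ((affine_ext s \o b) (cinv x0 z)) in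
    [/\ jsrc W = jsrc w, jtgt W = w
      & forall v, v *m jlin W = jmk v (v *m jlin w) (aff_form x0 y0 w v)].
Proof.
move=> [oU bU dU] Up dx dy; have [g1 g2 g3] := bU _ Up.
have db : cdom (c1 x0 y0) (b p).
  by split; [rewrite -[(b p).1.1]/(gsrc (b p)) g2|].
have sb := smooth_at_in (a := x0) (b := c1 x0 y0) aM aB dx db g3.
have nU := near_M dx (open_nbhs_nbhs (conj oU Up)).
apply: filterS2 nU sb.1 => z /bU[h1 h2 _] [d1 d2].
split.
  rewrite /comp; have [sh pjx _] := affine_extP h1; have := B1_src sh.1.
  have {}pjx : (affine_ext s (b (cinv x0 z))).1.2 = b (cinv x0 z) := pjx.
  rewrite pjx => E.
  have d0 : cdom x0 (affine_ext s (b (cinv x0 z))).1.1 by rewrite -E.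
  have d3 : cdom (c1 x0 y0) (affine_ext s (b (cinv x0 z))).1.2 by rewrite pjx; exact: (conj d1 d2).
  exact: (conj d0 d3).
exact: affine_ext_coord.
Qed.

(** Near p the composite has explicit coordinates; hence it is smooth and they can be differentiated
    one by one. The source part of [u *m jlin W] is the constant u, whence the 0. *)
Lemma affine_lift (U : set (mtop M)) (b : M -> gspace (B1 M)) (p x0 y0 : M) :
  bisection U b -> U p -> cdom x0 p -> cdom y0 (b p).1.2 ->
  let w z := coord (c1 x0 y0) (b (cinv x0 z)) in let z := coord x0 p in
  smooth_in x0 (c2 x0 y0) (affine_ext s \o b) p /\
  forall h, let w' := 'D_h w z in
  let W' := h *m dch x0 (c2 x0 y0) (affine_ext s \o b) p in
  [/\ jsrc W' = jsrc w', jtgt W' = w'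
    & forall u, u *m jlin W' =
        jmk 0 (u *m jlin w') ('D_h (fun y => aff_form x0 y0 (w y) u) z)].
Proof.
move=> bb Up dx dy w z; have N := affine_ext_near bb Up dx dy.
have [oU bU dU] := bb; have [g1 g2 g3] := bU _ Up.
have db : cdom (c1 x0 y0) (b p).
  by split; [rewrite -[(b p).1.1]/(gsrc (b p)) g2|].
have sb := smooth_at_in (a := x0) (b := c1 x0 y0) aM aB dx db g3.
have sw : smooth_near w z := sb.2; have dw := smooth_near_diff sw.
pose W y := coord (c2 x0 y0) ((affine_ext s \o b) (cinv x0 y)).
have bp : b (cinv x0 z) = b p by rewrite /z (at_K aM dx).
have wx : jsrc (w z) = coord x0 p.
  by apply: etrans (jsrc_coord (c1 x0 y0) _) _; rewrite bp -[(b p).1.1]/(gsrc (b p)) g2.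
have wy : jtgt (w z) = coord y0 (b p).1.2.
  by apply: etrans (jtgt_coord (c1 x0 y0) _) _; rewrite bp.
have sa u : smooth_near (fun y => aff_form x0 y0 (w y) u) z :=
  smooth_near_aff_form u dx dy sw wx wy.
have sl : smooth_near (fun y => jlin (w y)) z := smooth_near_lin _ sw.
have sm u : smooth_near (fun y => jmk u (u *m jlin (w y)) (aff_form x0 y0 (w y) u)) z.
  apply: smooth_near_row_mx; last exact: smooth_near_lin.
  apply: smooth_near_row_mx; first exact: smooth_near_cst.
  by apply: smooth_near_mulmx sl; exact: smooth_near_cst.
have sJ : smooth_near (fun y => jlin (W y)) z.
  apply: smooth_near_rows => u; apply: smooth_near_ext (sm u).
  by apply: filterS N => y [_ [_ _ E]]; exact/esym/E.
have sW : smooth_near W z.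
  have : smooth_near (fun y => jmk (jsrc (w y)) (w y) (jlin (W y))) z.
    apply: smooth_near_row_mx; last exact: smooth_near_lin.
    by apply: smooth_near_row_mx => //; exact: smooth_near_lin.
  apply: smooth_near_ext; apply: filterS N => y [_ [E1 E2 _]].
  by rewrite [RHS]jmkE; congr jmk; exact/esym.
have sb' : smooth_in x0 (c2 x0 y0) (affine_ext s \o b) p.
  by split; [apply: filterS N => y []|exact: sW].
split=> // h w' W'.
have DW : W' = 'D_h W z by exact/esym/dchP.
have dW := smooth_near_diff sW.
split.
- rewrite DW; apply: etrans (esym (derive_jsrc h dW)) _.
  apply: etrans (derive_jsrc h dw); apply: near_eq_derive.
  by apply: filterS N => y [_ []].
- rewrite DW; apply: etrans (esym (derive_jtgt h dW)) _.
  by apply: near_eq_derive; apply: filterS N => y [_ []].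
- move=> u; rewrite DW -(derive_jlin h dW).
  have dJ := smooth_near_diff sJ.
  have dc : differentiable (fun=> u) z := smooth_near_diff (smooth_near_cst u z).
  have Dc : 'D_h (fun=> u) z = 0 by exact: derive_cst.
  have E1 : 'D_h (fun y => u *m jlin (W y)) z = u *m 'D_h (fun y => jlin (W y)) z.
    by apply: etrans (derive_mulmx h dc dJ) _; rewrite Dc mul0mx add0r.
  rewrite -E1.
  have E2 : 'D_h (fun y => u *m jlin (W y)) z =
      'D_h (fun y => jmk u (u *m jlin (w y)) (aff_form x0 y0 (w y) u)) z.
    by apply: near_eq_derive; apply: filterS N => y [_ [_ _ E]]; exact: E.
  rewrite E2.
  have dl := smooth_near_diff sl; have da := smooth_near_diff (sa u).
  have dul : differentiable (fun y => u *m jlin (w y)) z := differentiable_mulmx dc dl.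
  have Dul : 'D_h (fun y => u *m jlin (w y)) z = u *m jlin w'.
    apply: etrans (derive_mulmx h dc dl) _.
    by rewrite Dc mul0mx add0r (derive_jlin h dw).
  have dma : differentiable (fun y => mxvec (aff_form x0 y0 (w y) u)) z := differentiable_lin _ da.
  have Dma : 'D_h (fun y => mxvec (aff_form x0 y0 (w y) u)) z =
     mxvec ('D_h (fun y => aff_form x0 y0 (w y) u) z) := derive_lin mxvec h da.
  have d1 := differentiable_row_mx dc dul; have D1 := derive_row_mx h dc dul.
  rewrite Dc Dul in D1.
  exact: etrans (derive_row_mx h d1 dma) (congr2 row_mx D1 Dma).
Qed.

(** S o b is again a bisection on the same open set: it inherits its sources and its target map from
    b. *)
Lemma affine_lift_gset (U : set (mtop M)) (b : M -> gspace (B1 M)) (p : M) :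
  bisection U b -> U p -> gset (jet1 (affine_ext s \o b) p : gspace (B111nh M)).
Proof.
move=> bb Up; exists U, (affine_ext s \o b); split=> //.
have [oU bU dU] := bb.
have E : gtgt (g := B11nh M) \o (affine_ext s \o b) = gtgt (g := B1 M) \o b.
  by apply/funext => q; rewrite /= affine_ext_pj.
split=> //; last by rewrite E.
move=> q Uq; have [g1 g2 g3] := bU _ Uq.
have [sh pjx _] := affine_extP g1.
split; first exact: sh.1.
- apply: etrans (esym (B1_src sh.1)) _.
  by rewrite /comp affine_ext_pj; exact: g2.
- have qq := at_center aM q; have yy := at_center aM (b q).1.2.
  exact: (smooth_in_at aM aBB qq (affine_lift bb Uq qq yy).1).
Qed.

(* The derivative of [aff_form _ _ _ u] along the affine extension of xi, in the direction h. *)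
Definition aff_form2 (xi : gspace (B1 M)) (h u : 'rV[R]_n) : 'M[R]_n :=
  let x := xi.1.1 in let y := xi.1.2 in let A : 'M[R]_n := xi.2 in
  let B := aff_form x y (coord (c1 x y) xi) h in
  let gx := gam_mx s x (coord x x) in let gy := gam_mx s y (coord y y) in
  vec_mx (u *m 'D_h (gam_mx s x) (coord x x)) *m A + vec_mx (u *m gx) *m B
  - (B *m vec_mx (u *m A *m gy)
     + A *m vec_mx (u *m B *m gy + u *m A *m 'D_(h *m A) (gam_mx s y) (coord y y))).

(** The derivative at x of a bisection representing S(xi) is itself a coordinate of S(xi). Hence the
    target part of the third-order row is the row of S(xi), which expresses p_* = p, and the
    derivative of [aff_form] is evaluated at known arguments. *)
Lemma affine_ext3P (xi : gspace (B1 M)) : gset xi ->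
  let x := xi.1.1 in let y := xi.1.2 in let w := coord (c1 x y) xi in
  [/\ gset (affine_ext3 s xi), (affine_ext3 s xi).1 = (x, affine_ext s xi)
    & forall h, let W' := h *m (affine_ext3 s xi).2 in
      [/\ jsrc W' = h, jtgt W' = jmk h (h *m xi.2) (aff_form x y w h)
        & forall u, u *m jlin W' = jmk 0 (u *m aff_form x y w h) (aff_form2 xi h u)]].
Proof.
move=> gxi x y w; have [sh pjx _] := affine_extP gxi.
set j := affine_ext s xi in sh pjx *; have gj := sh.1.
have j1 : j.1.2 = xi := pjx.
have sj : j.1.1 = x by rewrite -(B1_src gj) j1.
have xx := at_center aM x; have yy := at_center aM y.
have dxj : cdom x j.1.1 by rewrite sj.
have dyj : cdom y j.1.2.1.2 by rewrite j1.
have [bb Ux sb bE WE] := rep_chart gj dxj dyj.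
rewrite sj j1 in Ux sb bE WE.
set b := (rep j).2 in bb Ux sb bE WE *.
have E3 : affine_ext3 s xi = jet1 (affine_ext s \o b) x by rewrite -sj.
have bx : (affine_ext s \o b) x = j by rewrite /comp bE.
split.
- rewrite E3; exact: affine_lift_gset bb Ux.
- by rewrite E3 -[LHS]/(x, (affine_ext s \o b) x) bx.
have dyb : cdom y (b x).1.2 by rewrite bE.
have [sb' DE] := affine_lift bb Ux xx dyb.
have D3 : (affine_ext3 s xi).2 = dch x (c2 x y) (affine_ext s \o b) x.
  rewrite E3; apply: etrans (dmatE _ _) _; rewrite !dchE.
  have -> // : coord ((affine_ext s \o b) x) = coord (c2 x y).
  rewrite bx; apply: etrans (coord_c2 sj _) _; by rewrite j1.
move=> h W'; have WE' : W' = h *m dch x (c2 x y) (affine_ext s \o b) x by rewrite /W' D3.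
have [E1 E2 E4] := DE h.
set w1 := fun z => coord (c1 x y) (b (cinv x z)) in E1 E2 E4.
have Dw : 'D_h w1 (coord x x) = jmk h (h *m xi.2) (aff_form x y w h).
  have -> : 'D_h w1 (coord x x) = h *m dch x (c1 x y) b x by exact: dchP.
  have [_ _ lE] := affine_ext_coord gxi xx yy.
  have -> : dch x (c1 x y) b x = jlin (coord (c2 x y) j) by rewrite WE (jmkK _ _ _).2.
  rewrite lE; congr jmk; rewrite -(jlin_center xi); by [].
have w0 : w1 (coord x x) = w by rewrite /w1 (at_K aM xx) bE.
rewrite Dw in E1 E2 E4; rewrite WE'; split.
- by rewrite E1; exact: (jmkK _ _ _).1.1.
- exact: E2.
move=> u; rewrite E4; congr jmk; first by congr mulmx; exact: (jmkK _ _ _).2.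
have sw : smooth_near w1 (coord x x) := sb.2.
have wx : jsrc (w1 (coord x x)) = coord x x by rewrite w0; exact: jsrc_coord.
have wy : jtgt (w1 (coord x x)) = coord y y by rewrite w0; exact: jtgt_coord.
apply: etrans (derive_aff_form h u xx yy sw wx wy) _.
rewrite Dw wx wy w0 /aff_form2 -[jlin w]/(jlin (coord (c1 xi.1.1 xi.1.2) xi)) jlin_center.
by rewrite !(jmkK _ _ _).
Qed.

Lemma aff_form_center (xi : gspace (B1 M)) u :
  let x := xi.1.1 in let y := xi.1.2 in
  aff_form x y (coord (c1 x y) xi) u =
  gam s x (coord x x) u *m xi.2 - xi.2 *m gam s y (coord y y) (u *m xi.2).
Proof.
move=> x y; rewrite /aff_form !gamE jlin_center.
have -> : jsrc (coord (c1 x y) xi) = coord x x by exact: jsrc_coord.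
by have -> : jtgt (coord (c1 x y) xi) = coord y y by exact: jtgt_coord.
Qed.

(** Torsion is the skew part of the Christoffel form. With G and G' at source and target, its
    invariance reads u A G'(h A) - h A G'(u A) = (u G(h) - h G(u)) A; exchanging two terms between
    the sides gives the symmetry. *)
Lemma aff_form_sym (xi : gspace (B1 M)) h u : preserves_torsion s xi ->
  let B := aff_form xi.1.1 xi.1.2 (coord (c1 xi.1.1 xi.1.2) xi) in u *m B h = h *m B u.
Proof.
move=> tors B; rewrite /B !aff_form_center.
have := tors h u; rewrite !(torsion_atE hs) /app.
set A := xi.2; set x := xi.1.1; set y := xi.1.2.
rewrite -[gsrc xi]/x -[gtgt xi]/y.
have alg (a b c d : 'rV[R]_n) : a - b = c - d -> c - a = d - b.
  by move=> E; rewrite -(subrK d c) -E [a - b + d - a]addrAC [a - b - a]addrAC subrr sub0r addrC.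
by rewrite mulmxBl !mulmxBr !mulmxA => /alg.
Qed.

Lemma aff_form2_sub (xi : gspace (B1 M)) h u v : preserves_torsion s xi ->
  v *m (aff_form2 xi h u - aff_form2 xi u h) =
  app xi (curvature_at s xi.1.1 h u v)
  - curvature_at s xi.1.2 (app xi h) (app xi u) (app xi v).
Proof.
move=> tors; have := aff_form_sym h u tors.
rewrite /aff_form2 !aff_form_center !(curvature_atE hs) /app !gamE.
exact: curvature_difference.
Qed.

End Affine.

(** * The involution *)

Lemma jmk_eq (R : realType) p q (w w' : 'rV[R]_(p + q + p * q)) :
  jsrc w = jsrc w' -> jtgt w = jtgt w' ->
  jlin w = jlin w' -> w = w'.
Proof.
by move=> E1 E2 E3; apply: etrans (jmkE w) _; rewrite E1 E2 E3; exact/esym/jmkE.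
Qed.

Lemma rows_eq (R : realType) m k (A B : 'M[R]_(m, k)) :
  (forall u : 'rV[R]_m, u *m A = u *m B) -> A = B.
Proof. by move=> E; apply/row_matrixP => i; rewrite !rowE. Qed.

Lemma jet2_eq (R : realType) n (W W' : 'rV[R]_(n + (n + n + n * n) + n * (n + n + n * n))) :
  jsrc W = jsrc W' -> jsrc (jtgt W) = jsrc (jtgt W') -> jtgt (jtgt W) = jtgt (jtgt W') ->
  (forall v : 'rV[R]_n, v *m jlin (jtgt W) = v *m jlin (jtgt W')) ->
  (forall u : 'rV[R]_n, jsrc (u *m jlin W) = jsrc (u *m jlin W')) ->
  (forall u : 'rV[R]_n, jtgt (u *m jlin W) = jtgt (u *m jlin W')) ->
  (forall v u : 'rV[R]_n, v *m jlin (u *m jlin W) = v *m jlin (u *m jlin W')) -> W = W'.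
Proof.
move=> E1 E2 E3 E4 E5 E6 E7; apply: jmk_eq => //.
  by apply: jmk_eq => //; exact: rows_eq.
by apply: rows_eq => u; apply: jmk_eq => //; exact: rows_eq.
Qed.

Lemma mul_lin1_mx (R : realType) m k (f : 'rV[R]_m -> 'rV[R]_k) u :
  linear f -> u *m lin1_mx f = f u.
Proof.
move=> lf; pose g : {linear 'rV[R]_m -> 'rV[R]_k} := HB.pack f (GRing.isLinear.Build R _ _ _ f lf).
exact: (mul_rV_lin1 g u).
Qed.

(* The row of the jet that exchanges the directions h and u of the third-order part
   of the jet with derivative D. *)
Definition flip_row (R : realType) (n : nat)
    (D : 'M[R]_(n, n + (n + n + n * n) + n * (n + n + n * n))) (h : 'rV[R]_n) :
    'rV[R]_(n + (n + n + n * n) + n * (n + n + n * n)) :=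
  jmk h (jtgt (h *m D)) (lin1_mx (fun u => h *m jlin (u *m D))).

Lemma flip_row_linear (R : realType) (n : nat)
    (D : 'M[R]_(n, n + (n + n + n * n) + n * (n + n + n * n))) : linear (flip_row D).
Proof.
move=> a u v; rewrite /flip_row /jmk.
have -> : lin1_mx (fun w : 'rV[R]_n => (a *: u + v) *m jlin (w *m D)) =
  a *: lin1_mx (fun w : 'rV[R]_n => u *m jlin (w *m D)) +
  lin1_mx (fun w : 'rV[R]_n => v *m jlin (w *m D)).
  by apply/matrixP => i k; rewrite mxE mulmxDl -scalemxAl !mxE.
by rewrite mulmxDl -scalemxAl !linearP !scale_row_mx !add_row_mx.
Qed.

Lemma flipP (R : realType) (n : nat)
    (D : 'M[R]_(n, n + (n + n + n * n) + n * (n + n + n * n))) (h : 'rV[R]_n) :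
  let W := h *m lin1_mx (flip_row D) in
  [/\ jsrc W = h, jtgt W = jtgt (h *m D)
    & forall u : 'rV[R]_n, u *m jlin W = h *m jlin (u *m D)].
Proof.
move=> W; have WE : W = flip_row D h := mul_lin1_mx h (flip_row_linear D).
rewrite WE /flip_row !jmkK; split=> // u.
apply: (mul_lin1_mx u (f := fun u => h *m jlin (u *m D))) => a v w.
by rewrite mulmxDl -scalemxAl !linearP.
Qed.

Section Kappa.
Context {R : realType} {n : nat} (M : manifold R n).
Let aM : atlas M. Proof. exact: atlas_manifold M. Qed.
Let aTM : atlas (TB M). Proof. exact: atlas_TB aM. Qed.
Let aB : atlas (Hom M M). Proof. exact: atlas_Hom aM aM. Qed.
Let aBB : atlas (Hom M (Hom M M)). Proof. exact: atlas_Hom aM aB. Qed.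

Lemma coord_t2_center (x : M) (v : 'rV[R]_n) (q : 'rV[R]_(n + n)) :
  coord (t2 x) (((x, v), q) : TB (TB M)) = row_mx (row_mx (coord x x) v) q.
Proof.
have xx := at_center aM x.
apply: etrans (coord_TB _ _) _; congr row_mx.
  apply: etrans (coord_TB _ _) _; congr row_mx.
  by apply: etrans (congr1 (mulmx v) (tr_id aM xx)) _; rewrite mulmx1.
have dx : cdom (t1 x) ((x, v) : TB M) := xx.
(* The two indices differ in their fibre part only, so they name the same chart. *)
have E : tr ((x, v) : TB M) (t1 x) ((x, v) : TB M) = tr (t1 x) (t1 x) ((x, v) : TB M).
  by rewrite !trE.
apply: etrans (congr1 (mulmx q) E) _.
by apply: etrans (congr1 (mulmx q) (tr_id aTM dx)) _; rewrite mulmx1.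
Qed.

Lemma t2_inj (y : M) (Q : TB (TB M)) (c a : 'rV[R]_n) (r : 'rV[R]_(n + n)) :
  Q.1.1 = y -> coord (t2 y) Q = row_mx (row_mx c a) r -> Q = ((y, a), r).
Proof.
case: Q => -[y' a'] q E; have {E} -> : y' = y := E.
move=> E; have {E} := etrans (esym (coord_t2_center y a' q)) E.
by move=> /eq_row_mx[/eq_row_mx[_ ->] ->].
Qed.

Lemma act2_row (j : gspace (B11nh M)) (v u w : 'rV[R]_n) : gset j ->
  let W := coord (c2 j.1.1 j.1.2.1.2) j in
  act2 j ((j.1.1, v), row_mx u w) =
  ((j.1.2.1.2, v *m jlin (jtgt W)),
   row_mx (jtgt (u *m jlin W)) (w *m jlin (jtgt W) + v *m jlin (u *m jlin W))).
Proof.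
move=> gj W; have xx := at_center aM j.1.1; have yy := at_center aM j.1.2.1.2.
have [] := act2_coord (V := ((j.1.1, v), row_mx u w) : TB (TB M)) gj (erefl _) xx yy.
rewrite coord_t2_center -/W /act2_loc /act1_loc !(row_mxKl, row_mxKr).
exact: t2_inj.
Qed.

(** Besides the base point, v, u, h are first-order slots; w, v', u' belong to the pairs (u, v), (h,
    v), (h, u), and w' to all three. The involution exchanges (u, w) with (h, v'). *)
Lemma act3_row (j : gspace (B111nh M)) (v u w h v' u' w' : 'rV[R]_n) : gset j ->
  let x := j.1.1 in let y := j.1.2.1.2.1.2 in
  let W := coord (c2 x y) j.1.2 in let W' := h *m j.2 in
  act3 j (((x, v), row_mx u w), row_mx (row_mx h v') (row_mx u' w')) =
  (((y, v *m jlin (jtgt W)),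
    row_mx (jtgt (u *m jlin W)) (w *m jlin (jtgt W) + v *m jlin (u *m jlin W))),
   row_mx (row_mx (jtgt (jtgt W')) (v' *m jlin (jtgt W) + v *m jlin (jtgt W')))
     (row_mx (jtgt (u' *m jlin W + u *m jlin W'))
       (w' *m jlin (jtgt W) + w *m jlin (jtgt W')
        + (v' *m jlin (u *m jlin W) + v *m jlin (u' *m jlin W + u *m jlin W'))))).
Proof.
move=> gj x y W W'; have [gk sk] := B11_src gj.
set V1 : TB (TB M) := ((x, v), row_mx u w); set V2 := row_mx (row_mx h v') _.
have E1 : act2 j.1.2 V1 = ((y, v *m jlin (jtgt W)),
    row_mx (jtgt (u *m jlin W)) (w *m jlin (jtgt W) + v *m jlin (u *m jlin W))).
  by have := act2_row v u w gk; rewrite sk; exact.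
have E2 := act3E (V := (V1, V2) : TB (TB (TB M))) gj (erefl _).
have E3 := coord_t2_center x v (row_mx u w).
apply: etrans E2 _; apply: congr2 E1 _.
apply: etrans (congr1 (fun X => dact2_loc W (lsubmx (lsubmx V2) *m j.2) X V2) E3) _.
by rewrite /V2 /dact2_loc !(row_mxKl, row_mxKr).
Qed.

Lemma jsrc_jtgt_coord (x y : M) (k : Hom M (Hom M M)) :
  jsrc (jtgt (coord (c2 x y) k)) = coord x k.1.2.1.1 :> 'rV[R]_n.
Proof.
apply: etrans (congr1 (@jsrc R n n) (jtgt_coord (c2 x y) k)) _.
exact: (jsrc_coord (c1 x y)).
Qed.

Lemma jtgt_jtgt_coord (x y : M) (k : Hom M (Hom M M)) :
  jtgt (jtgt (coord (c2 x y) k)) = coord y k.1.2.1.2 :> 'rV[R]_n.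
Proof.
apply: etrans (congr1 (@jtgt R n n) (jtgt_coord (c2 x y) k)) _.
exact: (jtgt_coord (c1 x y)).
Qed.

(** Differentiates the source identities that hold along a bisection. They supply the components of
    the jet that its action on T^3M does not show. *)
Lemma B111_src (j : gspace (B111nh M)) : gset j -> forall h, let W' := h *m j.2 in
  [/\ jsrc W' = h, jsrc (jtgt W') = h & forall u, jsrc (u *m jlin W') = 0].
Proof.
move=> gj h W'; have [gj1 sj1] := B11_src gj; have [[oU bU dU] Ux jE] := repP gj.
have sj2 := B1_src gj1.
set b := (rep j).2 in bU dU jE *; set U := (rep j).1 in oU bU dU Ux.
set x := j.1.1 in Ux jE sj1 *; pose y := j.1.2.1.2.1.2.
have xx := at_center aM x; have yy := at_center aM y.
have bE : b x = j.1.2 by rewrite [in RHS]jE.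
have [_ _ sb] := bU _ Ux.
have c2E : coord (b x) = coord (c2 x y).
  rewrite bE; exact: (coord_c2 sj1 (etrans sj2 sj1)).
have sb' : smooth_in x (c2 x y) b x.
  have sb0 : smooth_in x (b x) b x := sb.
  have db : cdom (c2 x y) (b x).
    rewrite bE -[cdom _ _]/(cdom x j.1.2.1.1 /\ (cdom x j.1.2.1.2.1.1 /\ cdom y y)).
    by rewrite sj2 sj1; exact: (conj xx (conj xx yy)).
  exact: (smooth_in_chart aM aBB sb0 xx xx db).
pose W z : 'rV[R]_(n + (n + n + n * n) + n * (n + n + n * n)) :=
  coord (c2 x y) (b (cinv x z)).
have jm : j.2 = dch x (c2 x y) b x.
  rewrite jE; apply: etrans (dmatE _ _) _; rewrite !dchE.
  by have -> : coord (b x) = coord (c2 x y) by [].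
have DW : W' = 'D_h W (coord x x) by rewrite /W' jm; exact/esym/dchP.
have dW : differentiable W (coord x x) := smooth_near_diff sb'.2.
have nU := near_M xx (open_nbhs_nbhs (conj oU Ux)).
have N : \forall z \near coord x x, [/\ jsrc (W z) = z, jsrc (jtgt (W z)) = z
    & forall u, jsrc (u *m jlin (W z)) = u].
  apply: filterS3 nU (near_center aM xx) sb'.1 => z /bU[g1 g2 _] [_ cz] [d1 [_ d2]].
  have s2 := B1_src g1.
  split.
  - apply: etrans (jsrc_coord (c2 x y) _) _.
    by rewrite -[(b _).1.1]/(gsrc (b (cinv x z))) g2.
  - apply: etrans (jsrc_jtgt_coord x y _) _.
    by rewrite s2 -[(b _).1.1]/(gsrc (b (cinv x z))) g2.
  - by move=> u; exact: B11_srcE.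
have Did : 'D_h (fun z : 'rV[R]_n => z) (coord x x) = h by exact: derive_id.
split.
- rewrite DW; apply: etrans (esym (derive_jsrc h dW)) _.
  apply: etrans Did; apply: near_eq_derive.
  by apply: filterS N => z [].
- rewrite DW; apply: etrans (congr1 (@jsrc R n n) (esym (derive_jtgt h dW))) _.
  have dt : differentiable (fun z => jtgt (W z)) (coord x x) := differentiable_lin _ dW.
  apply: etrans (esym (derive_jsrc h dt)) _.
  apply: etrans Did; apply: near_eq_derive.
  by apply: filterS N => z [].
- move=> u; rewrite DW -(derive_jlin h dW).
  have dl : differentiable (fun z => jlin (W z)) (coord x x) := differentiable_lin _ dW.
  have dc : differentiable (fun=> u) (coord x x) := smooth_near_diff (smooth_near_cst u _).
  have dul := differentiable_mulmx dc dl.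
  have Dul : 'D_h (fun z => u *m jlin (W z)) (coord x x) =
      u *m 'D_h (fun z => jlin (W z)) (coord x x).
    apply: etrans (derive_mulmx h dc dl) _.
    by have -> : 'D_h (fun=> u) (coord x x) = 0 by [exact: derive_cst]; rewrite mul0mx add0r.
  rewrite -Dul; apply: etrans (esym (derive_jsrc h dul)) _.
  have <- : 'D_h (fun=> u) (coord x x) = 0 by exact: derive_cst.
  by apply: near_eq_derive; apply: filterS N => z [_ _ E]; exact: E.
Qed.

Lemma coord_inj (N : charted R) (a p q : N) : atlas N -> cdom a p -> cdom a q ->
  coord a p = coord a q -> p = q.
Proof. by move=> aN ap aq E; rewrite -(at_K aN ap) -(at_K aN aq) E. Qed.

Lemma mul0mx_addI m k l (A A' : 'M[R]_(m, k)) (p q : 'M[R]_(l, k)) :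
  0 *m A + p = 0 *m A' + q -> p = q.
Proof. by rewrite !mul0mx !add0r. Qed.

Lemma triple_inj (A B C : Type) (a a' : A) (b b' : B) (c c' : C) :
  (a, b, c) = (a', b', c') -> [/\ a = a', b = b' & c = c'].
Proof. by case. Qed.

(** Test vectors with most slots zero isolate the target and linear parts. The source parts are
    invisible to the action and are fixed by membership in the groupoid. *)
Lemma act2_inj (j j' : gspace (B11nh M)) : gset j -> gset j' -> j.1.1 = j'.1.1 ->
  (forall V : TB (TB M), V.1.1 = j.1.1 -> act2 j V = act2 j' V) -> j = j'.
Proof.
move=> gj gj' sE aE.
have E v u w : act2 j ((j.1.1, v), row_mx u w) = act2 j' ((j'.1.1, v), row_mx u w).
  by rewrite -sE; exact: aE.
have {}E v u w := etrans (esym (act2_row v u w gj)) (etrans (E v u w) (act2_row v u w gj')).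
have yE : j.1.2.1.2 = j'.1.2.1.2 by have [] := triple_inj (E 0 0 0).
have xx := at_center aM j.1.1; have yy := at_center aM j.1.2.1.2.
have d (k : gspace (B11nh M)) : gset k -> k.1.1 = j.1.1 -> k.1.2.1.2 = j.1.2.1.2 ->
    cdom (c2 j.1.1 j.1.2.1.2) k.
  move=> gk e1 e2; have e3 := B1_src gk.
  rewrite -[cdom _ _]/(cdom j.1.1 k.1.1 /\ (cdom j.1.1 k.1.2.1.1 /\ cdom j.1.2.1.2 k.1.2.1.2)).
  by rewrite e3 e1 e2.
apply: (coord_inj aBB (d j gj (erefl _) (erefl _)) (d j' gj' (esym sE) (esym yE))).
rewrite -sE -yE in E.
set W := coord _ j in E *; set W' := coord _ j' in E *.
have dx' : cdom j.1.1 j'.1.1 by rewrite -sE.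
have dy' : cdom j.1.2.1.2 j'.1.2.1.2 by rewrite -yE.
have l1 u : jsrc (u *m jlin W) = u by exact: B11_srcE.
have l2 u : jsrc (u *m jlin W') = u by exact: B11_srcE.
apply: (@jet2_eq R n W W').
- apply: etrans (jsrc_coord (c2 _ _) _) _; apply: etrans (esym (jsrc_coord (c2 _ _) _)).
  by rewrite sE.
- apply: etrans (jsrc_jtgt_coord _ _ _) _; apply: etrans (esym (jsrc_jtgt_coord _ _ _)).
  by rewrite (B1_src gj) (B1_src gj') sE.
- apply: etrans (jtgt_jtgt_coord _ _ _) _; apply: etrans (esym (jtgt_jtgt_coord _ _ _)).
  by rewrite yE.
- by move=> v; have [] := triple_inj (E v 0 0).
- by move=> u; exact: etrans (l1 u) (esym (l2 u)).
- by move=> u; have [_ _ /eq_row_mx[]] := triple_inj (E 0 u 0).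
- move=> v u; have [_ _ /eq_row_mx[_ F]] := triple_inj (E v u 0).
  exact: mul0mx_addI F.
Qed.

Lemma act3_row2 (j : gspace (B111nh M)) (v u w h v' u' w' : 'rV[R]_n) : gset j ->
  let W := coord (c2 j.1.1 j.1.2.1.2.1.2) j.1.2 in let W' := h *m j.2 in
  (act3 j (((j.1.1, v), row_mx u w), row_mx (row_mx h v') (row_mx u' w'))).2 =
  row_mx (row_mx (jtgt (jtgt W')) (v' *m jlin (jtgt W) + v *m jlin (jtgt W')))
     (row_mx (jtgt (u' *m jlin W + u *m jlin W'))
       (w' *m jlin (jtgt W) + w *m jlin (jtgt W')
        + (v' *m jlin (u *m jlin W) + v *m jlin (u' *m jlin W + u *m jlin W')))).
Proof. by move=> gj W W'; rewrite (act3_row v u w h v' u' w' gj). Qed.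

Lemma act3_algebra (W W1 W2 : 'rV[R]_(n + (n + n + n * n) + n * (n + n + n * n)))
    (A : 'M[R]_n) :
  let F (W' : 'rV[R]_(n + (n + n + n * n) + n * (n + n + n * n))) (v u w v' u' w' : 'rV[R]_n) :=
    row_mx (row_mx (jtgt (jtgt W')) (v' *m A + v *m jlin (jtgt W')))
     (row_mx (jtgt (u' *m jlin W + u *m jlin W'))
       (w' *m A + w *m jlin (jtgt W')
        + (v' *m jlin (u *m jlin W) + v *m jlin (u' *m jlin W + u *m jlin W')))) in
  jsrc W1 = jsrc W2 -> jsrc (jtgt W1) = jsrc (jtgt W2) ->
  (forall u : 'rV[R]_n, jsrc (u *m jlin W1) = jsrc (u *m jlin W2)) ->
  (forall v u w v' u' w', F W1 v u w v' u' w' = F W2 v u w v' u' w') -> W1 = W2.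
Proof.
move=> F E1 E2 E3 E; apply: jet2_eq => //.
- by have /eq_row_mx[/eq_row_mx[-> _] _] := E 0 0 0 0 0 0.
- by move=> v; have /eq_row_mx[/eq_row_mx[_ +] _] := E v 0 0 0 0 0; rewrite !mul0mx !add0r.
- by move=> u; have /eq_row_mx[_ /eq_row_mx[+ _]] := E 0 u 0 0 0 0; rewrite !mul0mx !add0r.
- move=> v u; have /eq_row_mx[_ /eq_row_mx[_]] := E v u 0 0 0 0.
  by rewrite !mul0mx !add0r.
Qed.

Opaque act2 act3.

Lemma act3_fst (j : gspace (B111nh M)) (V : TB (TB (TB M))) : gset j -> V.1.1.1 = j.1.1 ->
  (act3 j V).1 = act2 j.1.2 V.1.
Proof. by move=> gj sV; rewrite (act3E gj sV). Qed.

(** The action on T^3M covers that of [j.1.2] on T^2M, so the underlying 2-jets agree. The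
    derivatives are then compared on vectors whose only nonzero fibre slots are v, u and h. *)
Lemma act3_inj (j j' : gspace (B111nh M)) : gset j -> gset j' -> j.1.1 = j'.1.1 ->
  (forall V : TB (TB (TB M)), V.1.1.1 = j.1.1 -> act3 j V = act3 j' V) -> j = j'.
Proof.
move=> gj gj' sE aE.
have [gk sk] := B11_src gj; have [gk' sk'] := B11_src gj'.
have kE : j.1.2 = j'.1.2.
  apply: act2_inj gk gk' _ _; first by rewrite sk sk'.
  move=> V1 sV; rewrite sk in sV.
  have sV' : V1.1.1 = j'.1.1 by rewrite -sE.
  have [V V1E] : exists V : TB (TB (TB M)), V.1 = V1 by exists (V1, 0).
  rewrite -V1E in sV sV' *.
  have F := act3_fst gj sV; have F' := act3_fst gj' sV'.
  have T (Q Q' : TB (TB (TB M))) (A D : TB (TB M)) : Q = Q' -> Q.1 = A -> Q'.1 = D -> A = D.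
    by move=> -> <-.
  apply: (T _ _ _ _ (aE V sV)).
    exact: F.
  exact: F'.
have W1E := B111_src gj; have W2E := B111_src gj'.
have E v u w h v' u' w' := congr1 snd (aE (((j.1.1, v), row_mx u w),
  row_mx (row_mx h v') (row_mx u' w')) (erefl _)).
have F v u w h v' u' w' := etrans (esym (act3_row2 v u w h v' u' w' gj)) (E v u w h v' u' w').
have G v u w h v' u' w' := act3_row2 v u w h v' u' w' gj'.
rewrite -sE -kE in G.
have D : j.2 = j'.2.
  apply: rows_eq => h; have [a1 a2 a3] := W1E h; have [b1 b2 b3] := W2E h.
  apply: (@act3_algebra (coord (c2 j.1.1 j.1.2.1.2.1.2) j.1.2) _ _ _
    (etrans a1 (esym b1)) (etrans a2 (esym b2)) (fun u => etrans (a3 u) (esym (b3 u)))).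
  move=> v u w v' u' w'.
  exact: etrans (F v u w h v' u' w') (G v u w h v' u' w').
by case: j j' sE kE D {gj gj' aE gk sk gk' sk' W1E W2E E F G} => [[a b] c] [[a' b'] c'] /= -> -> ->.
Qed.

(** Along a bisection the 2-jet moves while the chart stays, so membership must be recognised in a
    chart not centred at [j]. The rule [tr_Hom] carries the conditions of [jet_ok] across. *)
Lemma B11_chart_build (j : gspace (B11nh M)) (x0 y0 : M) : cdom (c2 x0 y0) j ->
  j.1.2.1.1 = j.1.1 -> let W := coord (c2 x0 y0) j in
  jlin (jtgt W) \in unitmx -> jet_ok (jlin W) -> gset j.
Proof.
move=> dj sj W uA [Js Jt].
have dx : cdom x0 j.1.1 := dj.1.
have d1 : cdom (c1 x0 y0) j.1.2 := dj.2.
have dx1 : cdom x0 j.1.2.1.1 := d1.1.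
have dy1 : cdom y0 j.1.2.1.2 := d1.2.
have xx := at_center aM j.1.1; have cc := at_center aB j.1.2.
have Wl : jlin W = tr x0 j.1.1 j.1.1 *m j.2 *m tr j.1.2 (c1 x0 y0) j.1.2.
  exact: jlin_coord.
have Wt : jtgt W = coord (c1 x0 y0) j.1.2 := jtgt_coord (c2 x0 y0) j.
have JE : j.2 = tr j.1.1 x0 j.1.1 *m jlin W *m tr (c1 x0 y0) j.1.2 j.1.2.
  rewrite Wl !mulmxA (tr_inv aM xx dx) mul1mx.
  by apply/esym; apply: etrans (esym (mulmxA _ _ _)) _; rewrite (tr_inv aB cc d1) mulmx1.
have TH v := tr_Hom v aM aM d1 cc.
apply: B11_build => //.
  by apply/(B1_gset (xi := j.1.2) dx1 dy1); rewrite -Wt.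
split.
  move=> u; rewrite JE !mulmxA; have [-> _] := TH (u *m tr j.1.1 x0 j.1.1 *m jlin W).
  rewrite Js sj -mulmxA -[RHS]mulmx1; congr (u *m _).
  exact: (tr_inv aM xx dx).
have -> : jtgt_mx j.2 = tr j.1.1 x0 j.1.1 *m jtgt_mx (jlin W) *m tr y0 j.1.2.1.2 j.1.2.1.2.
  apply: rows_eq => u; rewrite -jtgt_mxE JE !mulmxA.
  have [_ ->] := TH (u *m tr j.1.1 x0 j.1.1 *m jlin W).
  by rewrite jtgt_mxE.
have yy := at_center aM j.1.2.1.2.
have u1 := tr_unit aM xx dx; have u2 := tr_unit aM dy1 yy.
by rewrite !unitmx_mul u1 Jt u2.
Qed.

(** Along the affine section the three source components are affine in z; the prescribed derivatives
    1, 1 and 0 keep them equal to z, z and u, while the invertibility conditions are open. *)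
Lemma B111_build (j : gspace (B111nh M)) : let x := j.1.1 in let y := j.1.2.1.2.1.2 in
  let W := coord (c2 x y) j.1.2 in
  gset j.1.2 -> j.1.2.1.1 = x ->
  jlin (jtgt W) \in unitmx -> jtgt_mx (jlin W) \in unitmx ->
  jtgt_mx (jtgt_mx (j.2 : 'M[R]_(n, n + (n + n + n * n) + n * (n + n + n * n)))) \in unitmx ->
  (forall h, jsrc (h *m j.2) = h) -> (forall h, jsrc (jtgt (h *m j.2)) = h) ->
  (forall h u, jsrc (u *m jlin (h *m j.2)) = 0) -> gset j.
Proof.
move=> x y W gk sk uA uJ uF D1 D2 D3.
have xx := at_center aM x; have yy := at_center aM y.
have s1 : j.1.2.1.2.1.1 = x by rewrite (B1_src gk).
have dj : cdom (c2 x y) j.1.2.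
  have d0 : cdom x j.1.2.1.1 by rewrite sk.
  have d1 : cdom x j.1.2.1.2.1.1 by rewrite s1.
  exact: (conj d0 (conj d1 yy)).
set z0 := coord x x.
set D : 'M[R]_(n, n + (n + n + n * n) + n * (n + n + n * n)) := j.2 in uF D1 D2 D3.
have dxk : cdom x j.1.2.1.1 := dj.1.
have Wu u : jsrc (u *m jlin W) = u by exact: (B11_srcE u gk dxk yy).
have W0 : jsrc W = z0 by apply: etrans (jsrc_coord (c2 x y) _) _; rewrite sk.
have W1 : jsrc (jtgt W) = z0 by apply: etrans (jsrc_jtgt_coord x y _) _; rewrite s1.
have W2 : jtgt (jtgt W) = coord y y := jtgt_jtgt_coord x y _.
have smE : smooth_near (fun z => W + (z - z0) *m D) z0 := smooth_near_affine _ _ _ _.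
have n1 : \forall z \near z0, jlin (jtgt (W + (z - z0) *m D)) \in unitmx.
  apply: near_unitmx.
    exact: (smooth_near_lin (@jlin R n n) (smooth_near_lin (@jtgt R n (n + n + n * n)) smE)).
  by rewrite subrr mul0mx addr0.
have n2 : \forall z \near z0, jtgt_mx (jlin (W + (z - z0) *m D)) \in unitmx.
  apply: near_unitmx.
    exact: (smooth_near_lin rsubmx (smooth_near_lin lsubmx
      (smooth_near_lin (@jlin R n (n + n + n * n)) smE))).
  by rewrite subrr mul0mx addr0.
have [|U [b [bb Ux b0 sb Db]]] :=
  @build_bisection _ _ _ (B11nh M) (c2 x y) j.1.2 x y _ D aBB uF dj erefl.
  have n3 := @near_affine_cinv _ n (Hom M (Hom M M)) _ _ z0 D aBB dj.
  have T (P1 P2 P3 P4 : set 'rV[R]_n) : (forall z, P1 z -> P2 z -> P3 z -> P4 z) ->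
      nbhs z0 P1 -> nbhs z0 P2 -> nbhs z0 P3 -> nbhs z0 P4 by exact: filterS3.
  apply: (T _ _ _ _ _ n1 n2 n3) => z u1 u2 [].
  rewrite -/W; set e : gspace (B11nh M) := cinv _ _ => de ce.
  have de1 : cdom x e.1.1 := de.1.
  have de2 : cdom x e.1.2.1.1 := de.2.1.
  have c1E : coord x e.1.1 = z.
    apply: etrans (esym (jsrc_coord (c2 x y) e)) _; rewrite ce jsrcD D1 W0.
    by rewrite addrC subrK.
  have c2E : coord x e.1.2.1.1 = z.
    apply: etrans (esym (jsrc_jtgt_coord x y e)) _; rewrite ce jtgtD jsrcD D2 W1.
    by rewrite addrC subrK.
  have ss : e.1.2.1.1 = e.1.1 by apply: (coord_inj aM de2 de1); rewrite c1E c2E.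
  split.
  - apply: B11_chart_build de ss _ _; rewrite ce //; split=> // u.
    by rewrite jlinD mulmxDr jsrcD Wu D3 addr0.
  - by rewrite -[gsrc e]/(e.1.1) -(at_K aM de1) c1E.
  - exact: de.2.2.
  - apply: etrans (esym (jtgt_jtgt_coord x y e)) _; rewrite ce !jtgtD W2.
    by rewrite !jtgt_mxE.
exists U, b; split=> //.
have Dj : j.2 = dmat b x.
  rewrite dmatE -[LHS]/D -Db !dchE; have -> // : coord (b x) = coord (c2 x y).
  by rewrite b0; exact: (coord_c2 sk s1).
by rewrite /jet1 b0 -Dj; case: (j) => -[].
Qed.

Lemma kappa_row (x : M) (v u w h v' u' w' : 'rV[R]_n) :
  kappa (N := TB M) ((((x, v), row_mx u w), row_mx (row_mx h v') (row_mx u' w')) :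
    TB (TB (TB M))) =
  (((x, v), row_mx h v'), row_mx (row_mx u w) (row_mx u' w')).
Proof. by rewrite /kappa row_mxKl row_mxKr. Qed.

Lemma T3_row (V : TB (TB (TB M))) : exists (x : M) (v u w h v' u' w' : 'rV[R]_n),
  V = (((x, v), row_mx u w), row_mx (row_mx h v') (row_mx u' w')).
Proof.
case: V => -[[x v] p] q.
pose q1 : 'rV[R]_(n + n) := lsubmx (q : 'rV[R]_((n + n) + (n + n))).
pose q2 : 'rV[R]_(n + n) := rsubmx (q : 'rV[R]_((n + n) + (n + n))).
exists x, v, (lsubmx (p : 'rV[R]_(n + n))), (rsubmx (p : 'rV[R]_(n + n))), (lsubmx q1), (rsubmx q1),
  (lsubmx q2), (rsubmx q2).
by rewrite !hsubmxK.
Qed.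

(** Exchanging (u, w) with (h, v') permutes the lower-order terms of the action, provided the
    derivative of the underlying arrow is the row of the 2-jet, that is p_* = p. The remaining row
    [u *m jlin (h *m j.2)] is replaced by [h *m jlin (u *m j.2)], as in [flip_row]. *)
Lemma flip_act3 (j : gspace (B111nh M)) (V : TB (TB (TB M))) :
  let jf : gspace (B111nh M) := (j.1, lin1_mx (flip_row j.2)) in
  gset j -> gset jf -> V.1.1.1 = j.1.1 ->
  (forall h, jtgt (h *m j.2) = h *m jlin (coord (c2 j.1.1 j.1.2.1.2.1.2) j.1.2)) ->
  act3 jf V = kappa (N := TB M) (act3 j (kappa (N := TB M) V)).
Proof.
move=> jf gj gjf; have [x [v [u [w [h [v' [u' [w' ->]]]]]]]] := T3_row V.
move=> sV tE; have {sV} -> : x = j.1.1 := sV.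
have E1 := act3_row v u w h v' u' w' gjf; have E2 := act3_row v h v' u w u' w' gj.
have E3 := kappa_row j.1.1 v u w h v' u' w'.
apply: etrans E1 _; apply: etrans (congr1 (fun Q => kappa (N := TB M) (act3 j Q)) (esym E3)).
apply: etrans (congr1 (kappa (N := TB M)) (esym E2)).
apply: etrans (esym (kappa_row _ _ _ _ _ _ _ _)).
have [_ F2 F3] := flipP j.2 h.
rewrite -[jf.2]/(lin1_mx (flip_row j.2)) F2 F3 !tE.
congr (_, row_mx _ (row_mx _ _)).
by rewrite -!addrA; congr (_ + _); rewrite addrCA.
Qed.

End Kappa.

(** * The involution on the affine extension *)

Section KappaAffine.
Context {R : realType} {n : nat} (M : manifold R n).
Let aM : atlas M. Proof. exact: atlas_manifold M. Qed.
Variable s : M -> gspace (B11nh M).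
Hypothesis hs : symmetry_jet s.

Lemma affine_ext3_tgt (xi : gspace (B1 M)) : gset xi ->
  let x := xi.1.1 in let y := xi.1.2 in
  let W := coord (c2 x y) (affine_ext s xi) in
  [/\ jlin (jtgt W) = xi.2,
      forall u, u *m jlin W = jmk u (u *m xi.2) (aff_form s x y (coord (c1 x y) xi) u)
    & forall h, jtgt (h *m (affine_ext3 s xi).2) = h *m jlin W].
Proof.
move=> gxi x y W; have xx := at_center aM x; have yy := at_center aM y.
have [_ Wt WE] := affine_ext_coord hs gxi xx yy.
have [_ _ DE] := affine_ext3P hs gxi.
have l := jlin_center xi.
have E u : u *m jlin W = jmk u (u *m xi.2) (aff_form s x y (coord (c1 x y) xi) u).
  by rewrite WE -l.
split=> //; first by rewrite Wt.
by move=> h; rewrite E; have [_ -> _] := DE h.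
Qed.

Definition flip (j : gspace (B111nh M)) : gspace (B111nh M) := (j.1, lin1_mx (flip_row j.2)).

Lemma flip_affine_ext3 (xi : gspace (B1 M)) : gset xi -> gset (flip (affine_ext3 s xi)).
Proof.
move=> gxi; have [gj j1 DE] := affine_ext3P hs gxi.
have [A WE tE] := affine_ext3_tgt gxi.
have [sh pjx _] := affine_extP hs gxi.
have k1 : (affine_ext s xi).1.2 = xi := pjx.
have k2 : (affine_ext s xi).1.1 = xi.1.1 by rewrite -(B1_src sh.1) k1.
have l := jlin_center xi.
rewrite /flip j1; set D := (affine_ext3 s xi).2 in DE tE *.
set W := coord _ _ in A WE tE.
have yE : (affine_ext s xi).1.2.1.2 = xi.1.2 by rewrite k1.
have WE' : coord (c2 xi.1.1 (affine_ext s xi).1.2.1.2) (affine_ext s xi) = W by rewrite yE.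
have T (B C : 'M[R]_n) : C \in unitmx -> (forall u : 'rV[R]_n, u *m B = u *m C) -> B \in unitmx.
  by move=> uC /rows_eq ->.
apply: (@B111_build R n M (xi.1.1, affine_ext s xi, lin1_mx (flip_row D)) sh.1 k2).
- by rewrite WE' A.
- rewrite WE'; apply: (T _ xi.2 gxi) => u.
  by rewrite -jtgt_mxE WE; exact: (jmkK _ _ _).1.2.
- apply: (T _ xi.2 gxi) => h; have [_ F2 _] := flipP D h; have [_ G2 _] := DE h.
  by rewrite -!jtgt_mxE F2 G2; exact: (jmkK _ _ _).1.2.
- by move=> h; have [F1 _ _] := flipP D h.
- move=> h; have [_ F2 _] := flipP D h; have [_ G2 _] := DE h.
  by rewrite F2 G2; exact: (jmkK _ _ _).1.1.
- move=> h u; have [_ _ F3] := flipP D h; have [_ _ G3] := DE u.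
  by rewrite F3 G3; exact: (jmkK _ _ _).1.1.
Qed.

Lemma kappaJ_affine_ext3 (xi : gspace (B1 M)) : gset xi ->
  kappaJ (affine_ext3 s xi) = flip (affine_ext3 s xi).
Proof.
move=> gxi; have [gj j1 DE] := affine_ext3P hs gxi.
have [A WE tE] := affine_ext3_tgt gxi.
have [sh pjx _] := affine_extP hs gxi.
have k1 : (affine_ext s xi).1.2 = xi := pjx.
have gf := flip_affine_ext3 gxi.
set j := affine_ext3 s xi in gj j1 DE tE gf *.
have tE' h : jtgt (h *m j.2) = h *m jlin (coord (c2 j.1.1 j.1.2.1.2.1.2) j.1.2).
  by rewrite j1 k1; exact: tE.
have fE (V : TB (TB (TB M))) : V.1.1.1 = gsrc j ->
    act3 (flip j) V = kappa (N := TB M) (act3 j (kappa (N := TB M) V)).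
  by move=> sV; exact: flip_act3 gj gf sV tE'.
rewrite /kappaJ; set P := [set j' | _].
have Pf : P (flip j) := And3 gf (erefl _) fE.
have [] : P (xget j P) := xgetPex j (ex_intro _ (flip j) Pf).
set j' := xget j P => g' s' a'.
apply: (act3_inj g' gf s') => V sV.
have sV' : V.1.1.1 = gsrc j := etrans sV s'.
exact: etrans (a' V sV') (esym (fE V sV')).
Qed.

End KappaAffine.

(** * Iterated tangent maps and conclusion *)

Section TangentMaps.
Context {R : realType}.
Implicit Types (N P : charted R).

Lemma tproj_chart N (a p : TB N) : atlas N -> cdom a p ->
  smooth_in a a.1 (@tproj R N) p /\
  forall u : 'rV[R]_(cdim N + cdim N), u *m dch a a.1 (@tproj R N) p = lsubmx u.
Proof.
move=> aN dp; have aT := atlas_TB aN.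
have sp := smooth_to_proj (smooth_to_cinv aT dp).
split=> // u; apply: etrans (esym (@dchP _ (TB N) N a a.1 _ p u sp)) _.
apply: etrans (derive_proj u (smooth_to_cinv aT dp)) _.
have D := @derive_cinv _ (TB N) a p u aT dp.
by rewrite D.
Qed.

Lemma smooth_at_tproj N (v : TB N) : atlas N -> smooth_at (@tproj R N) v.
Proof. by move=> aN; apply/smooth_atP; have [] := tproj_chart aN (at_center (atlas_TB aN) v). Qed.

Lemma dmat_tproj N (v : TB N) (u : 'rV[R]_(cdim N + cdim N)) :
  atlas N -> u *m dmat (@tproj R N) v = lsubmx u.
Proof.
move=> aN; have [_ E] := tproj_chart aN (at_center (atlas_TB aN) v).
by rewrite dmatE; exact: E.
Qed.

Lemma tmap_tproj N (v : TB (TB N)) : atlas N ->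
  tmap (@tproj R N) v = (v.1.1, lsubmx (v.2 : 'rV[R]_(cdim N + cdim N))).
Proof. by move=> aN; rewrite /tmap dmat_tproj. Qed.

Lemma tr_TB_lsub N (a b p : TB N) (u : 'rV[R]_(cdim N + cdim N)) :
  atlas N -> cdom a p -> cdom b p ->
  lsubmx (u *m tr a b p) = lsubmx u *m tr a.1 b.1 p.1.
Proof.
move=> aN da db; have aT := atlas_TB aN.
have [sa Ea] := tproj_chart aN da; have [sb Eb] := tproj_chart aN db.
have i1 : smooth_in a.1 b.1 id p.1 := smooth_in_id aN da db.
have i2 : smooth_in a b id p := smooth_in_id aT da db.
have F1 := dch_comp aT aN da sa i1; have F2 := dch_comp aT aT da i2 sb.
rewrite !tr_dch; apply: etrans (esym (Eb _)) _.
apply: etrans (esym (mulmxA _ _ _)) _; apply: etrans (congr1 (mulmx u) (etrans (esym F2) F1)) _.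
by apply: etrans (mulmxA _ _ _) _; rewrite Ea.
Qed.

Lemma smooth_at_tmap N P (f : N -> P) (v : TB N) : atlas N -> atlas P ->
  (forall y, smooth_at f y) -> smooth_at (tmap f) v.
Proof.
move=> aN aP sf; have aT := atlas_TB aN.
have vv := at_center aT v.
pose g := coord (f v.1) \o f \o cinv v.1.
have [df sg] := sf v.1.
have lv : lsubmx (coord v v : 'rV_(cdim N + cdim N)) = coord v.1 v.1 := lsub_coord_TB v v.
have df' : \forall z \near coord v v, cdom (f v.1) (f (cinv v.1 (lsubmx z))).
  have d1 : nbhs (lsubmx (coord v v : 'rV[R]_(cdim N + cdim N)))
      [set z | cdom (f v.1) (f (cinv v.1 z))] by rewrite lv; exact: df.
  exact: near_lsub d1.
have N0 := near_center aT vv.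
have N1 : \forall z \near coord v v, cdom (tmap f v) (tmap f (cinv v z)) /\
   coord (tmap f v) (tmap f (cinv v z)) =
   row_mx (g (lsubmx z)) (rsubmx z *m jacobian g (lsubmx z)).
  apply: filterS2 N0 df' => z; set q := cinv v z => -[dq cq] dfq.
  have dq1 : cdom v.1 q.1 := dq.
  have qq := at_center aN q.1.
  have l1 : coord v.1 q.1 = lsubmx z by rewrite -cq; exact/esym/lsub_coord_TB.
  have r1 : rsubmx z = q.2 *m tr q.1 v.1 q.1 by rewrite -cq; exact: rsub_coord_TB.
  have dfq1 : cdom (f v.1) (f q.1) := dfq.
  have D := dmat_dch aN aP dq1 dfq1 (sf q.1).
  split; first exact: dfq.
  apply: etrans (coord_TB _ _) _.
  have J : jacobian g (lsubmx z) = dch v.1 (f v.1) f q.1 by rewrite dchE l1.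
  rewrite r1 J D; congr row_mx.
  rewrite !mulmxA; congr (_ *m _ *m _).
  by rewrite -mulmxA (tr_inv aN qq dq1) mulmx1.
split.
  by apply: filterS N1 => z [].
have sl : smooth_near (fun z : 'rV[R]_(cdim N + cdim N) => lsubmx z) (coord v v).
  exact: smooth_near_linear.
have sr : smooth_near (fun z : 'rV[R]_(cdim N + cdim N) => rsubmx z) (coord v v).
  exact: smooth_near_linear.
have sgl : smooth_near (fun z : 'rV[R]_(cdim N + cdim N) => g (lsubmx z)) (coord v v).
  by apply: smooth_near_comp sl _; rewrite lv.
have sj : smooth_near (fun z : 'rV[R]_(cdim N + cdim N) => jacobian g (lsubmx z)) (coord v v).
  by apply: smooth_near_comp sl _; rewrite lv; exact: smooth_near_jacobian.
have := smooth_near_row_mx sgl (smooth_near_mulmx sr sj).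
apply: smooth_near_ext; apply: filterS N1 => z [_ E].
exact: esym E.
Qed.

(** In induced charts p_** is linear: it drops the fibre half of each of the two blocks. It is
    therefore its own derivative. *)
Lemma dmat_tmap_tproj N (v : TB (TB N)) (u : 'rV[R]_(cdim N + cdim N + (cdim N + cdim N))) :
  atlas N -> u *m dmat (tmap (@tproj R N)) v =
    row_mx (lsubmx (lsubmx u)) (lsubmx (rsubmx u)).
Proof.
move=> aN; have aT := atlas_TB aN; have aTT := atlas_TB aT.
have vv := at_center aTT v.
pose L (z : 'rV[R]_(cdim N + cdim N + (cdim N + cdim N))) :=
  row_mx (lsubmx (lsubmx z)) (lsubmx (rsubmx z)).
have sL z : smooth_near L z.
  apply: smooth_near_row_mx; first exact: smooth_near_lin (smooth_near_linear lsubmx z).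
  exact: smooth_near_lin (smooth_near_linear rsubmx z).
have Llin : linear L.
  by move=> a p q; rewrite /L !linearP scale_row_mx add_row_mx.
have N1 : \forall z \near coord v v, L z =
    (coord (tmap (@tproj R N) v) \o tmap (@tproj R N) \o cinv v) z.
  apply: filterS (near_center aTT vv) => z; rewrite /comp; set q := cinv v z => -[dq cq].
  have dq1 : cdom v.1 q.1 := dq.
  have qq := at_center aT q.1.
  rewrite [X in coord _ X](tmap_tproj q aN).
  apply/esym; apply: etrans (coord_TB _ _) _; rewrite /L -cq; congr row_mx.
    apply/esym; apply: etrans (congr1 (@lsubmx R 1 (cdim N) (cdim N)) (lsub_coord_TB v q)) _.
    exact: lsub_coord_TB.
  apply/esym; apply: etrans (congr1 (@lsubmx R 1 (cdim N) (cdim N)) (rsub_coord_TB v q)) _.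
  exact: tr_TB_lsub aN qq dq1.
rewrite /dmat -(near_eq_jacobian N1 (smooth_near_diff (sL _))).
rewrite (@jacobianP _ _ _ L _ (lin1_mx L) (smooth_near_diff (sL _))).
  exact: mul_lin1_mx.
move=> w; rewrite (mul_lin1_mx _ Llin).
pose Lf : {linear 'rV[R]_(cdim N + cdim N + (cdim N + cdim N)) -> 'rV[R]_(cdim N + cdim N)} :=
  HB.pack L (GRing.isLinear.Build R _ _ _ L Llin).
have dl : differentiable (@id 'rV[R]_(cdim N + cdim N + (cdim N + cdim N))) (coord v v).
  exact: ex_diff.
apply: etrans (derive_lin Lf w dl) _.
by congr (L _); exact: derive_id.
Qed.

Lemma dmat_sec n (M : manifold R n) (Y : vfield M) (x : M) (u : 'rV[R]_n) :
  smooth_vfield_at Y x ->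
  lsubmx (u *m dmat (sec Y) x : 'rV[R]_(n + n)) = u.
Proof.
move=> sY; have aM := atlas_manifold M; have aT := atlas_TB aM.
have sp := smooth_at_tproj (sec Y x) aM.
have E := dmat_comp aM aT sY sp.
have I : dmat (@tproj R M \o sec Y) x = 1%:M.
  by apply: etrans (dmatE _ _) _; apply: etrans (esym (tr_dch _ _ _)) _;
    exact: (tr_id aM (at_center aM x)).
apply: etrans (esym (dmat_tproj (sec Y x) _ aM)) _.
apply: etrans (esym (mulmxA _ _ _)) _.
by apply: etrans (congr1 (mulmx u) (etrans (esym E) I)) _; rewrite mulmx1.
Qed.

(** The base point of [tmap (sec Z) v] in M is that of v; the chain rule is applied to this
    identity. *)
Lemma dmat_tmap_sec n (M : manifold R n) (Z : vfield M) (v : TB M) (u : 'rV[R]_(n + n)) :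
  smooth_vfield Z ->
  lsubmx (lsubmx (u *m dmat (tmap (sec Z)) v : 'rV[R]_((n + n) + (n + n)))) = lsubmx u.
Proof.
move=> sZ; have aM := atlas_manifold M; have aT := atlas_TB aM; have aTT := atlas_TB aT.
have st := smooth_at_tmap v aM aT sZ.
have sp1 := smooth_at_tproj (tmap (sec Z) v) aT.
have sp2 := smooth_at_tproj (tproj (tmap (sec Z) v)) aM.
have E1 := dmat_comp aT aTT st sp1.
have s1 := smooth_at_comp aT aTT st sp1.
have E2 := dmat_comp aT aT s1 sp2.
have F := dmat_tproj v u aM.
have {}E2 : dmat (@tproj R M) v = dmat (tmap (sec Z)) v *m dmat (@tproj R (TB M)) (tmap (sec Z) v)
    *m dmat (@tproj R M) (tproj (tmap (sec Z) v)).
  by rewrite E1 in E2; exact: E2.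
apply: etrans F; rewrite E2.
apply: etrans (esym (dmat_tproj (tproj (tmap (sec Z) v)) _ aM)) _.
rewrite -(dmat_tproj (tmap (sec Z) v) _ aT).
by rewrite !mulmxA.
Qed.

End TangentMaps.

(** * Evaluation of Pi on the affine extension *)

Section Main.
Context {R : realType} {n : nat} (M : manifold R n).
Let aM : atlas M. Proof. exact: atlas_manifold M. Qed.
Let aTM : atlas (TB M). Proof. exact: atlas_TB aM. Qed.
Variable s : M -> gspace (B11nh M).
Hypothesis hs : symmetry_jet s.

Lemma Pi_row (Q Q' : TB (TB (TB M))) (V : TB (TB M)) (a b c d d' : 'rV[R]_n) :
  Q = (V, row_mx (row_mx a b) (row_mx c d)) -> Q' = (V, row_mx (row_mx a b) (row_mx c d')) ->
  same_projections Q Q' /\ Pi Q Q' = d - d'.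
Proof.
move=> -> ->; split; last by rewrite /Pi !row_mxKr.
split.
- by [].
- apply: etrans (tmap_tproj (N := TB M) _ aTM) _.
  apply: etrans (esym (tmap_tproj (N := TB M) _ aTM)).
  by rewrite !row_mxKl.
- congr pair.
  apply: etrans (dmat_tmap_tproj V _ aM) _; apply: etrans (esym (dmat_tmap_tproj V _ aM)).
  by rewrite !(row_mxKl, row_mxKr).
Qed.

(** Derivatives of the fields occupy the slots w, v', u', w', which the difference of the two
    actions does not see. The other slots hold the values at x. *)
Lemma T3_sec_row (X Y Z : vfield M) (x : M) : smooth_vfield_at Y x -> smooth_vfield Z ->
  exists w v' u' w' : 'rV[R]_n,
  tmap (tmap (sec Z)) (tmap (sec Y) ((x, X x) : TB M)) =
  (((x, Z x), row_mx (Y x) w), row_mx (row_mx (X x) v') (row_mx u' w')).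
Proof.
move=> sY sZ; pose p : 'rV[R]_(n + n) := Y x *m dmat (sec Z) x.
pose q : 'rV[R]_(n + n) := X x *m dmat (sec Y) x.
pose r : 'rV[R]_((n + n) + (n + n)) := q *m dmat (tmap (sec Z)) ((x, Y x) : TB M).
have pl : lsubmx p = Y x by exact: dmat_sec.
have ql : lsubmx q = X x by exact: dmat_sec.
have rl : lsubmx (lsubmx r) = X x by rewrite /r dmat_tmap_sec.
exists (rsubmx p), (rsubmx (lsubmx r)), (lsubmx (rsubmx r)), (rsubmx (rsubmx r)).
have pE : row_mx (Y x) (rsubmx p) = p by rewrite -[RHS]hsubmxK pl.
have rE : row_mx (row_mx (X x) (rsubmx (lsubmx r)))
    (row_mx (lsubmx (rsubmx r)) (rsubmx (rsubmx r))) = r.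
  by rewrite -rl !hsubmxK.
by rewrite pE rE.
Qed.

(** The two derivatives share the target part along h and the component k, which are all that the
    three projections can distinguish. What differs is the term in the last slot where v is
    multiplied by C or C'. *)
Lemma Pi_act3 (p : (M * gspace (B11nh M))%type)
    (D D' : 'M[R]_(n, n + (n + n + n * n) + n * (n + n + n * n)))
    (v u w h v' u' w' k : 'rV[R]_n) (C C' : 'M[R]_n) :
  let j : gspace (B111nh M) := (p, D) in let j' : gspace (B111nh M) := (p, D') in
  let V : TB (TB (TB M)) := (((p.1, v), row_mx u w), row_mx (row_mx h v') (row_mx u' w')) in
  gset j -> gset j' -> jtgt (h *m D') = jtgt (h *m D) ->
  u *m jlin (h *m D) = jmk 0 k C -> u *m jlin (h *m D') = jmk 0 k C' ->
  same_projections (act3 j V) (act3 j' V) /\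
  Pi (act3 j V) (act3 j' V) = v *m (C - C').
Proof.
move=> j j' V gj gj' tE E E'.
have E1 := act3_row v u w h v' u' w' gj; have E2 := act3_row v u w h v' u' w' gj'.
pose y := p.2.1.2.1.2; pose W := coord (c2 p.1 y) p.2.
have {}E1 : act3 j V =
   (((y, v *m jlin (jtgt W)),
    row_mx (jtgt (u *m jlin W)) (w *m jlin (jtgt W) + v *m jlin (u *m jlin W))),
   row_mx (row_mx (jtgt (jtgt (h *m D))) (v' *m jlin (jtgt W) + v *m jlin (jtgt (h *m D))))
     (row_mx (jtgt (u' *m jlin W + u *m jlin (h *m D)))
       (w' *m jlin (jtgt W) + w *m jlin (jtgt (h *m D))
        + (v' *m jlin (u *m jlin W) + v *m jlin (u' *m jlin W + u *m jlin (h *m D)))))) := E1.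
have {}E2 : act3 j' V =
   (((y, v *m jlin (jtgt W)),
    row_mx (jtgt (u *m jlin W)) (w *m jlin (jtgt W) + v *m jlin (u *m jlin W))),
   row_mx (row_mx (jtgt (jtgt (h *m D'))) (v' *m jlin (jtgt W) + v *m jlin (jtgt (h *m D'))))
     (row_mx (jtgt (u' *m jlin W + u *m jlin (h *m D')))
       (w' *m jlin (jtgt W) + w *m jlin (jtgt (h *m D'))
        + (v' *m jlin (u *m jlin W) + v *m jlin (u' *m jlin W + u *m jlin (h *m D')))))) := E2.
rewrite E in E1; rewrite tE E' in E2.
have t c : jtgt (u' *m jlin W + jmk 0 k c) = jtgt (u' *m jlin W) + k.
  by rewrite jtgtD; congr (_ + _); exact: (jmkK _ _ _).1.2.
have l c : jlin (u' *m jlin W + jmk 0 k c) = jlin (u' *m jlin W) + c.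
  by rewrite jlinD; congr (_ + _); exact: (jmkK _ _ _).2.
rewrite t l in E1; rewrite t l in E2.
have [P1 P2] := Pi_row E1 E2.
split; [exact: P1|apply: etrans P2 _].
have alg (a b c : 'rV[R]_n) (L : 'M[R]_n) :
    a + (b + v *m (L + C)) - (a + (b + v *m (L + C'))) = v *m (C - C').
  by rewrite !mulmxDr mulmxN !addrA; set e := a + b + _; rewrite opprD addrACA subrr add0r.
exact: alg.
Qed.

Lemma Pi_flip (j : gspace (B111nh M)) (v u w h v' u' w' k : 'rV[R]_n) (C C' : 'M[R]_n) :
  gset j -> gset (flip j) ->
  u *m jlin (h *m j.2) = jmk 0 k C -> h *m jlin (u *m j.2) = jmk 0 k C' ->
  let V : TB (TB (TB M)) := (((j.1.1, v), row_mx u w), row_mx (row_mx h v') (row_mx u' w')) in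
  same_projections (act3 j V) (act3 (flip j) V) /\
  Pi (act3 j V) (act3 (flip j) V) = v *m (C - C').
Proof.
case: j => p D gj gf E E'; have [_ F2 F3] := flipP D h.
exact: (Pi_act3 v w v' u' w' gj gf F2 E (etrans (F3 u) E')).
Qed.

Lemma Pi_affine_ext3 (xi : gspace (B1 M)) (v u w h v' u' w' : 'rV[R]_n) :
  gset xi -> preserves_torsion s xi ->
  let V : TB (TB (TB M)) := (((xi.1.1, v), row_mx u w), row_mx (row_mx h v') (row_mx u' w')) in
  let j := affine_ext3 s xi in
  same_projections (act3 j V) (act3 (kappaJ j) V) /\
  Pi (act3 j V) (act3 (kappaJ j) V) = app xi (curvature_at s xi.1.1 h u v)
    - curvature_at s xi.1.2 (app xi h) (app xi u) (app xi v).
Proof.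
move=> gxi tors V j; have K : kappaJ j = flip j := kappaJ_affine_ext3 hs gxi.
have C := aff_form2_sub hs h u v tors.
rewrite K; suff [P1 P2] : same_projections (act3 j V) (act3 (flip j) V) /\
    Pi (act3 j V) (act3 (flip j) V) = v *m (aff_form2 s xi h u - aff_form2 s xi u h).
  by split; [exact: P1|exact: etrans P2 C].
have [gj j1 DE] := affine_ext3P hs gxi.
have gf := flip_affine_ext3 hs gxi.
have [_ _ G3] := DE h; have [_ _ H3] := DE u.
have xE : j.1.1 = xi.1.1 := congr1 fst j1.
have := Pi_flip v w v' u' w' gj gf (G3 u).
(* Torsion invariance supplies the common component k, so that the images under p_** agree. *)
rewrite (aff_form_sym hs h u tors) => /(_ _ (H3 h)).
by rewrite xE.
Qed.

Lemma kappaJ_affine_ext3_id (xi : gspace (B1 M)) : gset xi ->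
  preserves_torsion s xi -> preserves_curvature s xi ->
  kappaJ (affine_ext3 s xi) = affine_ext3 s xi.
Proof.
move=> gxi tors curv; apply: etrans (kappaJ_affine_ext3 hs gxi) _.
have [_ _ DE] := affine_ext3P hs gxi; set j := affine_ext3 s xi in DE *.
(* The curvature formula holds for every v, so invariance of the curvature identifies the two
   third-order parts as matrices. *)
have CE h u : aff_form2 s xi u h = aff_form2 s xi h u.
  apply: rows_eq => v; have := aff_form2_sub hs h u v tors.
  have -> : curvature_at s xi.1.2 (app xi h) (app xi u) (app xi v) =
    app xi (curvature_at s xi.1.1 h u v) by exact: curv.
  have alg (A B : 'M[R]_n) (c : 'rV[R]_n) : v *m (A - B) = c - c -> v *m B = v *m A.
    by rewrite subrr mulmxBr => /eqP; rewrite subr_eq0 => /eqP.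
  exact: alg.
have eta (A B : Type) (q : A * B) (b : B) : b = q.2 -> (q.1, b) = q by case: q => ? ? /= ->.
apply: eta; apply: rows_eq => h.
have [F1 F2 F3] := flipP j.2 h; have [G1 G2 G3] := DE h.
apply: jmk_eq; [exact: etrans F1 (esym G1)|exact: F2|].
apply: rows_eq => u; have [_ _ H3] := DE u.
apply: etrans (F3 u) _; apply: etrans (H3 h) _; apply: etrans (esym (G3 u)).
by rewrite (aff_form_sym hs u h tors) CE.
Qed.

End Main.

Theorem proposition7p3 (R : realType) (n : nat) (M : manifold R n)
    (s : M -> gspace (B11nh M)) (hs : symmetry_jet s)
    (xi : gspace (B1 M)) (hxi : gset xi) (htors : preserves_torsion s xi) :
  (forall X Y Z : vfield M,
     smooth_vfield X -> smooth_vfield Y -> smooth_vfield Z ->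
     let x := gsrc xi in
     let XX : TB (TB (TB M)) := tmap (tmap (sec Z)) (tmap (sec Y) (x, X x)) in
     same_projections (act3 (affine_ext3 s xi) XX)
       (act3 (kappaJ (affine_ext3 s xi)) XX) /\
     Pi (act3 (affine_ext3 s xi) XX) (act3 (kappaJ (affine_ext3 s xi)) XX)
     = app xi (curvature_at s x (X x) (Y x) (Z x))
       - curvature_at s (gtgt xi) (app xi (X x)) (app xi (Y x))
           (app xi (Z x))) /\
  (preserves_curvature s xi -> kappaJ (affine_ext3 s xi) = affine_ext3 s xi).
Proof.
split; last exact: kappaJ_affine_ext3_id.
move=> X Y Z sX sY sZ x XX.
(* The slots h, u, v are filled by the values of X, Y, Z, which fixes the order of the arguments of
   the curvature. *)
have [w [v' [u' [w' E]]]] := T3_sec_row X (sY x) sZ.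
have -> : XX = (((x, Z x), row_mx (Y x) w), row_mx (row_mx (X x) v') (row_mx u' w')) := E.
exact: Pi_affine_ext3.
Qed.
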